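(* Let $n\ge 2$ and $Q\ge 1$. There exists $\alpha>0$ depending only on $Q$ and $n$ such that the following holds. Let $\Omega\subset\mathbb{R}^n$ be a domain, let $(X,d)$ be an NPC space, and let $u\colon\Omega\to X$ be a $Q$-quasi-$n$-harmonic mapping. Then $u$ has a locally $\alpha$-Hölder continuous representative.
   Context: **Sobolev mappings (Korevaar–Schoen).** Let $\Omega\subset\mathbb{R}^n$ be a domain (open connected set), $(X,d)$ a metric space and $p>1$. $L^p(\Omega,X)$ is the set of (a.e.-equivalence classes of) measurable maps $u\colon\Omega\to X$ with essentially separable range such that $d(u(\cdot),a)\in L^p(\Omega)$ for some $a\in X$. For $\epsilon>0$ let $\Omega_\epsilon=\{z\in\Omega: \mathrm{dist}(z,\partial\Omega)>\epsilon\}$ and $$e^u_{p,\epsilon}(x)=\frac{1}{|B_\epsilon(x)|}\int_{B_\epsilon(x)}\frac{d^p(u(x),u(y))}{\epsilon^p}\,dy\quad (x\in\Omega_\epsilon),\qquad e^u_{p,\epsilon}(x)=0\quad(x\in\Omega\setminus\Omega_\epsilon).$$ For $f\in C_c(\Omega)$ (continuous, compactly supported) set $E^u_{p,\epsilon}(f)=c(n,p)\int_\Omega f\,e^u_{p,\epsilon}\,dx$, where $c(n,p)>0$ is a fixed normalization constant. Then $u\in W^{1,p}(\Omega,X)$ means $u\in L^p(\Omega,X)$ and $$E_p(u):=\sup_{f\in C_c(\Omega),\,0\le f\le 1}\ \limsup_{\epsilon\to0}E^u_{p,\epsilon}(f)<\infty .$$ $E_p(u)$ is called the $p$-energy of $u$;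 for a domain $\Omega'\subset\Omega$, $E_p(u|_{\Omega'})$ is the $p$-energy of the restriction of $u$ to $\Omega'$. **Quasi-$n$-harmonic mappings.** For $Q\ge1$, a mapping $u\in W^{1,n}(\Omega,X)$, $\Omega\subset\mathbb{R}^n$ a domain, is $Q$-quasi-$n$-harmonic if $E_n(u|_{\Omega'})\le Q\cdot E_n(v|_{\Omega'})$ for every relatively compact domain $\Omega'\subset\Omega$ (i.e. closure compact and contained in $\Omega$) and every $v\in W^{1,n}(\Omega,X)$ with $u=v$ almost everywhere in $\Omega\setminus\Omega'$. **NPC spaces.** A complete metric space $(X,d)$ is NPC (non-positively curved in the sense of Alexandrov) if: (i) any two points $P,Q\in X$ are joined by a rectifiable curve whose length is $d(P,Q)$ (a geodesic); (ii) for any $P,Q,R\in X$, any choice of geodesics connecting them, and any $0<\lambda<1$, the point $Q_\lambda$ on the geodesic from $Q$ to $R$ with $d(Q_\lambda,Q)=\lambda d(Q,R)$ and $d(Q_\lambda,R)=(1-\lambda)d(Q,R)$ satisfies $$d^2(P,Q_\lambda)\le(1-\lambda)d^2(P,Q)+\lambda d^2(P,R)-\lambda(1-\lambda)d^2(Q,R).$$ A representative of $u$ is a map equal to $u$ almost everywhere. *)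

(* Defs.v *)
From HB Require Import structures.
From mathcomp Require Import all_boot all_order all_algebra.
From mathcomp Require Import all_classical all_reals all_analysis.

Set Implicit Arguments.
Unset Strict Implicit.
Unset Printing Implicit Defensive.

Import Order.TTheory GRing.Theory Num.Theory.
Import numFieldNormedType.Exports.

Local Open Scope classical_set_scope.
Local Open Scope ring_scope.

Section cover_outer_measure.
Local Open Scope ereal_scope.
Context {R : realType} (T I : Type) (cov : I -> set T) (w : I -> \bar R).
Hypothesis w_ge0 : forall i, 0 <= w i.
Variable i0 : I.
Hypothesis w_i0 : w i0 = 0.

Definition cover_of (A : set T) : set (nat -> I) :=
  [set C | A `<=` \bigcup_k cov (C k)].

Definition cover_outer (A : set T) : \bar R :=
  ereal_inf [set \sum_(k <oo) w (C k) | C in cover_of A].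

Lemma le_cover_outer : {homo cover_outer : A B / A `<=` B >-> A <= B}.
Proof.
move=> A B AB; apply/ereal_inf_le_tmp => x [C BC <-{x}].
by exists C => //; exact: subset_trans AB BC.
Qed.

Lemma cover_outer_ge0 A : 0 <= cover_outer A.
Proof.
by apply: le_ereal_inf_tmp => x [C AC <-{x}]; exact: nneseries_ge0.
Qed.

Lemma cover_outer0 : cover_outer set0 = 0.
Proof.
apply/eqP; rewrite eq_le cover_outer_ge0 andbT.
apply: ereal_inf_lbound; exists (fun=> i0) => //.
by rewrite eseries0.
Qed.

Lemma cover_outer_sigma_subadditive : sigma_subadditive cover_outer.
Proof.
move=> A; have [[i ioo]|] := pselect (exists i, cover_outer (A i) = +oo).
  rewrite (eseries_pinfty _ _ ioo) ?leey// => n _.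
  by rewrite -ltNye (lt_le_trans _ (cover_outer_ge0 _)).
rewrite -forallNE => Aoo.
suff add2e (e : {posnum R}) : cover_outer (\bigcup_n A n) <=
    \sum_(i <oo) cover_outer (A i) + e%:num%:E.
  by apply/lee_addgt0Pr => _/posnumP[].
rewrite (le_trans _ (epsilon_trick _ _ _))//; last first.
  by move=> n; exact: cover_outer_ge0.
pose P n (C : nat -> I) := cover_of (A n) C /\
  \sum_(k <oo) w (C k) <= cover_outer (A n) + (e%:num / (2 ^ n.+1)%:R)%:E.
have [G PG] : {G : nat -> nat -> I & forall n, P n (G n)}.
  apply: (@choice _ _ P) => n; rewrite /P /cover_outer.
  set S := (X in ereal_inf X); move infS : (ereal_inf S) => iS.
  case: iS infS => [r Sr|Soo|Soo].
  - have en1 : (0 < e%:num / (2 ^ n.+1)%:R)%R by [].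
    have /(lb_ereal_inf_adherent en1) : ereal_inf S \is a fin_num by rewrite Sr.
    move=> [x [C AnC <-] xS].
    by exists C; split => //; rewrite -Sr; exact/ltW.
  - by have := Aoo n; rewrite /cover_outer Soo.
  - suff : lbound S 0 by move/le_ereal_inf_tmp; rewrite Soo.
    by move=> /= _ [C AnC <-]; exact: nneseries_ge0.
pose W := w \o uncurry G.
have W_ge0 x : 0 <= W x by exact: w_ge0.
apply: (@le_trans _ _ (\esum_(i in setT) W i)).
  apply: ereal_inf_lbound => /=.
  have /card_esym/ppcard_eqP[f] := card_nat2.
  exists (uncurry G \o f).
    move=> t [i _ /(PG i).1[j _ Gijt]]; exists (f^-1%FUN (i, j)) => //=.
    by rewrite invK ?inE.
  rewrite -(esum_pred_image W _ xpredT) ?[fun=> _]set_true//.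
  by rewrite image_eq.
rewrite (_ : esum _ _ = \sum_(i <oo) \sum_(j <oo) w (G i j)); last first.
  pose J : nat -> set (nat * nat) := fun i => [set (i, j) | j in setT].
  rewrite (_ : setT = \bigcup_k J k); last first.
    by rewrite predeqE => -[a b]; split => // _; exists a => //; exists b.
  rewrite esum_bigcupT /=; last 2 first.
    - apply/trivIsetP => i j _ _ ij.
      rewrite predeqE => -[n m] /=; split => //= -[] [_] _ [<-{n} _].
      by move=> [m' _] [] /esym/eqP; rewrite (negbTE ij).
    - by move=> [n m]; exact: W_ge0.
  rewrite -(image_id [set: nat]) -fun_true esum_pred_image//; last first.
    by move=> n _; exact: esum_ge0.
  apply: eq_eseriesr => /= j _.
  rewrite -(esum_pred_image W (pair j) predT)//=; last first.
    by move=> ? ? _ _; exact: (@can_inj _ _ _ snd).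
  by congr esum; rewrite predeqE => -[a b]; split; move=> [i _ <-]; exists i.
apply: lee_nneseries => n *; first exact: nneseries_ge0.
exact: (PG n).2.
Qed.

End cover_outer_measure.

Section lebesgue_rV.
Context (R : realType) (n : nat).

(* [None] is the empty set: this makes finite covers available, which matters
   for [n = 0] where every box has volume 1. *)
Definition rV_box (I : option ('rV[R]_n * 'rV[R]_n)) : set 'rV[R]_n :=
  if I is Some (a, b)
  then [set x | forall i, a ord0 i < x ord0 i <= b ord0 i] else set0.

Definition rV_volume (I : option ('rV[R]_n * 'rV[R]_n)) : \bar R :=
  if I is Some (a, b)
  then (\prod_i Num.max 0 (b ord0 i - a ord0 i))%:E else 0%E.

Definition lebesgue_outer : set 'rV[R]_n -> \bar R :=
  cover_outer rV_box rV_volume.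

Lemma rV_volume_ge0 I : (0 <= rV_volume I)%E.
Proof.
case: I => [[a b]|] //=; rewrite lee_fin prodr_ge0// => i _.
by rewrite le_max lexx.
Qed.

HB.instance Definition _ := isOuterMeasure.Build R 'rV[R]_n lebesgue_outer
  (cover_outer0 rV_box rV_volume_ge0 (i0 := None) erefl)
  (cover_outer_ge0 rV_box rV_volume_ge0)
  (@le_cover_outer R _ _ rV_box rV_volume)
  (cover_outer_sigma_subadditive rV_box rV_volume_ge0).

(* The sigma-algebra of [lebesgue_rVType] is that of the Lebesgue-measurable
   (i.e. Caratheodory-measurable) sets. *)
Definition lebesgue_rVType := caratheodory_type lebesgue_outer.

HB.instance Definition _ := Measurable.on lebesgue_rVType.

Definition lebesgue_rV : set lebesgue_rVType -> \bar R := lebesgue_outer.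

Let lebesgue_rV0 : lebesgue_rV set0 = 0%E.
Proof. exact: outer_measure0. Qed.

Let lebesgue_rV_ge0 A : (0 <= lebesgue_rV A)%E.
Proof. exact: outer_measure_ge0. Qed.

Let lebesgue_rV_sigma_additive : semi_sigma_additive lebesgue_rV.
Proof. exact: caratheodory_measure_sigma_additive. Qed.

HB.instance Definition _ := isMeasure.Build _ lebesgue_rVType R lebesgue_rV
  lebesgue_rV0 lebesgue_rV_ge0 lebesgue_rV_sigma_additive.

End lebesgue_rV.
Arguments lebesgue_rV {R n}.

(* The library norm on ['rV[R]_n] is the sup norm; it induces the usual
    topology, but balls and distances below are Euclidean. *)

Section euclidean.
Context {R : realType} {n : nat}.
Implicit Types (x y : 'rV[R]_n) (A W : set 'rV[R]_n).

Definition enorm x : R := Num.sqrt (\sum_i x ord0 i ^+ 2).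

Definition eball x (r : R) : set 'rV[R]_n := [set y | enorm (x - y) < r].

Definition boundary A : set 'rV[R]_n := closure A `\` interior A.

(* equal to [+oo] when [A] is empty *)
Definition edist_to x A : \bar R := ereal_inf [set (enorm (x - y))%:E | y in A].

Definition domain W := [/\ W !=set0, open W & connected W].

Definition inner_part W (e : R) : set 'rV[R]_n :=
  [set z | W z /\ (e%:E < edist_to z (boundary W))%E].

(* Extension by zero identifies the functions of C_c(W) with these. *)
Definition Cc W : set ('rV[R]_n -> R) :=
  [set f | let S := closure [set x | f x != 0] in
           [/\ continuous f, compact S & S `<=` W]].

End euclidean.

(* A map [W -> X] is represented by a total function ['rV[R]_n -> X] whose
    values outside [W] are never used. *)

Section sobolev.
Context {R : realType} {n : nat} {X : metricType R}.
Implicit Types (W : set 'rV[R]_n) (u v : 'rV[R]_n -> X) (p : R).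

Definition lebesgue_measurable_map W u :=
  forall U : set X, open U ->
    measurable (W `&` u @^-1` U : set (lebesgue_rVType R n)).

Definition separable_set (A : set X) :=
  exists D : set X, [/\ countable D, D `<=` A & A `<=` closure D].

Definition essentially_separable_range W u :=
  exists N : set (lebesgue_rVType R n),
    lebesgue_rV.-negligible N /\ separable_set (u @` (W `\` N)).

Definition Lp_map p W u :=
  [/\ lebesgue_measurable_map W u,
      essentially_separable_range W u &
      exists a : X, lebesgue_rV.-integrable (W : set (lebesgue_rVType R n))
        (fun x => (mdist (u x) a `^ p)%:E)].

Definition energy_density p (e : R) W u (x : 'rV[R]_n) : \bar R :=
  if x \in inner_part W e then
    ((fine (lebesgue_rV (eball x e)))^-1%:E *
     \int[lebesgue_rV]_(y in eball x e)
        (mdist (u x) (u y) `^ p / e `^ p)%:E)%E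
  else 0%E.

(* the normalization constant c(n, p) of the energy *)
Variable c : nat -> R -> R.

Definition approx_energy p (e : R) W u (f : 'rV[R]_n -> R) : \bar R :=
  ((c n p)%:E *
   \int[lebesgue_rV]_(x in W) ((f x)%:E * energy_density p e W u x))%E.

Definition energy p W u : \bar R :=
  ereal_sup [set limf_esup (fun e => approx_energy p e W u f) 0^'+ |
             f in [set f | Cc W f /\ forall x, 0 <= f x <= 1]].

Definition sobolev p W u := Lp_map p W u /\ (energy p W u < +oo)%E.

Definition quasi_n_harmonic (Q : R) W u :=
  sobolev n%:R W u /\
  forall W' v, domain W' -> compact (closure W') -> closure W' `<=` W ->
    sobolev n%:R W v ->
    {ae lebesgue_rV, forall x, (W `\` W') x -> u x = v x} ->
    (energy n%:R W' u <= Q%:E * energy n%:R W' v)%E.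

Definition representative W u v :=
  {ae lebesgue_rV, forall x, W x -> v x = u x}.

Definition locally_hoelder (alpha : R) W v :=
  forall x, W x -> exists2 U, nbhs x U & exists C : R,
    forall y z, (W `&` U) y -> (W `&` U) z ->
      mdist (v y) (v z) <= C * enorm (y - z) `^ alpha.

End sobolev.

Section npc.
Context {R : realType} (X : metricType R).

Definition curve_length (g : R -> X) : \bar R :=
  ereal_sup [set (let F := g \o nth 1 (0 :: s) in
                  \sum_(0 <= k < size s) mdist (F k) (F k.+1))%:E |
             s in itv_partition 0 1].

Definition geodesic (g : R -> X) (P Q : X) :=
  [/\ {within `[0, 1], continuous g}, g 0 = P, g 1 = Q &
      curve_length g = (mdist P Q)%:E].

Definition complete_metric :=
  forall F : set_system X, ProperFilter F -> cauchy F -> exists x : X, F --> x.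

Definition NPC :=
  [/\ complete_metric,
      forall P Q : X, exists g, geodesic g P Q &
      forall (P Q S : X) (gPQ gQS gSP : R -> X),
        geodesic gPQ P Q -> geodesic gQS Q S -> geodesic gSP S P ->
        forall l t : R, 0 < l < 1 -> 0 <= t <= 1 ->
          mdist (gQS t) Q = l * mdist Q S ->
          mdist (gQS t) S = (1 - l) * mdist Q S ->
          mdist P (gQS t) ^+ 2 <=
            (1 - l) * mdist P Q ^+ 2 + l * mdist P S ^+ 2 -
            l * (1 - l) * mdist Q S ^+ 2].

End npc.

(* Main.v *)
(* The energy of [u] over a set V is compared, up to constants, with
   L(V) = liminf_(e -> 0) e^(-2n) \int_(x in V) \int_(|x - y| < e) d(u x, u y)^n.
   Writing a long displacement as a chain of e-steps turns L into a Poincare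
   inequality, with no differential structure on X.
   Hole filling: in the annulus between two concentric cubes pick, by Poincare,
   a value z0 with \int d(u, z0)^n <= C r^n L(annulus); contracting u along the
   geodesics to z0 inside the smaller cube gives a competitor whose energy is
   at most C L(annulus). Only here is X NPC: the contraction towards z0 is
   Lipschitz. Quasi-minimality gives L(small) <= C (L(big) - L(small)), i.e.
   L(small) <= theta L(big) with theta = C / (C + 1) depending on n and Q only.
   Since n is the dimension, the Poincare inequality is scale invariant, so the
   geometric decay of L makes the means of d(u x, .) over shrinking cubes
   telescope at almost every x (Morrey). This is a Hoelder estimate on a dense
   set, with exponent alpha given by theta = 8^(- alpha n), and it extends by
   completeness. *)
Require Import Defs.
From HB Require Import structures.
From mathcomp Require Import all_boot all_order all_algebra.
From mathcomp Require Import all_classical all_reals all_analysis.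
From mathcomp Require Import measurable_realfun ring lra zify.

Set Implicit Arguments.
Unset Strict Implicit.
Unset Printing Implicit Defensive.

Import Order.TTheory GRing.Theory Num.Theory.
Import numFieldNormedType.Exports.

Local Open Scope classical_set_scope.
Local Open Scope ring_scope.

(** * Lebesgue measure on R^n *)

(** The Korevaar-Schoen energy is a limsup, but hole filling adds the energies of two disjoint sets,
    which needs superadditivity: hence a liminf. Chaining reconciles the two: the finite-difference
    integral over a set at any one scale, not only in the limit, is at most a constant times the
    liminf energy of a neighbourhood. So the limsup energy of the competitor is bounded by a liminf
    energy of [u]. Each use costs a neighbourhood, which dictates the nested cubes of radii [r],
    [3/2 r], [2 r], [3 r], [4 r], [8 r]. Up to the construction of the competitor only the
    pulled-back distance of [u x] and [u y] matters, so that part is written for a pseudometric on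
    R^n. Sup-norm balls replace Euclidean balls because they are boxes; the comparison costs factors
    depending on [n]. The given map is arbitrary on a null set and outside the domain. It is
    replaced by a measurable modification with separable range, and enters the estimates only
    through integrals that are compared without proving their integrands measurable. The
    normalization [c n n] cancels, so the exponent does not depend on it. *)

Section box_volume.
Context {R : realType}.
Implicit Types (a b x : nat -> R) (m : nat).

Definition in_box m a b x := [forall i : 'I_m, a i < x i <= b i].

Definition box_volume m a b := \prod_(i < m) Num.max 0 (b i - a i).

Lemma box_volume_ge0 m a b : 0 <= box_volume m a b.
Proof. by apply: prodr_ge0 => i _; rewrite le_max lexx. Qed.

Lemma in_boxS m a b x :
  in_box m.+1 a b x = in_box m a b x && (a m < x m <= b m).
Proof.
apply/forallP/andP => [H|[/forallP H1 H2] i].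
  split; last exact: (H ord_max).
  by apply/forallP => i; exact: (H (widen_ord (leqnSn m) i)).
have [->|/eqP ne] := eqVneq (i : nat) m; first by [].
have lt : (i < m)%N by have := ltn_ord i; lia.
exact: (H1 (Ordinal lt)).
Qed.

Lemma eq_in_box m a b x y : (forall i, (i < m)%N -> x i = y i) ->
  in_box m a b x = in_box m a b y.
Proof. by move=> H; apply: eq_forallb => i; rewrite H. Qed.

Lemma lebesgue_measure_itvoc (s t : R) :
  lebesgue_measure `]s, t]%classic = (Num.max 0 (t - s))%:E :> \bar R.
Proof.
rewrite lebesgue_measure_itv/= lte_fin; case: ltP => h.
  by rewrite -EFinB; congr EFin; apply/esym/max_idPr; rewrite subr_ge0 ltW.
by congr EFin; apply/esym/max_idPl; rewrite subr_le0.
Qed.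

(* Integrating the pointwise inequality one variable at a time replaces the
   indicator of a box by its volume. *)
Lemma le_box_volume_series m a b (c : R) (w : nat -> R)
    (ak bk : nat -> nat -> R) : 0 <= c -> (forall k, 0 <= w k) ->
  (forall x, in_box m a b x ->
     (c%:E <= \sum_(k <oo) (w k * (in_box m (ak k) (bk k) x)%:R)%:E)%E) ->
  ((c * box_volume m a b)%:E <=
     \sum_(k <oo) (w k * box_volume m (ak k) (bk k))%:E)%E.
Proof.
elim: m a b c w ak bk => [|m IH] a b c w ak bk c0 w0 H.
  have b0 : in_box 0 a b (fun=> 0) by apply/forallP => -[].
  rewrite /box_volume big_ord0 mulr1; apply: le_trans (H _ b0) _.
  apply: lee_nneseries => [k _ _|k _]; first by rewrite lee_fin mulr_ge0.
  rewrite lee_fin big_ord0; apply: ler_wpM2l => //.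
  by case: (in_box _ _ _ _).
(* Once the last coordinate [t] is fixed, its indicator is absorbed into the weights; this is why
   the statement carries weights [w] at all. *)
pose ind k (t : R) : R := (t \in `]ak k m, bk k m])%:R.
have indE k t : ind k t = \1_(`]ak k m, bk k m]%classic) t.
  by rewrite indicE mem_setE.
have step t : (a m < t <= b m) ->
    ((c * box_volume m a b)%:E <=
     \sum_(k <oo) (w k * ind k t * box_volume m (ak k) (bk k))%:E)%E.
  move=> ht; apply: IH => // [k|x xab].
    by rewrite mulr_ge0// /ind; case: (_ \in _).
  pose x' i := if i == m then t else x i.
  have exx i : (i < m)%N -> x' i = x i.
    by rewrite /x'; case: eqP => // ->; rewrite ltnn.
  have : in_box m.+1 a b x'.
    by rewrite in_boxS (eq_in_box _ _ exx) xab/= /x' eqxx.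
  move=> /H /le_trans; apply; apply: lee_nneseries => [k _ _|k _].
    by rewrite lee_fin mulr_ge0.
  rewrite lee_fin in_boxS (eq_in_box _ _ exx) /x' eqxx /ind in_itv/= -mulrA.
  by rewrite -natrM mulnb andbC.
have mI (s t : R) : measurable (`]s, t]%classic : set R).
  exact: measurable_itv.
pose g k (t : R) : R := w k * ind k t * box_volume m (ak k) (bk k).
have mf k : measurable_fun (`]a m, b m]%classic : set R) (EFin \o g k).
  apply/measurable_EFinP; apply: measurable_funM => //.
  apply: measurable_funM => //; rewrite (_ : ind k = \1_(`]ak k m, bk k m]%classic)); last exact/funext/indE.
  exact: measurable_indic.
have f0 k t : (0 <= (EFin \o g k) t)%E.
  by rewrite lee_fin !mulr_ge0// ?box_volume_ge0// /ind; case: (_ \in _).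
rewrite {1}/box_volume big_ord_recr/= mulrA EFinM -lebesgue_measure_itvoc.
rewrite -integral_cst//; apply: (@le_trans _ _
  (\int[lebesgue_measure]_(t in `]a m, b m]%classic)
     \sum_(k <oo) (EFin \o g k) t)%E).
  apply: ge0_le_integral => //=.
  - by move=> t _; rewrite lee_fin mulr_ge0// box_volume_ge0.
  - apply: ge0_emeasurable_sum; first by move=> k t _ _; exact: f0.
    by move=> k _; exact: mf.
rewrite integral_nneseries//; apply: lee_nneseries => k *.
  by apply: integral_ge0.
rewrite [X in (_ <= (_ * X)%:E)%E]/box_volume big_ord_recr/= mulrA [leRHS]EFinM -lebesgue_measure_itvoc.
rewrite -/(box_volume m (ak k) (bk k)).
under eq_integral => t _.
  rewrite (_ : (g k t)%:E = (w k * box_volume m (ak k) (bk k))%:E *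
    (\1_(`]ak k m, bk k m]%classic) t)%:E)%E; last first.
    by rewrite /g indE -EFinM; congr EFin; ring.
  over.
rewrite ge0_integralZl//=.
- rewrite lee_wpmul2l ?lee_fin ?mulr_ge0 ?box_volume_ge0//.
  by rewrite integral_indic// le_measure ?inE//; exact: measurableI.
- by apply/measurable_EFinP; exact: measurable_indic.
- by rewrite lee_fin mulr_ge0 ?box_volume_ge0.
Qed.

End box_volume.

Lemma max0_cut {R : realType} (a b t : R) :
  Num.max 0 (b - a) = Num.max 0 (Num.min b t - a) + Num.max 0 (b - Num.max a t).
Proof.
have H (x : R) : Num.max 0 x = if 0 < x then x else 0 by rewrite maxElt.
rewrite !H minElt maxElt.
case: (ltP a t) => at'; case: (ltP b t) => bt;
  do ![case: ifPn; rewrite -?leNgt => ?]; lra.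
Qed.

Section lebesgue_rV_theory.
Context {R : realType} {n : nat}.
Local Notation T := (lebesgue_rVType R n).
Local Notation mu := (@lebesgue_rV R n).
Implicit Types (x y a b : 'rV[R]_n).

Definition coords a (i : nat) : R := if insub i is Some j then a ord0 j else 0.

Lemma coordsE a (i : 'I_n) : coords a i = a ord0 i.
Proof. by rewrite /coords valK. Qed.

Lemma in_box_coords a b x :
  in_box n (coords a) (coords b) (coords x) <-> rV_box (Some (a, b)) x.
Proof.
split=> [/forallP H i|H]; first by have := H i; rewrite !coordsE.
by apply/forallP => i; rewrite !coordsE.
Qed.

Lemma box_volume_coords a b :
  box_volume n (coords a) (coords b) = \prod_i Num.max 0 (b ord0 i - a ord0 i).
Proof. by apply: eq_bigr => i _; rewrite !coordsE. Qed.

(** The nontrivial inequality, that a countable cover cannot have smaller total volume, is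
    [le_box_volume_series] with constant 1. *)
Lemma lebesgue_outer_box a b :
  lebesgue_outer (rV_box (Some (a, b))) = rV_volume (Some (a, b)).
Proof.
apply/eqP; rewrite eq_le; apply/andP; split.
  apply: ereal_inf_lbound; exists (fun k => if k == 0%N then Some (a, b) else None).
    by move=> x ?; exists 0%N.
  rewrite nneseries_recl//; last by move=> k _; exact: rV_volume_ge0.
  by rewrite eseries0 ?adde0// => -[].
apply: le_ereal_inf_tmp => _ [C HC <-].
(* [None] becomes the box from 0 to 0 with weight 0. Its volume alone would not do: for [n = 0]
   every box has volume 1. *)
pose w k : R := if C k is Some _ then 1 else 0.
pose ak k := coords (if C k is Some p then p.1 else 0).
pose bk k := coords (if C k is Some p then p.2 else 0).
rewrite /= -box_volume_coords -[box_volume _ _ _]mul1r.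
rewrite (_ : (fun m => _) =
  fun m => (\sum_(0 <= k < m) (w k * box_volume n (ak k) (bk k))%:E)%E).
  2:{ apply/funext => m; apply: eq_bigr => k _; rewrite /w /ak /bk.
      case: (C k) => [[a' b']|] /=; rewrite ?mul0r// mul1r box_volume_coords//. }
apply: le_box_volume_series => //.
  by move=> k; rewrite /w; case: (C k).
move=> x xab; pose y : 'rV[R]_n := \row_i x i.
have eqxy c d : in_box n c d x = in_box n c d (coords y).
  apply: eq_in_box => i ilt; rewrite -[i]/(nat_of_ord (Ordinal ilt)) coordsE.
  by rewrite mxE.
have /in_box_coords/HC[k _] : in_box n (coords a) (coords b) (coords y).
  by rewrite -eqxy.
move=> Hk; rewrite (@nneseriesD1 _ _ k)//; last first.
  by move=> j _; rewrite lee_fin mulr_ge0// /w; case: (C j).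
rewrite (_ : (w k * _)%:E = 1%E).
  by rewrite leeDl// nneseries_ge0// => j *; rewrite lee_fin mulr_ge0// /w; case: (C j).
rewrite eqxy /w /ak /bk; case: (C k) Hk => [[a' b']|]//= /in_box_coords ->.
by rewrite mulr1.
Qed.

(** A hyperplane orthogonal to an axis cuts each box of a cover into two boxes whose volumes add up,
    so any cover of the test set splits into covers of its two parts at no extra cost. *)
Lemma measurable_halfspace (i : 'I_n) (t : R) :
  measurable ([set x | x ord0 i <= t] : set T).
Proof.
apply: le_caratheodory_measurable => A; apply: le_ereal_inf_tmp => _ [C HC <-].
pose cutl (I : option ('rV[R]_n * 'rV[R]_n)) := if I is Some (a, b) then
  Some (a, \row_j if j == i then Num.min (b ord0 j) t else b ord0 j) else None.
pose cutr (I : option ('rV[R]_n * 'rV[R]_n)) := if I is Some (a, b) then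
  Some (\row_j if j == i then Num.max (a ord0 j) t else a ord0 j, b) else None.
have cutE I : rV_volume I = (rV_volume (cutl I) + rV_volume (cutr I))%E.
  case: I => [[a b]|] /=; last by rewrite adde0.
  rewrite -EFinD; congr EFin; rewrite (bigD1 i)//= [in X in _ = X + _](bigD1 i)//=.
  rewrite [in X in _ = _ + X](bigD1 i)//= !mxE eqxx.
  set p := \prod_(_ | _) _.
  have -> : \prod_(j | j != i) Num.max 0
     ((\row_j (if j == i then Num.min (b ord0 j) t else b ord0 j)) ord0 j -
      a ord0 j) = p by apply: eq_bigr => j /negbTE ji; rewrite mxE ji.
  have -> : \prod_(j | j != i) Num.max 0 (b ord0 j -
     (\row_j (if j == i then Num.max (a ord0 j) t else a ord0 j)) ord0 j) = p.
    by apply: eq_bigr => j /negbTE ji; rewrite mxE ji.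
  by rewrite -mulrDl; congr (_ * _); exact: max0_cut.
have -> : (\sum_(k <oo) rV_volume (C k) =
    \sum_(k <oo) rV_volume (cutl (C k)) + \sum_(k <oo) rV_volume (cutr (C k)))%E.
  rewrite -nneseriesD//.
  - by apply: eq_eseriesr => k _; exact: cutE.
  - by move=> k *; exact: rV_volume_ge0.
  - by move=> k *; exact: rV_volume_ge0.
apply: leeD; apply: ereal_inf_lbound.
  exists (cutl \o C) => // x [/HC[k _ Ckx] /= xt]; exists k => //=.
  case: (C k) Ckx => [[a b]|]//= H j; rewrite mxE; have := H j.
  by case: eqP => [->|//]; rewrite le_min xt => /andP[-> ->].
exists (cutr \o C) => // x [/HC[k _ Ckx] /= /negP]; rewrite -ltNge => xt.
exists k => //=; case: (C k) Ckx => [[a b]|]//= H j; rewrite mxE; have := H j.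
by case: eqP => [->|//]; rewrite gt_max xt => /andP[-> ->].
Qed.

Lemma measurable_coord (i : 'I_n) : measurable_fun setT (fun x : T => x ord0 i).
Proof.
move=> _; apply: (measurability _ (RGenOInfty.measurableE R)) => //.
move=> _ [_ [r ->] <-]; rewrite setTI.
suff -> : (fun x : T => x ord0 i) @^-1` `]r, +oo[%classic =
    ~` [set x | x ord0 i <= r].
  exact: measurableC (measurable_halfspace i r).
apply/seteqP; split => x /=; rewrite in_itv/= andbT.
  by rewrite ltNge => /negP.
by move/negP; rewrite -ltNge.
Qed.

End lebesgue_rV_theory.

Lemma measurable_set_bool d (T : measurableType d) (f : T -> bool) :
  measurable_fun setT f -> measurable [set x | f x].
Proof.
move=> /(_ measurableT [set true] I); rewrite setTI. congr measurable.
Qed.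

(** * Comparison of integrals up to null sets *)

Section integral_ae.
Local Open Scope ereal_scope.
Import HBNNSimple.

(* No measurability of [f] and [g] is required: for nonnegative functions the
   integral is a supremum over simple functions. *)
Lemma ge0_le_integral_ae d (T : measurableType d) (R : realType)
    (mu : {measure set T -> \bar R}) (D N : set T) (f g : T -> \bar R) :
  measurable D -> measurable N -> mu N = 0 ->
  (forall x, D x -> 0 <= f x) -> (forall x, D x -> 0 <= g x) ->
  (forall x, D x -> ~ N x -> f x <= g x) ->
  \int[mu]_(x in D) f x <= \int[mu]_(x in D) g x.
Proof.
move=> mD mN N0 f0 g0 fg; rewrite ge0_integralE// ge0_integralE//.
apply: ge_ereal_sup => _ [h hf <-].
(* A simple function [h] below [f] is made zero on [N]: its integral does not change, and it is now
   below [g] everywhere. *)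
have mCN : measurable (~` N) by exact: measurableC.
have pE x : proj_nnsfun h mCN x = (h \_ (~` N)) x by rewrite (mrestrict h mCN).
rewrite -integralT_nnsfun (_ : integral _ _ _ =
  \int[mu]_x (EFin \o proj_nnsfun h mCN) x); last first.
  apply: ge0_ae_eq_integral => //.
  - by apply/measurable_EFinP.
  - by apply/measurable_EFinP.
  - by move=> x _; rewrite lee_fin.
  - by move=> x _; rewrite lee_fin.
  - exists N; split => // x /= /existsNP[_ H]; apply: contrapT => Nx.
    apply: H; congr EFin; apply/esym; apply: (etrans (pE x)).
    by rewrite patchE mem_set.
rewrite integralT_nnsfun; apply: ereal_sup_ubound.
exists (proj_nnsfun h mCN) => // x; rewrite pE [X in X%:E]patchE.
case: ifPn => [/set_mem Nx|_]; last first.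
  by rewrite patchE; case: ifPn => // /set_mem; exact: g0.
have := hf x; rewrite !patchE; case: ifPn => // /set_mem Dx /le_trans; apply.
exact: fg.
Qed.

Lemma ge0_le_integral_pointwise d (T : measurableType d) (R : realType)
    (mu : {measure set T -> \bar R}) (D : set T) (f g : T -> \bar R) :
  measurable D -> (forall x, D x -> 0 <= f x) ->
  (forall x, D x -> f x <= g x) ->
  \int[mu]_(x in D) f x <= \int[mu]_(x in D) g x.
Proof.
move=> mD f0 fg; apply: (@ge0_le_integral_ae _ _ _ _ _ set0) => //.
  by move=> x Dx; exact: le_trans (f0 _ Dx) (fg _ Dx).
by move=> x Dx _; exact: fg.
Qed.

End integral_ae.

(** * Cubes, their measure, and translations *)

Section cubes.
Context {R : realType} {n : nat}.
Local Notation T := (lebesgue_rVType R n).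
Local Notation mu := (@lebesgue_rV R n).
Implicit Types (x y h : 'rV[R]_n) (r : R).

Definition cube x r : set 'rV[R]_n :=
  [set y | forall i, `|x ord0 i - y ord0 i| < r].

Lemma cube_center x r : 0 < r -> cube x r x.
Proof. by move=> r0 i; rewrite subrr normr0. Qed.

Lemma cube_sym x y r : cube x r y -> cube y r x.
Proof. by move=> H i; rewrite distrC. Qed.

Lemma cube_triangle y x z r s : cube x r y -> cube y s z -> cube x (r + s) z.
Proof.
move=> H1 H2 i; rewrite (le_lt_trans (ler_distD (y ord0 i) _ _))//.
by rewrite ltrD.
Qed.

Lemma le_cube x r s : r <= s -> cube x r `<=` cube x s.
Proof. by move=> rs y H i; exact: lt_le_trans (H i) rs. Qed.

Lemma cube_convex x y z r (t : R) : 0 <= t <= 1 -> cube x r y -> cube x r z ->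
  cube x r (y + t *: (z - y)).
Proof.
move=> /andP[t0 t1] Hy Hz i; rewrite !mxE.
set c := x ord0 i; set a := y ord0 i; set b := z ord0 i.
have -> : c - (a + t * (b - a)) = (1 - t) * (c - a) + t * (c - b) by ring.
pose m := Num.max `|c - a| `|c - b|.
have mr : m < r by rewrite gt_max Hy Hz.
apply: le_lt_trans (ler_normD _ _) (le_lt_trans _ mr).
rewrite !normrM (ger0_norm t0) ger0_norm ?subr_ge0//.
rewrite (_ : m = (1 - t) * m + t * m); last by ring.
by apply: lerD; apply: ler_wpM2l; rewrite ?subr_ge0// le_max lexx ?orbT.
Qed.

Lemma ball_cube x r : 0 < r -> ball x r = cube x r.
Proof.
move=> r0; apply/seteqP; split => [y [_ H] i|y H]; first exact: H.
by split=> // j i; rewrite (ord1 j); exact: H.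
Qed.

Lemma nbhs_cubeP x (A : set 'rV[R]_n) :
  nbhs x A <-> exists2 r, 0 < r & cube x r `<=` A.
Proof.
split=> [/nbhs_ballP[r /= r0 H]|[r r0 H]].
  by exists r => //; rewrite -ball_cube.
by apply/nbhs_ballP; exists r => //; rewrite ball_cube.
Qed.

Lemma openP_cube (A : set 'rV[R]_n) :
  open A -> forall x, A x -> exists2 r, 0 < r & cube x r `<=` A.
Proof. by rewrite openE => H x /H /nbhs_cubeP. Qed.

Lemma open_cube x r : open (cube x r).
Proof.
rewrite openE => y H; apply/nbhs_cubeP.
pose t := \big[Num.min/1]_i (r - `|x ord0 i - y ord0 i|).
exists t.
  by rewrite /t; elim/big_ind: _ => [//|a b a0 b0|i _];
    rewrite ?lt_min ?a0 ?b0 ?subr_gt0.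
move=> z Hz i; apply: le_lt_trans (ler_distD (y ord0 i) _ _) _.
rewrite -ltrBrDl (lt_le_trans (Hz i))// /t (bigD1 i)//= ge_min lexx//.
Qed.

Lemma measurable_cube_rel r : measurable ([set p | cube p.1 r p.2] : set (T * T)).
Proof.
rewrite (_ : [set _ | _] = \bigcap_(i in [set: 'I_n])
    [set p : T * T | `|p.1 ord0 i - p.2 ord0 i| < r]); last first.
  by apply/seteqP; split => [y H i _|y H i]; apply: H.
apply: fin_bigcap_measurable => // i _; apply: measurable_set_bool.
apply: measurable_fun_ltr => //; apply: measurableT_comp => //.
apply: measurable_funB.
  by apply: (measurableT_comp (measurable_coord i)); exact: measurable_fst.
by apply: (measurableT_comp (measurable_coord i)); exact: measurable_snd.
Qed.

Lemma measurable_cube x r : measurable (cube x r : set T).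
Proof.
have := measurable_cube_rel r => /(measurable_xsection (x : T)).
by congr measurable; apply/seteqP; split => y; rewrite /xsection/= ?inE.
Qed.

Lemma measurable_eball_rel r :
  measurable ([set p | eball p.1 r p.2] : set (T * T)).
Proof.
have [r0|r0] := leP r 0.
  rewrite (_ : [set _ | _] = set0)//; apply/seteqP; split => // p /=.
  by rewrite /eball/= ltNge (le_trans r0)// sqrtr_ge0.
rewrite (_ : [set _ | _] =
    [set p : T * T | \sum_i (p.1 ord0 i - p.2 ord0 i) ^+ 2 < r ^+ 2]).
  apply: measurable_set_bool; apply: measurable_fun_ltr => //.
  apply: measurable_sum => i; apply: measurable_funX.
  apply: measurable_funB.
    by apply: (measurableT_comp (measurable_coord i)); exact: measurable_fst.
  by apply: (measurableT_comp (measurable_coord i)); exact: measurable_snd.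
have E (p : T * T) : enorm (p.1 - p.2 : 'rV[R]_n) =
    Num.sqrt (\sum_i (p.1 ord0 i - p.2 ord0 i) ^+ 2).
  by congr Num.sqrt; apply: eq_bigr => i _; rewrite !mxE.
have S0 (p : T * T) : 0 <= \sum_i (p.1 ord0 i - p.2 ord0 i) ^+ 2.
  by apply: sumr_ge0 => i _; exact: sqr_ge0.
have K (s : R) : 0 <= s -> (Num.sqrt s < r) = (s < r ^+ 2).
  move=> s0; rewrite -[in RHS](sqr_sqrtr s0) ltr_pXn2r// nnegrE ?sqrtr_ge0//.
  exact: ltW.
by apply/seteqP; split => p; rewrite /eball/= E K.
Qed.

Lemma measurable_eball x r : measurable (eball x r : set T).
Proof.
have := measurable_eball_rel r => /(measurable_xsection (x : T)).
by congr measurable; apply/seteqP; split => y; rewrite /xsection/= ?inE.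
Qed.

(** An open set is the union of the countably many cubes with rational centre and radius
    [1 / (k + 1)] that it contains. *)
Lemma open_measurable_rV (A : set 'rV[R]_n) : open A -> measurable (A : set T).
Proof.
move=> oA; pose c (p : 'rV[rat]_n * nat) := cube (map_mx ratr p.1 : 'rV[R]_n) p.2.+1%:R^-1.
rewrite (_ : A = \bigcup_p (if `[< c p `<=` A >] then c p else set0)).
  apply: countable_bigcupT_measurable => [|p]; first exact: countableP.
  by case: ifP => // _; exact: measurable_cube.
apply/seteqP; split => [x Ax|x [p _]]; last by case: ifPn => // /asboolP /[apply].
have [r r0 H] := openP_cube oA Ax.
have [k kr] : exists k, k.+1%:R^-1 < r / 2.
  have r2 : 0 < r / 2 by lra.
  by have [k] := ltr_add_invr r2; rewrite add0r; exists k.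
have k0 : (0 : R) < k.+1%:R^-1 by rewrite invr_gt0.
have [q Hq] : exists q : 'rV[rat]_n, cube x k.+1%:R^-1 (map_mx ratr q).
  have /choice[q Hq] : forall i : 'I_n, exists q : rat,
      `|x ord0 i - ratr q| < k.+1%:R^-1.
    move=> i; have [|q] := @rat_in_itvoo R (x ord0 i - k.+1%:R^-1)
      (x ord0 i + k.+1%:R^-1); first by rewrite ltrBlDr -addrA ltrDl addr_gt0.
    by rewrite in_itv/= => /andP[q1 q2]; exists q; rewrite ltr_distl ltrBlDr q2 -ltrBlDr q1.
  by exists (\row_i q i) => i; rewrite !mxE.
exists (q, k) => //; rewrite ifT; first exact: cube_sym.
apply/asboolP => y /(cube_triangle Hq) Hy; apply: H.
by apply: le_cube Hy => /=; move: (ltW kr); set t := _^-1 => ?; lra.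
Qed.

End cubes.

Section lebesgue_rV_cube.
Context {R : realType} {n : nat}.
Local Notation T := (lebesgue_rVType R n).
Local Notation mu := (@lebesgue_rV R n).
Implicit Types (x y h : 'rV[R]_n) (r : R).

Lemma lebesgue_rV_box_const x (a b : R) : a <= b ->
  mu (rV_box (Some (x + const_mx a, x + const_mx b))) = ((b - a) ^+ n)%:E.
Proof.
move=> ab; rewrite [LHS]lebesgue_outer_box/=; congr EFin.
rewrite -[X in _ ^+ X]card_ord -prodr_const; apply: eq_bigr => i _.
rewrite !mxE opprD addrACA subrr add0r; apply/max_idPr.
by rewrite subr_ge0.
Qed.

Lemma lebesgue_rV_cube_le x r : 0 <= r -> (mu (cube x r) <= ((2 * r) ^+ n)%:E)%E.
Proof.
move=> r0; rewrite (_ : 2 * r = r - - r); last by ring.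
rewrite -(lebesgue_rV_box_const x); last lra.
apply: le_outer_measure => y H i; have := H i; rewrite !mxE ltr_distl.
by move=> /andP[h1 h2]; apply/andP; split; lra.
Qed.

(** A factor [2 ^ n] is given away so that the open cube contains a half-open box; only two-sided
    bounds are ever used. *)
Lemma lebesgue_rV_cube_ge x r : 0 < r -> ((r ^+ n)%:E <= mu (cube x r))%E.
Proof.
move=> r0; rewrite [X in (X ^+ n)%:E](_ : r = r / 2 - - (r / 2)); last by field.
rewrite -(lebesgue_rV_box_const x); last lra.
apply: le_outer_measure => y H i; have := H i; rewrite !mxE ltr_distl.
by move=> /andP[h1 h2]; apply/andP; split; lra.
Qed.

(** Required by Tonelli's theorem, hence for the measurability of integrals over sections. *)
Lemma lebesgue_rV_sigma_finite : sigma_finite [set: T] mu.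
Proof.
exists (fun k => cube (0 : 'rV[R]_n) k%:R).
  apply/esym; rewrite -subTset => x _.
  pose M := \sum_i `|x ord0 i|.
  exists (Num.truncn M).+1 => // i; rewrite mxE sub0r normrN.
  apply: le_lt_trans (truncnS_gt M).
  by rewrite /M (bigD1 i)//= lerDl sumr_ge0.
move=> k; split; first exact: measurable_cube.
by apply: le_lt_trans (lebesgue_rV_cube_le _ _) _ => //; rewrite ltry.
Qed.

HB.instance Definition _ :=
  @Measure_isSigmaFinite.Build _ T R mu lebesgue_rV_sigma_finite.

Lemma lebesgue_outer_translate_le h (A : set 'rV[R]_n) :
  (lebesgue_outer ((fun x : 'rV[R]_n => (x + h)%R) @^-1` A) <= lebesgue_outer A)%E.
Proof.
apply: le_ereal_inf_tmp => _ [C HC <-].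
pose tr (I : option ('rV[R]_n * 'rV[R]_n)) :=
  if I is Some (a, b) then Some (a - h, b - h) else None.
rewrite (_ : (\sum_(k <oo) _ = \sum_(k <oo) rV_volume (tr (C k)))%E); last first.
  apply: eq_eseriesr => k _; case: (C k) => [[a b]|]//=; congr EFin.
  by apply: eq_bigr => i _; rewrite !mxE opprD addrACA subrr addr0.
apply: ereal_inf_lbound; exists (tr \o C) => // x /HC[k _ Hk]; exists k => //=.
case: (C k) Hk => [[a b]|]//= Hk i; have := Hk i; rewrite !mxE.
by rewrite ltrBlDr lerBrDr.
Qed.

Lemma preimage_translateK h (A : set 'rV[R]_n) :
  (fun x : 'rV[R]_n => (x - h)%R) @^-1` ((fun x : 'rV[R]_n => (x + h)%R) @^-1` A) = A.
Proof. by apply/seteqP; split => x /=; rewrite subrK. Qed.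

Lemma lebesgue_outer_translate h (A : set 'rV[R]_n) :
  lebesgue_outer ((fun x : 'rV[R]_n => (x + h)%R) @^-1` A) = lebesgue_outer A.
Proof.
apply/eqP; rewrite eq_le lebesgue_outer_translate_le/=.
rewrite -{1}(preimage_translateK h A); exact: lebesgue_outer_translate_le.
Qed.

Lemma measurable_translate h :
  measurable_fun setT ((fun x : 'rV[R]_n => x + h) : T -> T).
Proof.
move=> _ A mA; rewrite setTI; apply: le_caratheodory_measurable => X; rewrite le_eqVlt; apply/orP; left; apply/eqP.
apply: etrans (lebesgue_outer_translate (- h) X); apply: etrans (esym (mA _)).
congr (_ + _)%E; apply: etrans (esym (lebesgue_outer_translate (- h) _)) _;
  by congr lebesgue_outer; apply/seteqP; split => x /=; rewrite subrK.
Qed.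

Lemma ge0_integral_translate h (f : T -> \bar R) : measurable_fun setT f ->
  (forall x, 0 <= f x)%E ->
  (\int[mu]_x f ((x : 'rV[R]_n) + h)%R = \int[mu]_x f x)%E.
Proof.
move=> mf f0; have := ge0_integral_pushforward (measurable_translate h) mu
  (D := setT) (f := f) measurableT mf (fun x _ => f0 x).
rewrite preimage_setT => <-; apply: eq_measure_integral => [|mphi A mA _].
  exact: measurable_translate.
by rewrite /pushforward; exact: lebesgue_outer_translate.
Qed.

End lebesgue_rV_cube.

(** * Convexity of powers and auxiliary integration lemmas *)

Section power_mean.
Context {R : realFieldType}.

(** The graph of the convex function [t ^ (p + 1)] lies above its tangent at [b]. *)
Lemma expr_tangent (a b : R) p : 0 <= a -> 0 <= b ->
  b ^+ p.+1 + p.+1%:R * b ^+ p * (a - b) <= a ^+ p.+1.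
Proof.
move=> a0 b0; elim: p => [|p IH]; first by rewrite !expr1 expr0; lra.
rewrite [a ^+ _]exprS; apply: le_trans (ler_wpM2l a0 IH).
have c0 : 0 <= p.+1%:R * b ^+ p * ((a - b) * (a - b)).
  by apply: mulr_ge0; [rewrite mulr_ge0 ?exprn_ge0|rewrite -expr2 sqr_ge0].
move: c0; rewrite -[p.+2%:R]natr1 !exprS; move: p.+1%:R (b ^+ p) => k c c0.
by rewrite -subr_ge0; apply: le_trans c0 _; rewrite le_eqVlt; apply/orP; left;
  apply/eqP; ring.
Qed.

(** Sum the tangent inequalities at the arithmetic mean [b], where the linear terms cancel. *)
Lemma power_mean (k p : nat) (a : nat -> R) : (forall i, 0 <= a i) ->
  (\sum_(i < k) a i) ^+ p.+1 <= k%:R ^+ p * \sum_(i < k) a i ^+ p.+1.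
Proof.
move=> a0; case: k => [|k]; first by rewrite !big_ord0 exprS mul0r mulr0.
set s := \sum_(i < k.+1) a i; pose b := s / k.+1%:R.
have s0 : 0 <= s by apply: sumr_ge0.
have b0 : 0 <= b by rewrite divr_ge0.
have k0 : k.+1%:R != 0 :> R by rewrite pnatr_eq0.
have : \sum_(i < k.+1) (b ^+ p.+1 + p.+1%:R * b ^+ p * (a i - b)) <=
    \sum_(i < k.+1) a i ^+ p.+1.
  by apply: ler_sum => i _; exact: expr_tangent.
rewrite big_split/= -mulr_sumr sumrB -/s !sumr_const card_ord.
rewrite (_ : s - b *+ k.+1 = 0); last first.
  by rewrite -[b *+ _]mulr_natl /b; field; rewrite -[1]/(1%:R) -natrD pnatr_eq0.
rewrite mulr0 addr0 => /(ler_wpM2l (exprn_ge0 p (ler0n R k.+1))).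
apply: le_trans; rewrite -[b ^+ p.+1 *+ _]mulr_natr mulrCA -exprSr -exprMn /b divfK//.
Qed.

Lemma power_mean2 (a b : R) p : 0 <= a -> 0 <= b ->
  (a + b) ^+ p.+1 <= 2 ^+ p * (a ^+ p.+1 + b ^+ p.+1).
Proof.
move=> a0 b0; have := @power_mean 2 p (fun i => if i == 0%N then a else b).
rewrite !big_ord_recl !big_ord0/= !addr0; apply => i; by case: ifP.
Qed.

End power_mean.

Lemma sume_const {R : realType} (I : finType) (x : \bar R) : (0 <= x)%E ->
  (\sum_(i : I) x = #|I|%:R%:E * x)%E.
Proof.
move=> x0; rewrite big_const; elim: #|I| => [|k IH]; first by rewrite mul0e.
rewrite iterS IH -natr1 EFinD ge0_muleDl ?lee_fin// mul1e addeC//.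
Qed.

Section integral_aux.
Local Open Scope ereal_scope.

Lemma ge0_integral_cover d (T : measurableType d) (R : realType)
    (mu : {measure set T -> \bar R}) (I : finType) (A : set T)
    (B : I -> set T) (f : T -> \bar R) :
  measurable A -> (forall i, measurable (B i)) ->
  measurable_fun setT f -> (forall x, 0 <= f x) ->
  A `<=` \bigcup_i B i ->
  \int[mu]_(x in A) f x <= \sum_i \int[mu]_(x in B i) f x.
Proof.
move=> mA mB mf f0 AB; rewrite integral_mkcond.
under [leRHS]eq_bigr do rewrite integral_mkcond.
have f0' i x : 0 <= (f \_ (B i)) x by rewrite patchE; case: ifP.
rewrite -ge0_integral_sum//; last first.
  by move=> i; apply/(measurable_restrictT f (mB i)); exact: measurable_funTS.
apply: ge0_le_integral_pointwise => // x _.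
  by rewrite patchE; case: ifP.
rewrite patchE; case: ifPn => [|_]; last by apply: sume_ge0 => i _; exact: f0'.
move=> /set_mem Ax; have [i _ Bx] := AB _ Ax.
by rewrite (bigD1 i)//= patchE mem_set// leeDl// sume_ge0// => *; exact: f0'.
Qed.

Lemma ge0_integralZD d (T : measurableType d) (R : realType)
    (mu : {measure set T -> \bar R}) (A : set T) (c : R) (f g : T -> \bar R) :
  measurable A -> (0 <= c)%R ->
  measurable_fun A f -> measurable_fun A g ->
  (forall x, 0 <= f x) -> (forall x, 0 <= g x) ->
  \int[mu]_(x in A) (c%:E * (f x + g x)) =
  c%:E * (\int[mu]_(x in A) f x + \int[mu]_(x in A) g x).
Proof.
move=> mA c0 mf mg f0 g0; rewrite ge0_integralZl ?lee_fin//.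
- by rewrite ge0_integralD.
- exact: emeasurable_funD.
- by move=> x _; rewrite adde_ge0.
Qed.

(** The domain of integration varies with [x]. Moving it into the integrand as the restriction to a
    measurable subset of the product reduces the claim to Tonelli. *)
Lemma measurable_fun_section_integral d1 d2 (T1 : measurableType d1)
    (T2 : measurableType d2) (R : realType)
    (m2 : {sigma_finite_measure set T2 -> \bar R}) (B : T1 -> set T2)
    (f : T1 -> T2 -> \bar R) :
  measurable [set p : T1 * T2 | B p.1 p.2] ->
  measurable_fun setT (fun p : T1 * T2 => f p.1 p.2) ->
  (forall x y, 0 <= f x y) ->
  measurable_fun setT (fun x => \int[m2]_(y in B x) f x y).
Proof.
move=> mB mf f0; pose g := (fun p : T1 * T2 => f p.1 p.2) \_ [set p | B p.1 p.2].
have mg : measurable_fun setT g.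
  by apply/(measurable_restrictT _ mB); exact: measurable_funTS.
have g0 p : 0 <= g p by rewrite /g patchE; case: ifP.
have := measurable_fun_fubini_tonelli_F (m2 := m2) g mg g0.
congr measurable_fun; apply/funext => x; rewrite /fubini_F [in RHS]integral_mkcond.
apply: eq_integral => y _; rewrite /g !patchE.
by congr (if _ then _ else _); apply/idP/idP => /set_mem H; exact: mem_set.
Qed.

End integral_aux.

(** * Finite-difference energies and the Poincare inequality *)

(** A map into [X] is seen here only through the distances of its values. The joint measurability is
    what Tonelli needs; it will come from the separability of the range. *)
Record measurable_pseudometric {R : realType} {n : nat}
    (delta : lebesgue_rVType R n -> lebesgue_rVType R n -> R) : Prop := {
  pm_ge0 : forall x y, 0 <= delta x y;
  pm_refl : forall x, delta x x = 0;
  pm_sym : forall x y, delta x y = delta y x;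
  pm_triangle : forall y x z, delta x z <= delta x y + delta y z;
  pm_measurable : measurable_fun setT
    (fun p : lebesgue_rVType R n * lebesgue_rVType R n => delta p.1 p.2)
}.

Section pseudometric.
Context {R : realType} {n : nat}.
Local Notation T := (lebesgue_rVType R n).
Local Notation mu := (@lebesgue_rV R n).
Variable delta : T -> T -> R.
Hypotheses (n_gt0 : (0 < n)%N) (delta_pm : measurable_pseudometric delta).

Definition pmpow (x y : T) : \bar R := (delta x y ^+ n)%:E.

Lemma pmpow_ge0 x y : (0 <= pmpow x y)%E.
Proof. by rewrite lee_fin exprn_ge0// (pm_ge0 delta_pm). Qed.

Lemma pmpow_sym x y : pmpow x y = pmpow y x.
Proof. by rewrite /pmpow (pm_sym delta_pm). Qed.

Lemma measurable_pmpow2 : measurable_fun setT (fun p : T * T => pmpow p.1 p.2).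
Proof. by apply/measurable_EFinP; apply: measurable_funX; exact: (pm_measurable delta_pm). Qed.

Lemma measurable_pmpow x D : measurable_fun D (pmpow x).
Proof.
apply: measurable_funTS; exact: (measurable_fun_pair2 x measurable_pmpow2).
Qed.

Lemma pmpow_triangle y x z :
  (pmpow x z <= (2 ^+ n.-1)%:E * (pmpow x y + pmpow y z))%E.
Proof.
rewrite lee_fin.
have := power_mean2 n.-1 (pm_ge0 delta_pm x y) (pm_ge0 delta_pm y z).
rewrite prednK//; apply: le_trans.
apply: lerXn2r (pm_triangle delta_pm _ _ _); rewrite nnegrE ?addr_ge0//;
  exact: (pm_ge0 delta_pm).
Qed.

Lemma pmpow_chain (k : nat) (s : nat -> T) :
  (pmpow (s 0%N) (s k) <=
     (k%:R ^+ n.-1)%:E * \sum_(i < k) pmpow (s i) (s i.+1))%E.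
Proof.
have H : delta (s 0%N) (s k) <= \sum_(i < k) delta (s i) (s i.+1).
  elim: k => [|k IH]; first by rewrite big_ord0 (pm_refl delta_pm).
  rewrite big_ord_recr/=; apply: le_trans (pm_triangle delta_pm (s k) _ _) _.
  by rewrite lerD2r.
rewrite /pmpow sumEFin -EFinM lee_fin.
have := power_mean k n.-1 (fun i => pm_ge0 delta_pm (s i) (s i.+1)).
rewrite prednK//; apply: le_trans; apply: lerXn2r H; rewrite nnegrE.
  exact: (pm_ge0 delta_pm).
by apply: sumr_ge0 => i _; exact: (pm_ge0 delta_pm).
Qed.

Definition dens (e : R) (x : T) : \bar R :=
  (\int[mu]_(y in (cube x e : set T)) pmpow x y)%E.

Lemma dens_ge0 e x : (0 <= dens e x)%E.
Proof. by apply: integral_ge0 => y _; exact: pmpow_ge0. Qed.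

Lemma measurable_dens e D : measurable_fun D (dens e).
Proof.
apply: measurable_funTS; apply: measurable_fun_section_integral.
- exact: measurable_cube_rel.
- exact: measurable_pmpow2.
- exact: pmpow_ge0.
Qed.

(** Average the triangle inequality over the cube of radius [e / 2] about the midpoint of [x] and
    [y]: that cube lies in both cubes of radius [e]. A pointwise distance is thus controlled by
    integrated quantities. *)
Lemma pmpow_le_dens (x y : 'rV[R]_n) (e : R) : 0 < e ->
  (forall i, `|x ord0 i - y ord0 i| <= e) ->
  (((e / 2) ^+ n)%:E * pmpow x y <= (2 ^+ n.-1)%:E * (dens e x + dens e y))%E.
Proof.
move=> e0 xy; pose m : 'rV[R]_n := \row_i ((x ord0 i + y ord0 i) / 2).
have m_ (x' : 'rV[R]_n) : (forall i, `|x' ord0 i - m ord0 i| <= e / 2) ->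
    cube m (e / 2) `<=` cube x' e.
  move=> H z mz i; apply: le_lt_trans (ler_distD (m ord0 i) _ _) _.
  by rewrite [e]splitr; apply: ler_ltD.
have mx : cube m (e / 2) `<=` cube x e.
  apply: m_ => i; rewrite mxE (_ : _ - _ = (x ord0 i - y ord0 i) / 2); last by field.
  by rewrite normrM (@ger0_norm _ 2^-1)// ler_pM2r.
have my : cube m (e / 2) `<=` cube y e.
  apply: m_ => i; rewrite mxE (_ : _ - _ = - ((x ord0 i - y ord0 i) / 2)); last by field.
  by rewrite normrN normrM (@ger0_norm _ 2^-1)// ler_pM2r.
have mC (z : 'rV[R]_n) r : measurable (cube z r : set T) by exact: measurable_cube.
apply: (@le_trans _ _ (\int[mu]_(z in (cube m (e / 2) : set T)) pmpow x y)%E).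
  rewrite integral_cst// muleC lee_wpmul2l ?pmpow_ge0// lebesgue_rV_cube_ge//.
  by rewrite divr_gt0.
have mK z : measurable_fun (cube m (e / 2) : set T) (pmpow z) by exact: measurable_pmpow.
apply: (@le_trans _ _ (\int[mu]_(z in (cube m (e / 2) : set T))
    ((2 ^+ n.-1)%:E * (pmpow x z + pmpow y z)))%E).
  apply: ge0_le_integral_pointwise => // z _; first exact: pmpow_ge0.
  by rewrite [X in (_ <= _ * (_ + X))%E]pmpow_sym; exact: pmpow_triangle.
rewrite (ge0_integralZD _ (mC _ _) (exprn_ge0 _ _) (mK x) (mK y))//;
  try by move=> z; exact: pmpow_ge0.
rewrite lee_wpmul2l//.
by apply: leeD; apply: ge0_subset_integral => //; try exact: measurable_pmpow;
  move=> z _; exact: pmpow_ge0.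
Qed.

End pseudometric.

(** * Chaining a displacement into steps of one scale *)

Section chain.
Context {R : realType} {n : nat}.
Local Notation T := (lebesgue_rVType R n).
Local Notation mu := (@lebesgue_rV R n).
Variable delta : T -> T -> R.
Hypotheses (n_gt0 : (0 < n)%N) (delta_pm : measurable_pseudometric delta).
Local Notation pmpow := (pmpow delta).
Local Notation dens := (dens delta).

Definition energy_at (e : R) (V : set T) : \bar R :=
  (\int[mu]_(x in V) dens e x)%E.

Section fixed_scale.
Variables (e : R) (m : nat) (S : T -> set T) (V : set T).
Hypotheses (e_gt0 : 0 < e) (m_gt0 : (0 < m)%N).
Hypotheses (mS : measurable [set p : T * T | S p.1 p.2]) (mV : measurable V).
Hypothesis S_dist : forall x y : 'rV[R]_n, S x y ->
  forall i, `|y ord0 i - x ord0 i| <= m%:R * e.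
Hypothesis S_conv : forall (x y : 'rV[R]_n) (t : R), S x y -> 0 <= t <= 1 ->
  cube (x + t *: (y - x)) e `<=` V.

(** A displacement [y - x] is rounded down to a grid vector [h z], with [z] in a finite set, plus a
    remainder in [[0, e)^n]. For fixed [z] the intermediate points [node z x j] are translates of
    [x] by vectors independent of [y], so integrating over [x] needs only translation invariance. *)
Let Z := {ffun 'I_n -> 'I_(2 * m).+1}.
Let h (z : Z) : 'rV[R]_n := \row_i (e * ((z i)%:R - m%:R)).
Let cell (z : Z) (x : 'rV[R]_n) : set T :=
  [set y : 'rV[R]_n | forall i, 0 <= y ord0 i - x ord0 i - h z ord0 i < e].
Let g := dens e \_ V.
Let node (z : Z) (x : 'rV[R]_n) (j : nat) : T := x + (j%:R / m%:R) *: h z.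
Let G (z : Z) (x : T) : \bar R := (\sum_(j < m.+1) g (node z x j))%E.

Let m_neq0 : m%:R != 0 :> R. Proof. by rewrite pnatr_eq0 -lt0n. Qed.

Let g_ge0 x : (0 <= g x)%E.
Proof. by rewrite /g patchE; case: ifP => // _; exact: dens_ge0. Qed.

Let measurable_g : measurable_fun setT g.
Proof.
by apply/(measurable_restrictT _ mV); exact: measurable_dens.
Qed.

Let G_ge0 z x : (0 <= G z x)%E.
Proof. by apply: sume_ge0 => j _; exact: g_ge0. Qed.

Let measurable_S x : measurable (S x).
Proof.
have := measurable_xsection x mS.
by congr measurable; apply/seteqP; split => y; rewrite /xsection/= inE.
Qed.

Let measurable_cell z x : measurable (cell z x).
Proof.
rewrite (_ : cell z x = \bigcap_(i in [set: 'I_n])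
  ([set y : T | 0 <= y ord0 i - x ord0 i - h z ord0 i] `&`
   [set y : T | y ord0 i - x ord0 i - h z ord0 i < e])); last first.
  apply/seteqP; split => [y H i _|y H i]; first by have /andP := H i.
  by apply/andP; exact: (H i I).
have mc i : measurable_fun setT (fun y : T => y ord0 i - x ord0 i - h z ord0 i).
  apply: measurable_funB; last exact: measurable_cst.
  by apply: measurable_funB; [exact: measurable_coord|exact: measurable_cst].
apply: fin_bigcap_measurable => // i _; apply: measurableI;
  apply: measurable_set_bool.
- by apply: measurable_fun_ler => //; exact: mc.
- by apply: measurable_fun_ltr => //; exact: mc.
Qed.

Let cell_cover x : S x `<=` \bigcup_z (S x `&` cell z x).
Proof.
move=> y Sxy; pose a i := (y ord0 i - x ord0 i) / e.
have [aL aU] : (forall i, - m%:R <= a i) /\ (forall i, a i <= m%:R).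
  by split => i; have := S_dist Sxy i; rewrite ler_norml /a => /andP[];
    rewrite ?ler_pdivlMr ?ler_pdivrMr// mulNr.
have fL i : (- (m%:Z) <= Num.floor (a i))%R.
  by rewrite floor_ge_int intrN; exact: aL.
have fU i : (Num.floor (a i) <= m%:Z)%R.
  rewrite -(ler_int R); apply: le_trans (aU i).
  by have /andP[] := floor_itv (a i).
(* The floors range over the [2 m + 1] integers from [-m] to [m]; the shift by [m] makes them
   indices. *)
pose k i := absz (Num.floor (a i) + m%:Z).
have kE i : (k i)%:Z = Num.floor (a i) + m%:Z.
  by rewrite /k gez0_abs//; have := fL i; lia.
have klt i : (k i < (2 * m).+1)%N by have := kE i; have := fU i; lia.
exists [ffun i => Ordinal (klt i)] => //; split => // i; rewrite mxE ffunE/=.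
have -> : (k i)%:R - m%:R = (Num.floor (a i))%:~R :> R.
  by rewrite pmulrn kE intrD addrK.
have /andP[f1 f2] := floor_itv (a i).
have eE : y ord0 i - x ord0 i = e * a i by rewrite /a mulrC divfK// gt_eqF.
rewrite eE -mulrBr; rewrite intrD in f2; apply/andP; split.
  by rewrite mulr_ge0 ?subr_ge0 ?(ltW e_gt0).
by rewrite -[ltRHS]mulr1 ltr_pM2l// ltrBlDl.
Qed.

Let node_dist z x j i :
  `|(node z x j : 'rV[R]_n) ord0 i - (node z x j.+1 : 'rV[R]_n) ord0 i| <= e.
Proof.
rewrite !mxE opprD addrACA subrr add0r.
have -> (w : R) : j%:R / m%:R * (e * w) - j.+1%:R / m%:R * (e * w) =
    e * (- (w / m%:R)) by rewrite -[j.+1%:R]natr1; field.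
rewrite normrM (gtr0_norm e_gt0) -[leRHS]mulr1 ler_pM2l// normrN normf_div.
rewrite normr_nat ler_pdivrMr ?ltr0n// mul1r.
have := ltn_ord (z i); rewrite ltnS => zi.
have : (z i)%:R <= (2 * m)%:R :> R by rewrite ler_nat.
have := ler0n R (z i); rewrite natrM => *.
by rewrite ler_norml; apply/andP; split; lra.
Qed.

(** The chain runs through [m] grid steps from [x] to [node z x m], then one last step to [y], so
    [power_mean] is applied with [m + 1] terms. Grid steps cost [8 ^ n]: the cell has measure at
    most [(2 e) ^ n], and [pmpow_le_dens] gives [2 ^ n.-1 / (e / 2) ^ n], each node being counted at
    most twice. The last step is integrated over [y] and costs 1. *)
Let cell_integral z x :
  (\int[mu]_(y in S x `&` cell z x) pmpow x y <=
     (m.+1%:R ^+ n.-1 * (8 ^+ n + 1))%:E * G z x)%E.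
Proof.
have mB : measurable (S x `&` cell z x) by exact: measurableI.
(* The nodes may leave [V] when the cell misses [S x], but then the left side vanishes. Otherwise
   any [y0] in the intersection places each node within [e] of the segment from [x] to [y0]. *)
have [->|/set0P[y0 [Sxy0 cy0]]] := eqVneq (S x `&` cell z x) set0.
  by rewrite integral_set0 mule_ge0// lee_fin mulr_ge0// ?exprn_ge0// addr_ge0.
have gE j : (j <= m)%N -> dens e (node z x j) = g (node z x j).
  move=> jm; rewrite /g patchE mem_set//.
  pose t : R := j%:R / m%:R.
  have t0 : 0 <= t by rewrite divr_ge0.
  have t1 : t <= 1 by rewrite ler_pdivrMr ?ltr0n// mul1r ler_nat.
  apply: (S_conv (t := t) Sxy0); first by rewrite t0.
  move=> i; have /andP[c1 c2] := cy0 i; rewrite !mxE in c1 c2 *.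
  rewrite opprD addrACA subrr add0r -mulrBr -/t ger0_norm ?mulr_ge0//.
  by apply: le_lt_trans c2; rewrite ler_piMl.
pose A := (\sum_(i < m) pmpow (node z x i) (node z x i.+1))%E.
have A0 : (0 <= A)%E by apply: sume_ge0 => i _; exact: pmpow_ge0.
have M0 : 0 <= m.+1%:R ^+ n.-1 :> R by rewrite exprn_ge0.
have cellS : S x `&` cell z x `<=` cube (node z x m : 'rV[R]_n) e.
  move=> y [_ cy] i; have := cy i; rewrite /node divff// scale1r.
  rewrite (_ : _ - _ - _ = - ((x + h z) ord0 i - y ord0 i)); last first.
    by rewrite [in RHS]mxE; ring.
  by move=> /andP[c1 c2]; rewrite -normrN ger0_norm.
apply: (@le_trans _ _ (\int[mu]_(y in S x `&` cell z x)
    ((m.+1%:R ^+ n.-1)%:E * (A + pmpow (node z x m) y)))%E).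
  apply: ge0_le_integral_pointwise => // y _; first exact: pmpow_ge0.
  have := pmpow_chain n_gt0 delta_pm m.+1
    (fun j => if (j <= m)%N then node z x j else y).
  rewrite leq0n ltnn /= {1}/node mul0r scale0r addr0 => /le_trans; apply.
  rewrite lee_wpmul2l// big_ord_recr/= leqnn ltnn leeD2r// /A.
  rewrite le_eqVlt; apply/orP; left; apply/eqP; apply: eq_bigr => i _ /=.
  by rewrite (ltnW (ltn_ord i)) ltn_ord.
have mK : measurable_fun (S x `&` cell z x) (pmpow (node z x m)).
  exact: measurable_pmpow.
rewrite (ge0_integralZD _ mB M0 (measurable_cst _) mK)//; last first.
  by move=> y; exact: pmpow_ge0.
rewrite EFinM -muleA lee_wpmul2l//.
rewrite EFinD ge0_muleDl ?lee_fin// ?exprn_ge0// mul1e.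
apply: leeD; last first.
  apply: (@le_trans _ _ (dens e (node z x m))).
    apply: ge0_subset_integral => //; first exact: measurable_cube.
      exact: measurable_pmpow.
    by move=> y _; exact: pmpow_ge0.
  rewrite gE// /G big_ord_recr/= leeDr// sume_ge0// => j _; exact: g_ge0.
rewrite integral_cst//; apply: (@le_trans _ _ (((2 * e) ^+ n)%:E * A)%E).
  rewrite muleC lee_wpmul2r//.
  apply: le_trans (lebesgue_rV_cube_le (node z x m) (ltW e_gt0)).
  by apply: le_measure; rewrite ?inE//; exact: measurable_cube.
rewrite /A ge0_sume_distrr//; last by move=> i _; exact: pmpow_ge0.
apply: (@le_trans _ _ (\sum_(i < m) ((4 ^+ n * 2 ^+ n.-1)%:E *
    (g (node z x i) + g (node z x i.+1))))%E).
  apply: lee_sum => i _; rewrite (_ : (2 * e) ^+ n = 4 ^+ n * (e / 2) ^+ n); last first.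
    by rewrite -exprMn; congr (_ ^+ _); field.
  rewrite 2!EFinM -2!muleA lee_wpmul2l ?lee_fin ?exprn_ge0//.
  rewrite -!gE// 1?ltnW//; apply: pmpow_le_dens => // k; exact: node_dist.
rewrite -ge0_sume_distrr; last by move=> i _; rewrite adde_ge0 ?g_ge0.
rewrite big_split/= (_ : 8 ^+ n = 4 ^+ n * 2 ^+ n.-1 * 2); last first.
  by rewrite -mulrA -exprSr prednK// -exprMn; congr (_ ^+ _); ring.
rewrite [X in (_ <= X * _)%E]EFinM -muleA lee_wpmul2l ?lee_fin//.
rewrite mule_natl mule2n; apply: leeD.
  by rewrite /G big_ord_recr/= leeDl// g_ge0.
by rewrite /G big_ord_recl/= leeDr// g_ge0.
Qed.

(** The [(2 m + 1) ^ n] cells, the [m + 1] nodes of each chain and the factor [(m + 1) ^ n.-1]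
    combine to [((2 m + 1) (m + 1)) ^ n], at most [(6 m ^ 2) ^ n]. *)
Lemma chain_estimate :
  (\int[mu]_x \int[mu]_(y in S x) pmpow x y <=
     (6 ^+ n * (8 ^+ n + 1) * m%:R ^+ (2 * n))%:E * energy_at e V)%E.
Proof.
pose C1 : R := m.+1%:R ^+ n.-1 * (8 ^+ n + 1).
have C10 : 0 <= C1 by rewrite mulr_ge0 ?exprn_ge0// addr_ge0// exprn_ge0.
have step x : (\int[mu]_(y in S x) pmpow x y <= \sum_(z : Z) C1%:E * G z x)%E.
  apply: le_trans (_ : \sum_z \int[mu]_(y in S x `&` cell z x) pmpow x y <= _)%E.
    apply: ge0_integral_cover => //.
    - by move=> z; exact: measurableI.
    - exact: measurable_pmpow.
    - by move=> y; exact: pmpow_ge0.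
  by apply: lee_sum => z _; exact: cell_integral.
have mGj z (j : nat) : measurable_fun setT (fun x : T => g (node z x j)).
  apply: (measurableT_comp measurable_g).
  exact: (measurable_translate ((j%:R / m%:R) *: h z)).
have mG z : measurable_fun setT (G z).
  by apply: emeasurable_sum => j; exact: mGj.
apply: (@le_trans _ _ (\int[mu]_x \sum_(z : Z) C1%:E * G z x)%E).
  apply: ge0_le_integral_pointwise => // x _.
  by apply: integral_ge0 => y _; exact: pmpow_ge0.
have mCG z : measurable_fun setT (fun x => C1%:E * G z x)%E.
  exact: measurable_funeM.
have CG0 z x : setT x -> (0 <= C1%:E * G z x)%E by rewrite mule_ge0.
rewrite (ge0_integral_sum _ measurableT mCG CG0).
have E0 : (0 <= energy_at e V)%E by apply: integral_ge0 => x _; exact: dens_ge0.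
rewrite (eq_bigr (fun=> (C1 * m.+1%:R)%:E * energy_at e V)%E); last first.
  move=> z _; rewrite ge0_integralZl//.
  rewrite [in RHS]EFinM -[RHS]muleA; congr (_ * _)%E; rewrite /G.
  rewrite (ge0_integral_sum _ measurableT (fun j : 'I_m.+1 => mGj z j)
    (fun j x _ => g_ge0 _)).
  rewrite (eq_bigr (fun=> energy_at e V)); last first.
    move=> j _; apply: etrans (ge0_integral_translate _ measurable_g g_ge0) _.
    by rewrite /energy_at [RHS]integral_mkcond.
  by rewrite sume_const// card_ord.
rewrite sume_const; last by rewrite mule_ge0// lee_fin mulr_ge0.
rewrite muleA -EFinM lee_wpmul2r// lee_fin card_ffun !card_ord natrX /C1.
have -> : (2 * m).+1%:R ^+ n * (m.+1%:R ^+ n.-1 * (8 ^+ n + 1) * m.+1%:R) =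
    (8 ^+ n + 1) * ((2 * m).+1%:R * m.+1%:R) ^+ n :> R.
  rewrite exprMn; have -> : m.+1%:R ^+ n = m.+1%:R * m.+1%:R ^+ n.-1 :> R.
    by rewrite -exprS prednK.
  by move: (8 ^+ n) (m.+1%:R ^+ n.-1) ((2 * m).+1%:R ^+ n) => *; ring.
rewrite [_ * (8 ^+ n + 1)]mulrC -mulrA ler_wpM2l ?addr_ge0 ?exprn_ge0//.
rewrite exprM -exprMn lerXn2r ?nnegrE ?mulr_ge0 ?exprn_ge0//.
by rewrite -natrX -!natrM ler_nat expnS expn1; nia.
Qed.

End fixed_scale.
End chain.

(** * The limiting energy and the Poincare inequality on convex sets *)

Section liminf_energy.
Context {R : realType} {n : nat}.
Local Notation T := (lebesgue_rVType R n).
Local Notation mu := (@lebesgue_rV R n).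
Variable delta : T -> T -> R.
Hypotheses (n_gt0 : (0 < n)%N) (delta_pm : measurable_pseudometric delta).
Local Notation pmpow := (pmpow delta).
Local Notation dens := (dens delta).
Local Notation energy_at := (energy_at delta).

(** One factor [e ^ n] normalizes the volume of the cube in [dens], the other turns the distance
    into a difference quotient. *)
Definition scaled_energy (e : R) (V : set T) : \bar R :=
  ((e ^+ (2 * n))^-1%:E * energy_at e V)%E.

Definition liminf_energy (V : set T) : \bar R :=
  ereal_sup [set ereal_inf [set scaled_energy e V | e in [set e | 0 < e < d]] |
             d in [set d | 0 < d]].

Lemma energy_at_ge0 e V : (0 <= energy_at e V)%E.
Proof. by apply: integral_ge0 => x _; exact: dens_ge0. Qed.

Lemma scaled_energy_ge0 e V : (0 <= scaled_energy e V)%E.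
Proof.
by rewrite mule_ge0 ?energy_at_ge0// lee_fin invr_ge0 exprM exprn_ge0// sqr_ge0.
Qed.

Lemma le_energy_at e (V V' : set T) : measurable V -> measurable V' ->
  V `<=` V' -> (energy_at e V <= energy_at e V')%E.
Proof.
move=> mV mV' VV'; apply: ge0_subset_integral => //; first exact: measurable_dens.
by move=> x _; exact: dens_ge0.
Qed.

Lemma le_scaled_energy e (V V' : set T) : measurable V -> measurable V' ->
  V `<=` V' -> (scaled_energy e V <= scaled_energy e V')%E.
Proof.
move=> mV mV' VV'; rewrite lee_wpmul2l ?le_energy_at// lee_fin invr_ge0.
by rewrite exprM exprn_ge0// sqr_ge0.
Qed.

Lemma le_liminf_energy (x : \bar R) (d : R) V : 0 < d ->
  (forall e, 0 < e < d -> (x <= scaled_energy e V)%E) ->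
  (x <= liminf_energy V)%E.
Proof.
move=> d0 H; apply: le_trans (ereal_sup_ubound _); last by exists d.
by apply: le_ereal_inf_tmp => _ [e ed <-]; exact: H.
Qed.

Lemma liminf_energy_ge0 V : (0 <= liminf_energy V)%E.
Proof. by apply: (@le_liminf_energy _ 1) => // e _; exact: scaled_energy_ge0. Qed.

Lemma liminf_energy_le (x : \bar R) V :
  (forall d, 0 < d -> exists2 e, 0 < e < d & (scaled_energy e V <= x)%E) ->
  (liminf_energy V <= x)%E.
Proof.
move=> H; apply: ge_ereal_sup => _ [d d0 <-]; have [e ed He] := H _ d0.
by apply: le_trans He; apply: ereal_inf_lbound; exists e.
Qed.

Lemma liminf_energy_lt (x : \bar R) V : (x < liminf_energy V)%E ->
  exists2 d, 0 < d & forall e, 0 < e < d -> (x <= scaled_energy e V)%E.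
Proof.
move=> /ereal_sup_gt[_ [d d0 <-] xd]; exists d => // e ed.
by apply: le_trans (ltW xd) _; apply: ereal_inf_lbound; exists e.
Qed.

Lemma liminf_energy_mono (V V' : set T) : measurable V -> measurable V' ->
  V `<=` V' -> (liminf_energy V <= liminf_energy V')%E.
Proof.
move=> mV mV' VV'; apply: ge_ereal_sup => _ [d d0 <-].
apply: (@le_liminf_energy _ d) => // e ed.
apply: le_trans (le_scaled_energy e mV mV' VV').
by apply: ereal_inf_lbound; exists e.
Qed.

(** The energies of disjoint sets add at each scale, and a liminf is superadditive; a limsup would
    give the opposite inequality. *)
Lemma liminf_energyD (V1 V2 V : set T) : measurable V1 -> measurable V2 ->
  measurable V -> V1 `&` V2 = set0 -> V1 `<=` V -> V2 `<=` V ->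
  (liminf_energy V1 + liminf_energy V2 <= liminf_energy V)%E.
Proof.
move=> mV1 mV2 mV V12 V1V V2V.
have H e : 0 < e -> (scaled_energy e V1 + scaled_energy e V2 <= scaled_energy e V)%E.
  move=> e0; apply: le_trans (_ : scaled_energy e (V1 `|` V2) <= _)%E; last first.
    by apply: le_scaled_energy => //; [exact: measurableU|rewrite subUset].
  rewrite /scaled_energy -ge0_muleDr ?energy_at_ge0// /energy_at.
  rewrite ge0_integral_setU//; first exact: measurable_dens.
    by move=> x _; exact: dens_ge0.
  by apply/disj_setPS; rewrite V12.
have [->|LV] := eqVneq (liminf_energy V) +oo%E; first exact: leey.
have fin W : measurable W -> W `<=` V -> liminf_energy W \is a fin_num.
  move=> mW WV; rewrite ge0_fin_numE ?liminf_energy_ge0//.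
  by apply: le_lt_trans (liminf_energy_mono mW mV WV) _; rewrite ltey.
have fin1 := fin _ mV1 V1V; have fin2 := fin _ mV2 V2V.
apply/lee_addgt0Pr => t t0; rewrite -leeBlDr//.
have sub1 W : liminf_energy W \is a fin_num ->
    (liminf_energy W - (t / 2)%:E < liminf_energy W)%E.
  by move=> fW; rewrite lteBlDr// lteDl// lte_fin divr_gt0.
have [d1 d10 H1] := liminf_energy_lt (sub1 _ fin1).
have [d2 d20 H2] := liminf_energy_lt (sub1 _ fin2).
apply: (@le_liminf_energy _ (Num.min d1 d2)); first by rewrite lt_min d10.
move=> e /andP[e0]; rewrite lt_min => /andP[ed1 ed2]; apply: le_trans (H e e0).
apply: le_trans (leeD (H1 e _) (H2 e _)); [|by rewrite e0..].
rewrite -(fineK fin1) -(fineK fin2) -!EFinB -!EFinD lee_fin; lra.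
Qed.

(** The last factor comes from rounding: the number [m] of steps satisfies [m <= 2 rho / e]. *)
Definition chain_cst : R := 6 ^+ n * (8 ^+ n + 1) * 4 ^+ n.

Lemma chain_cst_gt0 : 0 < chain_cst.
Proof. by rewrite !mulr_gt0 ?exprn_gt0// ltr_wpDl ?exprn_ge0. Qed.

(** The factor [m ^ (2 n)] of [chain_estimate] is balanced by the normalization [e ^ (2 n)], since
    [m e <= 2 rho]. The bound is therefore uniform in [e], and the infimum over small [e] may be
    taken. The margin [tau] only limits the scales used and does not enter the constant. *)
Lemma chain_liminf (S : T -> set T) (V : set T) (rho tau : R) :
  0 < rho -> 0 < tau ->
  measurable [set p : T * T | S p.1 p.2] -> measurable V ->
  (forall x y : 'rV[R]_n, S x y -> forall i, `|y ord0 i - x ord0 i| <= rho) ->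
  (forall (x y : 'rV[R]_n) (t : R), S x y -> 0 <= t <= 1 ->
     cube (x + t *: (y - x)) tau `<=` V) ->
  (\int[mu]_x \int[mu]_(y in S x) pmpow x y <=
     (chain_cst * rho ^+ (2 * n))%:E * liminf_energy V)%E.
Proof.
move=> rho0 tau0 mS mV Sd SV; set X := (\int[mu]_x _)%E.
have c0 : 0 < chain_cst * rho ^+ (2 * n) by rewrite mulr_gt0 ?chain_cst_gt0 ?exprn_gt0.
rewrite -lee_pdivrMl//.
apply: (@le_liminf_energy _ (Num.min rho tau)); first by rewrite lt_min rho0.
move=> e /andP[e0]; rewrite lt_min => /andP[erho etau].
rewrite lee_pdivrMl// /scaled_energy muleA -EFinM.
pose m := (Num.truncn (rho / e)).+1.
have q0 : 0 <= rho / e by rewrite divr_ge0 ?ltW.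
have q1 : 1 <= rho / e by rewrite ler_pdivlMr// mul1r ltW.
have mL : rho / e <= m%:R by rewrite ltW// truncnS_gt.
have mU : m%:R <= 2 * (rho / e).
  have /andP[tr _] := truncn_itv q0.
  by rewrite /m -natr1; lra.
apply: le_trans (chain_estimate n_gt0 delta_pm e0 (ltn0Sn _ : (0 < m)%N) mS mV _ _) _.
- move=> x y Sxy i; apply: le_trans (Sd _ _ Sxy i) _.
  by rewrite -ler_pdivrMr.
- by move=> x y t Sxy t01 z /(le_cube (ltW etau)); exact: SV.
rewrite lee_wpmul2r ?energy_at_ge0// lee_fin /chain_cst -!mulrA.
rewrite !ler_wpM2l ?exprn_ge0 ?addr_ge0 ?exprn_ge0//.
rewrite (_ : 4 = 2 ^+ 2 :> R); last by rewrite expr2; ring.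
rewrite -exprM -exprVn -!exprMn; apply: lerXn2r mU; rewrite nnegrE//.
by rewrite mulr_ge0.
Qed.

Lemma poincare_convex (B V : set T) (rho tau : R) :
  0 < rho -> 0 < tau -> measurable B -> measurable V ->
  (forall x y : 'rV[R]_n, B x -> B y -> forall i, `|y ord0 i - x ord0 i| <= rho) ->
  (forall (x y : 'rV[R]_n) (t : R), B x -> B y -> 0 <= t <= 1 ->
     B (x + t *: (y - x))) ->
  (forall x : 'rV[R]_n, B x -> cube x tau `<=` V) ->
  (\int[mu]_(x in B) \int[mu]_(y in B) pmpow x y <=
     (chain_cst * rho ^+ (2 * n))%:E * liminf_energy V)%E.
Proof.
move=> rho0 tau0 mB mV Bd Bc BV.
apply: le_trans (@chain_liminf (fun x => [set y | B x /\ B y]) V rho tau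
  rho0 tau0 _ mV _ _); last 3 first.
- exact: (measurableX mB mB).
- by move=> x y [Bx By]; exact: Bd.
- by move=> x y t [Bx By] t01; apply: BV; exact: Bc.
rewrite [leLHS]integral_mkcond; apply: ge0_le_integral_pointwise => // x _.
  rewrite patchE; case: ifP => // _; apply: integral_ge0 => y _; exact: pmpow_ge0.
rewrite patchE; case: ifPn => [/set_mem Bx|_].
  rewrite le_eqVlt; apply/orP; left; apply/eqP; congr integral.
  by apply/seteqP; split => [y By|y []].
by apply: integral_ge0 => y _; exact: pmpow_ge0.
Qed.

(** Chaining from the scale [rho] down to arbitrarily small scales. As [rho] is any admissible
    scale, this is what bounds limsups by a liminf. *)
Lemma energy_at_le_liminf (U V : set T) (rho : R) :
  0 < rho -> measurable U -> measurable V ->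
  (forall x : 'rV[R]_n, U x -> cube x (2 * rho) `<=` V) ->
  (energy_at rho U <= (chain_cst * rho ^+ (2 * n))%:E * liminf_energy V)%E.
Proof.
move=> rho0 mU mV UV.
apply: le_trans (@chain_liminf (fun x => [set y | U x /\ cube x rho y]) V rho rho
  rho0 rho0 _ mV _ _); last 3 first.
- rewrite (_ : [set _ | _] = (U `*` setT) `&` [set p : T * T | cube p.1 rho p.2]).
    by apply: measurableI; [exact: measurableX|exact: measurable_cube_rel].
  by apply/seteqP; split => [p [? ?]|p [[? _] ?]].
- by move=> x y [_ xy] i; rewrite distrC ltW.
- move=> x y t [Ux xy] /andP[t0 t1] z Hz; apply: (UV x) => //.
  rewrite mulr2n mulrDl mul1r; apply: cube_triangle Hz => i.
  rewrite !mxE opprD addrA subrr sub0r normrN normrM ger0_norm// distrC.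
  by apply: le_lt_trans (xy i); rewrite ler_piMl.
rewrite [leLHS]integral_mkcond; apply: ge0_le_integral_pointwise => // x _.
  rewrite patchE; case: ifP => // _; exact: dens_ge0.
rewrite patchE; case: ifPn => [/set_mem Bx|_].
  rewrite le_eqVlt; apply/orP; left; apply/eqP; congr integral.
  by apply/seteqP; split => [y By|y []].
by apply: integral_ge0 => y _; exact: pmpow_ge0.
Qed.

End liminf_energy.

(** * Poincare inequality on a cubical annulus *)

Section annulus.
Context {R : realType} {n : nat}.
Local Notation T := (lebesgue_rVType R n).
Local Notation mu := (@lebesgue_rV R n).
Variable delta : T -> T -> R.
Hypotheses (n_ge2 : (2 <= n)%N) (delta_pm : measurable_pseudometric delta).
Local Notation pmpow := (pmpow delta).
Local Notation liminf_energy := (liminf_energy delta).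
Let n_gt0 : (0 < n)%N. Proof. exact: ltn_trans n_ge2. Qed.

Definition pair_energy (A B : set T) : \bar R :=
  (\int[mu]_(x in A) \int[mu]_(y in B) pmpow x y)%E.

Let D_ge0 (B : set T) x : (0 <= \int[mu]_(y in B) pmpow x y)%E.
Proof. by apply: integral_ge0 => y _; exact: pmpow_ge0. Qed.

Lemma measurable_integral_pmpow (A B : set T) : measurable B ->
  measurable_fun A (fun x => \int[mu]_(y in B) pmpow x y)%E.
Proof.
move=> mB; apply: measurable_funTS.
apply: (@measurable_fun_section_integral _ _ _ _ _ _ (fun=> B) pmpow).
- rewrite (_ : [set _ | _] = setT `*` B); first exact: measurableX.
  by apply/seteqP; split => [p ?|p []].
- exact: measurable_pmpow2.
- exact: pmpow_ge0.
Qed.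

Lemma pair_energy_ge0 A B : (0 <= pair_energy A B)%E.
Proof. by apply: integral_ge0 => x _; exact: D_ge0. Qed.

Lemma le_pair_energy (A B B' : set T) : measurable A -> measurable B ->
  measurable B' -> B `<=` B' -> (pair_energy A B <= pair_energy A B')%E.
Proof.
move=> mA mB mB' BB'; apply: ge0_le_integral_pointwise => // x _.
apply: ge0_subset_integral => //; first exact: measurable_pmpow.
by move=> y _; exact: pmpow_ge0.
Qed.

(* Average the triangle inequality over an intermediate point of [O]. *)
Lemma pair_energy_via (A B O : set T) (r s : R) : 0 < r -> 0 <= s ->
  measurable A -> measurable B -> measurable O ->
  (r%:E <= mu O)%E -> (mu A <= s%:E)%E -> (mu B <= s%:E)%E ->
  (r%:E * pair_energy A B <=
     (2 ^+ n.-1 * s)%:E * (pair_energy A O + pair_energy B O))%E.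
Proof.
move=> r0 s0 mA mB mO rO As Bs.
pose D (x : T) := (\int[mu]_(z in O) pmpow x z)%E.
have D0 x : (0 <= D x)%E by exact: D_ge0.
have mD E : measurable_fun E D by exact: measurable_integral_pmpow.
have K0 x y : (0 <= pmpow x y)%E by exact: pmpow_ge0.
have mK x E : measurable_fun E (pmpow x) by exact: measurable_pmpow.
have c0 : 0 <= 2 ^+ n.-1 :> R by rewrite exprn_ge0.
have step1 x y : (r%:E * pmpow x y <= (2 ^+ n.-1)%:E * (D x + D y))%E.
  apply: (@le_trans _ _ (\int[mu]_(z in O) pmpow x y)%E).
    by rewrite integral_cst// muleC lee_wpmul2l.
  apply: (@le_trans _ _ (\int[mu]_(z in O)
      ((2 ^+ n.-1)%:E * (pmpow x z + pmpow y z)))%E).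
    apply: ge0_le_integral_pointwise => // z _.
    by rewrite (pmpow_sym delta_pm y z); exact: pmpow_triangle.
  by rewrite (ge0_integralZD _ mO c0 (mK x _) (mK y _)).
have step2 x : (r%:E * \int[mu]_(y in B) pmpow x y <=
    (2 ^+ n.-1)%:E * (D x * s%:E + pair_energy B O))%E.
  rewrite -ge0_integralZl//; last by rewrite lee_fin ltW.
  apply: (@le_trans _ _ (\int[mu]_(y in B) ((2 ^+ n.-1)%:E * (D x + D y)))%E).
    by apply: ge0_le_integral_pointwise => // y _; rewrite mule_ge0// lee_fin ltW.
  have -> := @ge0_integralZD _ _ _ mu B _ (fun=> D x) D mB c0
    (measurable_cst _) (mD _) (fun=> D0 x) D0.
  apply: lee_wpmul2l; first by rewrite lee_fin.
  apply: leeD2r; apply: le_trans (_ : D x * mu B <= _)%E.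
    by rewrite -(integral_cst mu mB).
  by apply: lee_wpmul2l.
have mI E : measurable_fun E (fun x => \int[mu]_(y in B) pmpow x y)%E.
  exact: measurable_integral_pmpow.
rewrite /pair_energy -ge0_integralZl//; last by rewrite lee_fin ltW.
apply: (@le_trans _ _ (\int[mu]_(x in A)
   ((2 ^+ n.-1)%:E * (D x * s%:E + pair_energy B O)))%E).
  by apply: ge0_le_integral_pointwise => // y _; rewrite mule_ge0// lee_fin ltW.
have mDs : measurable_fun A (fun x => D x * s%:E)%E.
  by under eq_fun do rewrite muleC; exact: measurable_funeM.
have P0 := pair_energy_ge0.
have Ds0 x : (0 <= D x * s%:E)%E by rewrite mule_ge0.
have -> := @ge0_integralZD _ _ _ mu A _ _ (fun=> pair_energy B O) mA c0 mDs
    (measurable_cst _) Ds0 (fun=> P0 _ _).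
rewrite EFinM -muleA; apply: lee_wpmul2l; first by rewrite lee_fin.
rewrite ge0_muleDr ?P0//; apply: leeD.
  by rewrite (ge0_integralZr _ mA (mD A)) ?lee_fin// muleC.
apply: le_trans (_ : pair_energy B O * mu A <= _)%E.
  by rewrite -(integral_cst mu mA).
by rewrite muleC; apply: lee_wpmul2r.
Qed.

Variables (x0 : 'rV[R]_n) (r : R).
Hypothesis r_gt0 : 0 < r.

(** The annulus is not convex, so [poincare_convex] does not apply to it directly. It is covered by
    these [2 n] convex pieces, one for each axis [i] and each sign [b]. *)
Definition slab (i : 'I_n) (b : bool) : set T :=
  [set x : 'rV[R]_n | cube x0 (4 * r) x /\
     3 / 2 * r <= (-1) ^+ b * (x ord0 i - x0 ord0 i)].

Definition annulus : set T := cube x0 (4 * r) `\` cube x0 (3 / 2 * r).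
Definition big_annulus : set T := cube x0 (8 * r) `\` cube x0 r.

Lemma measurable_annulus : measurable annulus.
Proof. by apply: measurableD; exact: measurable_cube. Qed.

Lemma measurable_big_annulus : measurable big_annulus.
Proof. by apply: measurableD; exact: measurable_cube. Qed.

Lemma measurable_slab i b : measurable (slab i b).
Proof.
apply: measurableI; first exact: measurable_cube.
apply: measurable_set_bool; apply: measurable_fun_ler; first exact: measurable_cst.
apply: measurable_funM; first exact: measurable_cst.
by apply: measurable_funB; [exact: measurable_coord|exact: measurable_cst].
Qed.

Lemma annulus_slab : annulus `<=` \bigcup_p slab p.1 p.2.
Proof.
move=> x [x4 /existsNP[i /negP]]; rewrite -leNgt distrC => xi.
exists (i, x ord0 i - x0 ord0 i < 0) => //; split => //=; move: xi.
by case: ltP => h; rewrite ?expr1 ?expr0 ?mulN1r ?mul1r;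
  [rewrite ltr0_norm|rewrite ger0_norm].
Qed.

Let L := liminf_energy big_annulus.
Let X : \bar R := ((@chain_cst R n * (8 * r) ^+ (2 * n))%:E * L)%E.
Let L_ge0 : (0 <= L)%E. Proof. exact: liminf_energy_ge0. Qed.
Let X_ge0 : (0 <= X)%E.
Proof.
rewrite mule_ge0// lee_fin mulr_ge0// ?ltW ?chain_cst_gt0// exprn_gt0//.
by rewrite mulr_gt0.
Qed.

Lemma sign_norm (b : bool) (x : R) : (-1) ^+ b * x <= `|x|.
Proof.
by case: b; [rewrite expr1 mulN1r -normrN|rewrite expr0 mul1r]; exact: ler_norm.
Qed.

(** The margin [r / 2] is the distance from [3/2 r] to the inner radius [r] of the big annulus. *)
Lemma slab_poincare i b : (pair_energy (slab i b) (slab i b) <= X)%E.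
Proof.
apply: (@poincare_convex _ _ _ n_gt0 delta_pm _ _ (8 * r) (r / 2)).
- by rewrite mulr_gt0.
- by rewrite divr_gt0.
- exact: measurable_slab.
- exact: measurable_big_annulus.
- move=> x y [x4 _] [y4 _] k; apply/ltW.
  have := cube_triangle (cube_sym y4) x4 k; congr (_ < _); ring.
- move=> x y t [x4 xi] [y4 yi] t01; split; first exact: cube_convex.
  move: t01 => /andP[t0 t1]; rewrite !mxE; move: xi yi.
  move: (x0 ord0 i) (x ord0 i) (y ord0 i) ((-1) ^+ b) => c a d s h1 h2.
  have -> : s * (a + t * (d - a) - c) = (1 - t) * (s * (a - c)) + t * (s * (d - c)).
    by ring.
  rewrite [leLHS](_ : _ = (1 - t) * (3 / 2 * r) + t * (3 / 2 * r)); last by ring.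
  by apply: lerD; apply: ler_wpM2l; rewrite ?subr_ge0.
- move=> x [x4 xi] z xz; split.
    apply: (le_cube _ (cube_triangle x4 xz)); move: r_gt0. lra.
  move=> /(_ i); apply/negP; rewrite -leNgt distrC.
  apply: le_trans (sign_norm b _).
  have -> : (-1) ^+ b * (z ord0 i - x0 ord0 i) =
    (-1) ^+ b * (x ord0 i - x0 ord0 i) - (-1) ^+ b * (x ord0 i - z ord0 i) by ring.
  have := sign_norm b (x ord0 i - z ord0 i); have := xz i; move: xi.
  by move: ((-1) ^+ b * _) ((-1) ^+ b * _) => p q; move: r_gt0; lra.
Qed.

Lemma slab_overlap i j b c : i != j ->
  ((r ^+ n)%:E <= mu (slab i b `&` slab j c))%E.
Proof.
(* The cube of radius [r] about [p] has its signed coordinates [i] and [j] between [3/2 r] and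
   [7/2 r], and the others below [r]: it lies in both slabs. *)
move=> ij; pose p : 'rV[R]_n := \row_k (x0 ord0 k +
  (if k == i then (-1) ^+ b * (5 / 2 * r)
   else if k == j then (-1) ^+ c * (5 / 2 * r) else 0)).
apply: le_trans (lebesgue_rV_cube_ge p r_gt0) _; apply: le_outer_measure.
have sgn2 (d : bool) : (-1) ^+ d = 1 :> R \/ (-1) ^+ d = -1 :> R.
  by case: d; [right|left].
move=> x px.
have x4 : cube x0 (4 * r) x.
  move=> k; have := px k; rewrite mxE.
  case: ifP => _; [have [->|->] := sgn2 b|case: ifP => _; [have [->|->] := sgn2 c|]];
    rewrite !ltr_norml => /andP[h1 h2]; apply/andP; split; lra.
split; split => //.
  have := px i; rewrite mxE eqxx.
  by have [->|->] := sgn2 b; rewrite !ltr_norml => /andP[h1 h2]; lra.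
have := px j; rewrite mxE eq_sym (negbTE ij) eqxx.
by have [->|->] := sgn2 c; rewrite !ltr_norml => /andP[h1 h2]; lra.
Qed.

Lemma slab_measure_le i b : (mu (slab i b) <= ((8 * r) ^+ n)%:E)%E.
Proof.
have r4 : 0 <= 4 * r by rewrite mulr_ge0 ?ltW.
rewrite (_ : 8 * r = 2 * (4 * r)); last ring.
apply: le_trans (lebesgue_rV_cube_le x0 r4).
by apply: le_outer_measure => x [].
Qed.

Let c1 : R := 16 ^+ n.
Let c1_ge1 : 1 <= c1. Proof. by rewrite exprn_ege1// ler1n. Qed.

(** Slabs have measure at most [(8 r) ^ n] and the intermediate set at least [r ^ n], so
    [pair_energy_via] costs [2 ^ n.-1 * 8 ^ n], which is below [16 ^ n]. *)
Let via A B O Y Z : measurable O -> ((r ^+ n)%:E <= mu O)%E ->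
  (exists i b, A = slab i b) -> (exists i b, B = slab i b) ->
  (pair_energy A O <= Y -> pair_energy B O <= Z ->
   pair_energy A B <= c1%:E * (Y + Z))%E.
Proof.
move=> mO rO [i [b ->]] [j [c ->]] HA HB.
have rn : 0 < r ^+ n by rewrite exprn_gt0.
have r8 : 0 <= (8 * r) ^+ n by rewrite exprn_ge0 ?mulr_ge0// ltW.
have := pair_energy_via rn r8 (measurable_slab i b) (measurable_slab j c) mO rO
  (slab_measure_le i b) (slab_measure_le j c).
have P0 := pair_energy_ge0.
rewrite -lee_pdivlMl// => /le_trans; apply.
rewrite muleA -EFinM; apply: lee_pmul.
- by rewrite lee_fin mulr_ge0 ?invr_ge0 ?(ltW rn)// mulr_ge0// exprn_ge0.
- by rewrite adde_ge0.
- rewrite lee_fin (_ : _ * _ = 2 ^+ n.-1 * 8 ^+ n); last first.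
    by rewrite exprMn; field; rewrite gt_eqF// exprn_gt0.
  rewrite /c1 (_ : 16 = 2 * 8 :> R); last ring.
  rewrite exprMn ler_wpM2r ?exprn_ge0// ler_weXn2l ?ler1n// leq_pred//.
- exact: leeD.
Qed.

Let i0 : 'I_n := Ordinal n_gt0.
Let i1 : 'I_n := Ordinal n_ge2.

Let slab_pair i b j c : i != j ->
  (pair_energy (slab i b) (slab j c) <= c1%:E * (X + X))%E.
Proof.
move=> ij; apply: (via (O := slab i b `&` slab j c)).
- by apply: measurableI; exact: measurable_slab.
- exact: slab_overlap.
- by exists i, b.
- by exists j, c.
- apply: le_trans (slab_poincare i b); apply: le_pair_energy;
    [exact: measurable_slab| |exact: measurable_slab|exact: subIsetl].
  by apply: measurableI; exact: measurable_slab.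
- apply: le_trans (slab_poincare j c); apply: le_pair_energy;
    [exact: measurable_slab| |exact: measurable_slab|exact: subIsetr].
  by apply: measurableI; exact: measurable_slab.
Qed.

(** The delicate pair is that of two opposite slabs, which do not meet: they are joined through a
    slab along the second axis, which exists because [n >= 2]. *)
Let slab_pair0 j c :
  (pair_energy (slab i0 false) (slab j c) <= (4 * c1 ^+ 2)%:E * X)%E.
Proof.
have c0 : 0 <= c1 by exact: le_trans ler01 c1_ge1.
have XX : (c1%:E * (X + X) = (2 * c1)%:E * X)%E.
  by rewrite -mule2n -mule_natl muleA -EFinM mulrC.
have [<-|ji] := eqVneq i0 j.
  case: c; last first.
    apply: le_trans (slab_poincare _ _) _; rewrite -[leLHS]mul1e lee_wpmul2r//.
    by rewrite lee_fin; move: c1_ge1; move: c1 => c ?; nra.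
  rewrite (_ : (4 * c1 ^+ 2)%:E * X = c1%:E * (c1%:E * (X + X) + c1%:E * (X + X)))%E.
    apply: (via (O := slab i1 false)).
    - exact: measurable_slab.
    - have i01 : i1 != i0 by [].
      apply: le_trans (slab_overlap false false i01) _.
      by apply: le_outer_measure; exact: subIsetl.
    - by exists i0, false.
    - by exists i0, true.
    - exact: slab_pair.
    - exact: slab_pair.
  rewrite XX -mule2n -mule_natl !muleA -!EFinM; congr (_%:E * _)%E; ring.
apply: le_trans (slab_pair _ _ ji) _; rewrite XX lee_wpmul2r// lee_fin.
by move: c1_ge1; move: c1 => k ?; nra.
Qed.

(** There are [2 n] slabs at cost [4 * (16 ^ n) ^ 2] each, and [64 ^ n] comes from [(8 r) ^ (2 n)].
    The resulting 8 is doubled to 16 to make an inequality strict in [annulus_poincare]. *)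
Definition annulus_cst : R :=
  16 * n%:R * (16 ^+ n) ^+ 2 * @chain_cst R n * 64 ^+ n.

Lemma annulus_cst_gt0 : 0 < annulus_cst.
Proof. by rewrite !mulr_gt0 ?exprn_gt0 ?ltr0n ?chain_cst_gt0. Qed.

(** Chebyshev: if every [z] in the annulus violated the bound, integrating over one slab, of measure
    at least [r ^ n], would exceed the pair energy. The centre is produced as a point of the domain,
    so that only the pseudometric is involved. *)
Lemma annulus_poincare (l : R) : 0 < l -> (L <= l%:E)%E ->
  exists2 z : T, annulus z & (\int[mu]_(y in annulus) pmpow z y <=
    (annulus_cst * r ^+ n * l)%:E)%E.
Proof.
move=> l0 Ll; apply: contrapT => /forall2NP H.
pose M := annulus_cst * r ^+ n * l.
have M0 : 0 < M.
  by apply: mulr_gt0 => //; apply: mulr_gt0; [exact: annulus_cst_gt0|exact: exprn_gt0].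
have sub : slab i0 false `<=` annulus.
  move=> x [x4 xi]; split=> // /(_ i0); apply/negP; rewrite -leNgt distrC.
  by apply: le_trans xi _; exact: sign_norm.
have HM z : slab i0 false z -> (M%:E <= \int[mu]_(y in annulus) pmpow z y)%E.
  by move=> /sub az; have [//|/negP] := H z; rewrite -ltNge => /ltW.
have mS i b : measurable (slab i b) by exact: measurable_slab.
have lo : ((M * r ^+ n)%:E <= pair_energy (slab i0 false) annulus)%E.
  apply: (@le_trans _ _ (\int[mu]_(z in slab i0 false) (cst M%:E z))%E).
    rewrite integral_cst// EFinM; apply: lee_wpmul2l; first by rewrite lee_fin ltW.
    have i01 : i0 != i1 by [].
    apply: le_trans (slab_overlap false false i01) _.
    by apply: le_outer_measure; exact: subIsetl.
  by apply: ge0_le_integral_pointwise => // z _; rewrite lee_fin ltW.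
have hi : (pair_energy (slab i0 false) annulus <=
    \sum_(p : 'I_n * bool) pair_energy (slab i0 false) (slab p.1 p.2))%E.
  apply: (@le_trans _ _ (\int[mu]_(x in slab i0 false)
      \sum_(p : 'I_n * bool) \int[mu]_(y in slab p.1 p.2) pmpow x y)%E).
    apply: ge0_le_integral_pointwise => // x _.
    apply: ge0_integral_cover => //.
    - exact: measurable_annulus.
    - exact: measurable_pmpow.
    - by move=> y; exact: pmpow_ge0.
    - exact: annulus_slab.
  have mI (p : 'I_n * bool) : measurable_fun (slab i0 false)
      (fun x => \int[mu]_(y in slab p.1 p.2) pmpow x y)%E.
    exact: measurable_integral_pmpow.
  by rewrite (ge0_integral_sum _ (mS _ _) mI (fun p x _ => D_ge0 _ x)).
have : ((M * r ^+ n)%:E <= (8 * n%:R * c1 ^+ 2)%:E * X)%E.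
  apply: le_trans lo (le_trans hi _).
  apply: (@le_trans _ _ (\sum_(p : 'I_n * bool) (4 * c1 ^+ 2)%:E * X)%E).
    by apply: lee_sum => p _; exact: slab_pair0.
  rewrite sume_const; last by rewrite mule_ge0// lee_fin mulr_ge0// sqr_ge0.
  rewrite card_prod card_ord card_bool natrM muleA -EFinM lee_wpmul2r// lee_fin.
  by rewrite le_eqVlt; apply/orP; left; apply/eqP; ring.
apply/negP; rewrite -ltNge /X muleA -EFinM.
have k0 : 0 <= 8 * n%:R * c1 ^+ 2 * (@chain_cst R n * (8 * r) ^+ (2 * n)).
  rewrite !mulr_ge0 ?sqr_ge0 ?(ltW (chain_cst_gt0 _))// exprn_ge0//.
  by rewrite mulr_ge0 ?ltW.
apply: le_lt_trans (lee_wpmul2l _ Ll) _; first by rewrite lee_fin.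
rewrite -EFinM lte_fin /M /annulus_cst -/c1.
rewrite (_ : (8 * r) ^+ (2 * n) = 64 ^+ n * (r ^+ n * r ^+ n)); last first.
  by rewrite exprM -!exprMn; congr (_ ^+ _); ring.
move: (@chain_cst_gt0 R n) => cc; have rn : 0 < r ^+ n by rewrite exprn_gt0.
have n0 : 0 < n%:R :> R by rewrite ltr0n.
have c6 : 0 < 64 ^+ n :> R by rewrite exprn_gt0.
have c10 : 0 < c1 by exact: lt_le_trans ltr01 c1_ge1.
have q0 : 0 < n%:R * c1 ^+ 2 * @chain_cst R n * 64 ^+ n * (r ^+ n * r ^+ n) * l.
  by rewrite !mulr_gt0 ?exprn_gt0.
move: q0; set q := _ * l; move=> q0.
rewrite [ltLHS](_ : _ = 8 * q); last by rewrite /q; ring.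
rewrite [ltRHS](_ : _ = 16 * q); last by rewrite /q; ring.
lra.
Qed.

End annulus.

(** * Maps into metric and NPC spaces *)

Section dense_sequences.
Context {R : realType} {X : metricType R}.
Implicit Types (A : set X) (d : nat -> X).

(** The terms of [d] need not lie in [A], unlike in [separable_set]; this makes the notion pass to
    subsets. *)
Definition dense_seq A d := forall x, A x -> forall r : R, 0 < r ->
  exists k, mdist (d k) x < r.

Lemma openP_mdist (U : set X) : open U -> forall x, U x ->
  exists2 r : R, 0 < r & forall y, mdist x y < r -> U y.
Proof.
rewrite openE => H x /H /nbhs_ballP[r r0 rU]; exists r => // y xy.
by apply: rU; rewrite ballEmdist.
Qed.

Lemma open_mdist (x : X) (r : R) : open [set y | mdist x y < r].
Proof.
rewrite openE => y /= xy; apply/nbhs_ballP; exists (r - mdist x y) => /=.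
  by rewrite subr_gt0.
move=> z; rewrite ballEmdist /= => yz; apply: le_lt_trans (metric_triangle _ y _) _.
by rewrite -ltrBrDl.
Qed.

Lemma separable_dense_seq A : separable_set A -> A !=set0 ->
  exists d, dense_seq A d.
Proof.
move=> [D [/countable_injP[f finj] DA AD]] [a Aa].
pose d k := if pselect (exists2 x, D x & f x = k) is left h then projT1 (cid2 h) else a.
exists d => x Ax r r0; have := AD _ Ax [set y | mdist x y < r].
case=> [|y [Dy xy]].
  by apply: open_nbhs_nbhs; split; [exact: open_mdist|rewrite /= mdistxx].
exists (f y); rewrite /d; case: pselect => [h|[]]; last by exists y.
case: cid2 => z Dz fz /=; rewrite (_ : z = y) 1?metric_sym//.
by apply: finj; rewrite ?inE.
Qed.

Lemma dense_seq_separable A d : dense_seq A d -> separable_set A.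
Proof.
move=> dA; have [->|/set0P[a Aa]] := eqVneq A set0.
  by exists set0; split => //; exact: countable0.
pose P (p : nat * nat) x := A x /\ mdist (d p.1) x < p.2.+1%:R^-1.
pose f p := if pselect (exists x, P p x) is left h then projT1 (cid h) else a.
exists (range f); split.
- by apply: sub_countable (card_image_le f setT) _; exact: countableP.
- by move=> _ [p _ <-]; rewrite /f; case: pselect => // h; case: cid => x [].
- move=> x Ax B /nbhs_ballP[r /= r0 xB].
  have r2 : 0 < r / 2 by lra.
  have [m] := ltr_add_invr r2; rewrite add0r => mr.
  have m0 : (0 : R) < m.+1%:R^-1 by rewrite invr_gt0.
  have [k kx] := dA _ Ax _ m0.
  exists (f (k, m)); split; first by exists (k, m).
  apply: xB; rewrite ballEmdist /= /f; case: pselect => [h|[]]; last by exists x.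
  case: cid => y [Ay ky] /=; apply: le_lt_trans (metric_triangle _ (d k) _) _.
  rewrite metric_sym in kx; rewrite [r]splitr; apply: ltrD;
    [exact: lt_trans kx mr|exact: lt_trans ky mr].
Qed.

Lemma dense_seq_sub A B d : A `<=` B -> dense_seq B d -> dense_seq A d.
Proof. by move=> AB dB x /AB; exact: dB. Qed.

End dense_sequences.

(** * Measurable maps with separable range *)

Section measurable_maps.
Context {R : realType} {n : nat} {X : metricType R}.
Local Notation T := (lebesgue_rVType R n).
Local Notation mu := (@lebesgue_rV R n).

Record measurable_map (u : T -> X) : Prop := {
  mm_open : forall U : set X, open U -> measurable (u @^-1` U);
  mm_dense : exists d, dense_seq (range u) d
}.

(** A sublevel set is a countable union of products of balls' preimages, indexed by a dense sequence
    in the range of [u] and a rational radius. Without separability the distance need not be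
    measurable for the product sigma-algebra. *)
Lemma measurable_mdist2 (u v : T -> X) : measurable_map u -> measurable_map v ->
  measurable_fun setT (fun p : T * T => mdist (u p.1) (v p.2)).
Proof.
move=> mu_ mv; have [d dd] := mm_dense mu_.
move=> _; apply: (measurability _ (RGenInftyO.measurableE R)) => //.
move=> _ [_ [t ->] <-]; rewrite setTI.
pose B (i : nat * rat) : set (T * T) :=
  [set x | mdist (d i.1) (u x) < ratr i.2] `*`
  [set y | mdist (d i.1) (v y) < t - ratr i.2].
suff -> : (fun p : T * T => mdist (u p.1) (v p.2)) @^-1` `]-oo, t[%classic =
    \bigcup_i B i.
  apply: countable_bigcupT_measurable => [|i]; first exact: countableP.
  apply: measurableX.
    exact: (mm_open mu_ (open_mdist (d i.1) (ratr i.2))).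
  exact: (mm_open mv (open_mdist (d i.1) (t - ratr i.2))).
apply/seteqP; split => [p|p [i _ [/= h1 h2]]]; rewrite /= in_itv/=; last first.
  apply: le_lt_trans (metric_triangle _ (d i.1) _) _; rewrite metric_sym.
  by rewrite (_ : t = ratr i.2 + (t - ratr i.2)) ?ltrD//; ring.
move=> pt; pose g := t - mdist (u p.1) (v p.2).
have g0 : 0 < g / 3 by rewrite divr_gt0// subr_gt0.
have [k kx] : exists k, mdist (d k) (u p.1) < g / 3 by apply: (dd _ _ _ g0); exists p.1.
have : g / 3 < g / 3 + g / 3 by lra.
move=> /rat_in_itvoo[q]; rewrite in_itv/= => /andP[q1 q2].
exists (k, q) => //; split => /=; first exact: lt_trans kx q1.
apply: le_lt_trans (metric_triangle _ (u p.1) _) _.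
have -> : mdist (u p.1) (v p.2) = t - g by rewrite /g; ring.
by lra.
Qed.

Lemma measurable_mdist1 (u : T -> X) (a : X) : measurable_map u ->
  measurable_fun setT (fun x : T => mdist (u x) a).
Proof.
move=> mu_; move=> _; apply: (measurability _ (RGenInftyO.measurableE R)) => //.
move=> _ [_ [t ->] <-]; rewrite setTI.
have := mm_open mu_ (open_mdist a t).
by congr measurable; apply/seteqP; split => x /=; rewrite in_itv/= metric_sym.
Qed.

Lemma measurable_map_pseudometric (u : T -> X) : measurable_map u ->
  measurable_pseudometric (fun x y => mdist (u x) (u y)).
Proof.
move=> mu_; split.
- by move=> x y; exact: mdist_ge0.
- by move=> x; exact: mdistxx.
- by move=> x y; exact: metric_sym.
- by move=> y x z; exact: metric_triangle.
- exact: measurable_mdist2.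
Qed.

Lemma measurable_map_Lp_map (W : set 'rV[R]_n) (u : T -> X) :
  measurable (W : set T) -> measurable_map u ->
  lebesgue_measurable_map W u /\ essentially_separable_range W u.
Proof.
move=> mW mu_; split.
  by move=> U oU; apply: measurableI => //; exact: mm_open.
exists set0; split; first exact: negligible_set0.
have [d dd] := mm_dense mu_; apply: (@dense_seq_separable _ _ _ d).
by apply: dense_seq_sub dd => _ [x _ <-]; exists x.
Qed.

(* On the common refinement of countably many small pieces both [u] and [s] are
   nearly constant. *)
Lemma measurable_map_lipschitz (u v : T -> X) (s : T -> R) (f : T -> R) :
  measurable_map u -> measurable_fun setT s ->
  (forall x y, mdist (v x) (v y) <= mdist (u x) (u y) + `|s x - s y| * f x) ->
  measurable_map v.
Proof.
move=> mu_ ms vuv; have [d dd] := mm_dense mu_.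
pose B (i : nat * rat * nat) : set T :=
  [set x | mdist (d i.1.1) (u x) < i.2.+1%:R^-1] `&`
  [set x | `|ratr i.1.2 - s x| < i.2.+1%:R^-1].
have mB i : measurable (B i).
  apply: measurableI; first exact: (mm_open mu_ (open_mdist (d i.1.1) i.2.+1%:R^-1)).
  apply: measurable_set_bool; apply: measurable_fun_ltr; last exact: measurable_cst.
  apply: (measurableT_comp (@normr_measurable R setT)).
  by apply: measurable_funB; [exact: measurable_cst|exact: ms].
have BP x (e : R) : 0 < e -> exists2 i, B i x &
    forall y, B i y -> mdist (v x) (v y) < e.
  move=> e0; pose c := 2 * (1 + `|f x|).
  have c0 : 0 < c by rewrite mulr_gt0// ltr_wpDr.
  have ec : 0 < e / c by rewrite divr_gt0.
  have [m] := ltr_add_invr ec; rewrite add0r => mr.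
  have m0 : (0 : R) < m.+1%:R^-1 by rewrite invr_gt0.
  have [k kx] : exists k, mdist (d k) (u x) < m.+1%:R^-1.
    by apply: (dd _ _ _ m0); exists x.
  have : s x < s x + m.+1%:R^-1 by rewrite ltrDl.
  move=> /rat_in_itvoo[q]; rewrite in_itv/= => /andP[q1 q2].
  have qs : `|ratr q - s x| < m.+1%:R^-1.
    by rewrite ger0_norm ?subr_ge0 ?(ltW q1)// ltrBlDl.
  exists (k, q, m) => // y [/= ky qy].
  apply: le_lt_trans (vuv x y) _.
  have uxy : mdist (u x) (u y) <= 2 * m.+1%:R^-1.
    apply: le_trans (metric_triangle _ (d k) _) _; rewrite metric_sym.
    by rewrite mulr2n mulrDl mul1r ltW// ltrD.
  have sxy : `|s x - s y| <= 2 * m.+1%:R^-1.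
    apply: le_trans (ler_distD (ratr q) _ _) _; rewrite distrC.
    by rewrite mulr2n mulrDl mul1r ltW// ltrD.
  have H : `|s x - s y| * f x <= 2 * m.+1%:R^-1 * `|f x|.
    apply: le_trans (ler_norm _) _; rewrite normrM normr_id.
    by rewrite ler_wpM2r.
  apply: le_lt_trans (lerD uxy H) _.
  rewrite (_ : _ + _ = c * m.+1%:R^-1); last by rewrite /c; ring.
  by rewrite mulrC -ltr_pdivlMr.
split=> [U oU|].
  rewrite (_ : v @^-1` U = \bigcup_i (if `[< B i `<=` v @^-1` U >] then B i else set0)).
    apply: countable_bigcupT_measurable => [|i]; first exact: countableP.
    by case: ifP.
  apply/seteqP; split => [x Ux|x [i _]]; last by case: ifPn => // /asboolP /[apply].
  have [r r0 rU] := openP_mdist oU Ux; have [i Bx iB] := BP x r r0.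
  by exists i => //; rewrite ifT//; apply/asboolP => y /iB; exact: rU.
(* One sample point in each nonempty piece: the values of [v] there are dense in its range. *)
pose p (i : nat * rat * nat) :=
  if pselect (B i !=set0) is left h then projT1 (cid h) else point.
exists (fun k => v (p (odflt (0%N, 0, 0%N) (unpickle k)))).
move=> _ [x _ <-] r r0.
have r2 : 0 < r / 2 by lra.
have [i Bx iB] := BP x _ r2.
exists (pickle i); rewrite pickleK /= metric_sym.
suff Bp : B i (p i) by apply: lt_trans (iB _ Bp) _; lra.
by rewrite /p; case: pselect => [h|[]]; [case: cid|exists x].
Qed.

(** The Sobolev assumption constrains [u] only on [W], and its range only up to a null set. Sending
    everything else to one fixed point gives a total measurable map with separable range. *)
Lemma measurable_map_modification (W : set 'rV[R]_n) (u : 'rV[R]_n -> X) :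
  measurable (W : set T) ->
  lebesgue_measurable_map W u -> essentially_separable_range W u ->
  exists (N : set T) (u' : T -> X),
    [/\ measurable N, mu N = 0%E, measurable_map u' &
        forall x, W x -> ~ N x -> u' x = u x].
Proof.
move=> mW mu_ [N0 [[N [mN N0_ N0N]] sepN0]].
exists N; have [E|/set0P[x0 Ex0]] := eqVneq (u @` (W `\` N0)) set0.
  exists (fun=> u 0); split => //.
    split=> [U oU|]; last first.
      by exists (fun=> u 0) => _ [x _ <-] r r0; exists 0%N; rewrite mdistxx.
    have [h|h] := pselect (U (u 0)).
      by rewrite (_ : _ @^-1` _ = setT)//; apply/seteqP; split.
    by rewrite (_ : _ @^-1` _ = set0)//; apply/seteqP; split.
  move=> x Wx Nx; exfalso; suff : (u @` (W `\` N0)) (u x) by rewrite E.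
  by exists x => //; split => // /N0N.
have [d dd] := separable_dense_seq sepN0 (ex_intro _ _ Ex0).
pose u' (x : T) := if x \in W `\` N then u x else x0.
have u'E x : W x -> ~ N x -> u' x = u x.
  by move=> Wx Nx; rewrite /u' mem_set.
exists u'; split => //; split => [U oU|].
  have mWU := mu_ U oU.
  rewrite (_ : u' @^-1` U = ((W `&` u @^-1` U) `\` N) `|`
     (if `[< U x0 >] then ~` (W `\` N) else set0)).
    apply: measurableU; first exact: measurableD.
    by case: ifP => // _; apply: measurableC; exact: measurableD.
  apply/seteqP; split => x; rewrite /= /u'.
    case: ifPn => [/set_mem[Wx Nx] Ux|/negP H Ux]; [by left|right].
    by rewrite ifT; [move=> H'; apply: H; exact: mem_set|exact/asboolP].
  move=> [[[Wx Ux] Nx]|]; first by rewrite mem_set.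
  case: ifPn => // /asboolP Ux0 H; rewrite ifN//.
  by apply/negP => /set_mem; exact: H.
exists d => _ [x _ <-]; apply: dd; rewrite /u'; case: ifPn => // /set_mem[Wx Nx].
by exists x => //; split => // /N0N.
Qed.

End measurable_maps.

(** * Contraction of an NPC space to a point *)

Section npc_midpoints.
Context {R : realType} {X : metricType R}.

(** The partition of [[0, 1]] at [t] gives a sum of distances at most the length, which is the
    distance of the endpoints. *)
Lemma geodesic_split (g : R -> X) (P Q : X) (t : R) : geodesic g P Q ->
  0 <= t <= 1 -> mdist P (g t) + mdist (g t) Q = mdist P Q.
Proof.
move=> [cg g0 g1 lg] /andP[t0 t1]; apply/eqP; rewrite eq_le metric_triangle andbT.
have [t0'|tn0] := eqVneq t 0; first by rewrite t0' g0 mdistxx add0r.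
have [t1'|tn1] := eqVneq t 1; first by rewrite t1' g1 mdistxx addr0.
rewrite -lee_fin -lg; apply: ereal_sup_ubound; exists [:: t; 1].
  split=> //=; rewrite andbT; apply/andP; split; rewrite lt_neqAle.
    by rewrite eq_sym tn0.
  by rewrite tn1.
by rewrite /= !big_nat_recl// big_nil/= addr0 g0 g1.
Qed.

Lemma geodesic_reach (g : R -> X) (P Q : X) (l : R) : geodesic g P Q ->
  0 <= l <= 1 -> exists2 t, 0 <= t <= 1 & mdist (g t) P = l * mdist P Q.
Proof.
move=> gg /andP[l0 l1]; have [cg g0 g1 _] := gg.
have cf : {within `[0, 1], continuous (fun t => mdist (g t) P)}.
  apply/subspace_continuousP => t t01.
  apply/cvgrPdist_lt => e e0.
  have /subspace_continuousP/(_ t t01)/metricType_numDomainType.cvgrPdist_lt/(_ e e0) := cg.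
  apply: filterS => s gts; apply: le_lt_trans gts; rewrite /= ler_norml.
  have := metric_triangle (g t) (g s) P; have := metric_triangle (g s) (g t) P.
  rewrite (metric_sym (g s) (g t)) => h1 h2.
  change (- mdist (g t) (g s) <= mdist (g t) P - mdist (g s) P <= mdist (g t) (g s)).
  apply/andP; split; lra.
have [|t t01 ft] := @IVT R _ 0 1 (l * mdist P Q) ler01 cf.
  rewrite g0 g1 mdistxx metric_sym min_l ?mdist_ge0// max_r ?mdist_ge0//.
  by rewrite mulr_ge0 ?mdist_ge0//= ler_piMl ?mdist_ge0.
by exists t => //; move: t01; rewrite in_itv.
Qed.

(** The point is chosen before [P]. The values 0 and 1 of [l], excluded in [NPC], are served by the
    endpoints. *)
Lemma NPC_point (Q S : X) (l : R) : NPC X -> 0 <= l <= 1 ->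
  exists m, forall P, mdist P m ^+ 2 <=
    (1 - l) * mdist P Q ^+ 2 + l * mdist P S ^+ 2 -
    l * (1 - l) * mdist Q S ^+ 2.
Proof.
move=> [_ geo npc] /andP[l0 l1].
have [->|ln0] := eqVneq l 0; first by exists Q => P; nra.
have [->|ln1] := eqVneq l 1; first by exists S => P; nra.
have [gQS hQS] := geo Q S.
have [t t01 tl] : exists2 t, 0 <= t <= 1 & mdist (gQS t) Q = l * mdist Q S.
  by apply: geodesic_reach => //; rewrite l0.
exists (gQS t) => P; have [gPQ hPQ] := geo P Q; have [gSP hSP] := geo S P.
apply: (npc P Q S gPQ gQS gSP hPQ hQS hSP l t) => //.
  by rewrite !lt_neqAle eq_sym ln0 l0 ln1.
have := geodesic_split hQS t01; rewrite metric_sym tl => h; lra.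
Qed.

(* [contraction P m]: [m s Q] plays the role of the point dividing a geodesic
   from [P] to [Q] in ratio [s : 1 - s]. *)
Definition geodesic_contraction (P : X) (m : R -> X -> X) : Prop :=
  [/\ forall Q, m 0 Q = P, forall Q, m 1 Q = Q,
      forall s Q, 0 <= s <= 1 -> mdist P (m s Q) <= s * mdist P Q &
      forall s t Q Q', 0 <= s <= 1 -> 0 <= t <= 1 ->
        mdist (m s Q) (m t Q') <= mdist Q Q' + `|s - t| * mdist P Q].

(** The points [m s Q] are merely chosen to satisfy the NPC inequality against every [A]; this alone
    yields all the properties. Taking [A] to be [P] or [Q] bounds the distances to the endpoints,
    hence fixes [m 0 Q] and [m 1 Q]. *)
Lemma NPC_contraction (P : X) : NPC X -> exists m, geodesic_contraction P m.
Proof.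
move=> npc.
have sqr_le (a b : R) : 0 <= a -> 0 <= b -> a ^+ 2 <= b ^+ 2 -> a <= b.
  by move=> a0 b0; rewrite ler_pXn2r// ?nnegrE.
have : forall x : R * X, exists m, 0 <= x.1 <= 1 -> forall A, mdist A m ^+ 2 <=
    (1 - x.1) * mdist A P ^+ 2 + x.1 * mdist A x.2 ^+ 2 -
    x.1 * (1 - x.1) * mdist P x.2 ^+ 2.
  move=> [s Q] /=; have [s01|s01] := boolP (0 <= s <= 1); last by exists P.
  by have [m Hm] := NPC_point P Q npc s01; exists m.
move=> /choice[m0 Hm0]; pose m s Q := m0 (s, Q).
have Hm (s : R) Q A : 0 <= s <= 1 -> mdist A (m s Q) ^+ 2 <=
    (1 - s) * mdist A P ^+ 2 + s * mdist A Q ^+ 2 - s * (1 - s) * mdist P Q ^+ 2.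
  by move=> s01; exact: (Hm0 (s, Q)).
have Ps (s : R) Q : 0 <= s <= 1 -> mdist P (m s Q) <= s * mdist P Q.
  move=> s01; have /andP[s0 s1] := s01; apply: sqr_le; rewrite ?mulr_ge0 ?mdist_ge0//.
  by apply: le_trans (Hm s Q P s01) _; rewrite mdistxx; nra.
have Qs (s : R) Q : 0 <= s <= 1 -> mdist Q (m s Q) <= (1 - s) * mdist P Q.
  move=> s01; have /andP[s0 s1] := s01.
  apply: sqr_le; rewrite ?mulr_ge0 ?mdist_ge0 ?subr_ge0//.
  by apply: le_trans (Hm s Q Q s01) _; rewrite mdistxx (metric_sym Q P); nra.
have i0 : 0 <= (0 : R) <= 1 by rewrite lexx ler01.
have i1 : 0 <= (1 : R) <= 1 by rewrite lexx ler01.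
have m_speed (s t : R) Q : 0 <= s <= 1 -> 0 <= t <= 1 ->
    mdist (m s Q) (m t Q) <= `|s - t| * mdist P Q.
  move=> s01 t01; have /andP[s0 s1] := s01; have /andP[t0 t1] := t01.
  apply: sqr_le; rewrite ?mulr_ge0 ?mdist_ge0//.
  apply: le_trans (Hm t Q (m s Q) t01) _.
  rewrite exprMn real_normK ?num_real//.
  have := Ps s Q s01; have := Qs s Q s01.
  rewrite (metric_sym P (m s Q)) (metric_sym Q (m s Q)).
  have := mdist_ge0 (m s Q) P; have := mdist_ge0 (m s Q) Q; have := mdist_ge0 P Q.
  move: (mdist (m s Q) P) (mdist (m s Q) Q) (mdist P Q) => a b D D0 b0 a0 hb ha.
  have ha2 : a ^+ 2 <= (s * D) ^+ 2 by rewrite ler_pXn2r// nnegrE mulr_ge0.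
  have hb2 : b ^+ 2 <= ((1 - s) * D) ^+ 2.
    by rewrite ler_pXn2r// nnegrE mulr_ge0// subr_ge0.
  have h1 := ler_wpM2l (_ : 0 <= 1 - t) ha2; have h2 := ler_wpM2l t0 hb2.
  rewrite subr_ge0 in h1; have {}h1 := h1 t1.
  rewrite [leRHS](_ : _ = (1 - t) * (s * D) ^+ 2 + t * ((1 - s) * D) ^+ 2 -
    t * (1 - t) * D ^+ 2); last by ring.
  by lra.
(* Use the inequality for [m s Q'] against [m s Q], then the one for [m s Q] against [Q']: all terms
   containing distances to [P] cancel. *)
have m_contr (s : R) Q Q' : 0 <= s <= 1 -> mdist (m s Q) (m s Q') <= s * mdist Q Q'.
  move=> s01; have /andP[s0 s1] := s01.
  apply: sqr_le; rewrite ?mulr_ge0 ?mdist_ge0//.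
  apply: le_trans (Hm s Q' (m s Q) s01) _.
  have h1 := Hm s Q Q' s01; have h2 := Ps s Q s01.
  rewrite (metric_sym (m s Q) P) (metric_sym (m s Q) Q').
  rewrite (metric_sym Q' Q) (metric_sym Q' P) in h1.
  have h3 : mdist P (m s Q) ^+ 2 <= (s * mdist P Q) ^+ 2.
    by rewrite ler_pXn2r// nnegrE ?mulr_ge0 ?mdist_ge0.
  have h4 := ler_wpM2l s0 h1.
  have h5 : (1 - s) * mdist P (m s Q) ^+ 2 <= (1 - s) * (s * mdist P Q) ^+ 2.
    by rewrite ler_wpM2l// subr_ge0.
  by nra.
exists m; split => //.
- move=> Q; apply/esym/mdist_positivity/eqP; rewrite eq_le mdist_ge0 andbT.
  by have := Ps 0 Q i0; rewrite mul0r.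
- move=> Q; apply/esym/mdist_positivity/eqP; rewrite eq_le mdist_ge0 andbT.
  by have := Qs 1 Q i1; rewrite subrr mul0r.
- move=> s t Q Q' s01 t01; apply: le_trans (metric_triangle _ (m t Q) _) _.
  rewrite addrC; apply: lerD; last exact: m_speed.
  apply: le_trans (m_contr _ _ _ t01) _; move: t01 => /andP[t0 t1].
  by rewrite ler_piMl ?mdist_ge0.
Qed.

End npc_midpoints.

Section integral_affine_bound.
Local Open Scope ereal_scope.
Import HBNNSimple.

(** The integral of a nonmeasurable function is a supremum over simple functions, for which
    subadditivity is not automatic. It survives here because [b] is measurable: for a simple [h]
    below [f], the positive part of [(h - b) / k] is measurable and below [g] almost everywhere. *)
Lemma ge0_integral_affine_bound d (T : measurableType d) (R : realType)
    (mu : {measure set T -> \bar R}) (D N : set T) (k : R) (f g : T -> \bar R)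
    (b : T -> R) :
  measurable D -> measurable N -> mu N = 0 -> (0 < k)%R ->
  measurable_fun setT b -> (forall x, 0 <= b x)%R ->
  (forall x, D x -> 0 <= f x) -> (forall x, D x -> 0 <= g x) ->
  (forall x, D x -> ~ N x -> f x <= k%:E * g x + (b x)%:E) ->
  \int[mu]_(x in D) f x <=
    k%:E * \int[mu]_(x in D) g x + \int[mu]_(x in D) (b x)%:E.
Proof.
move=> mD mN N0 k0 mb b0 f0 g0 fg; rewrite ge0_integralE//.
apply: ge_ereal_sup => _ [h hf <-].
have hD x : D x -> (h x)%:E <= f x by move=> Dx; have := hf x; rewrite patchE mem_set.
have hND x : ~ D x -> h x = 0%R.
  move=> Dx; apply/eqP; rewrite eq_le fun_ge0 andbT -lee_fin.
  by have := hf x; rewrite patchE memNset.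
pose h' x : R := Num.max 0%R ((h x - b x) / k)%R.
have h'0 x : (0 <= h' x)%R by rewrite /h' le_max lexx.
have mh : measurable_fun setT h by [].
have mh' : measurable_fun setT h'.
  apply: measurable_maxr; first exact: measurable_cst.
  apply: measurable_funM; last exact: measurable_cst.
  exact: measurable_funB.
have mEh' : measurable_fun D (EFin \o h').
  by apply/measurable_EFinP; exact: measurable_funTS.
have mEb : measurable_fun D (EFin \o b).
  by apply/measurable_EFinP; exact: measurable_funTS.
rewrite -integralT_nnsfun (_ : integral _ _ _ = \int[mu]_(x in D) (h x)%:E); last first.
  rewrite [RHS]integral_mkcond; apply: eq_integral => x _; rewrite patchE.
  by case: ifPn => // /negP Dx; rewrite hND// => /mem_set.
apply: (@le_trans _ _ (\int[mu]_(x in D) (k%:E * (h' x)%:E + (b x)%:E))).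
  apply: ge0_le_integral_pointwise => // x _; first by rewrite lee_fin fun_ge0.
  rewrite -EFinM -EFinD lee_fin -lerBlDr mulrC -ler_pdivrMr//.
  by rewrite le_max lexx orbT.
have mkh' : measurable_fun D (fun x => k%:E * (h' x)%:E).
  exact: (@measurable_funeM _ _ _ _ (EFin \o h')).
have kh'0 x : D x -> 0 <= k%:E * (h' x)%:E.
  by move=> _; rewrite mule_ge0// lee_fin// ltW.
have Eb0 x : D x -> 0 <= (EFin \o b) x by move=> _; rewrite lee_fin.
have Eh'0 x : D x -> 0 <= (EFin \o h') x by move=> _; rewrite lee_fin.
rewrite (ge0_integralD _ mD kh'0 mkh' Eb0 mEb).
apply: leeD2r; rewrite (ge0_integralZl_EFin _ mD Eh'0 mEh' (ltW k0)).
apply: lee_wpmul2l; first by rewrite lee_fin ltW.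
apply: (@ge0_le_integral_ae _ _ _ _ _ N) => // x Dx Nx.
have := le_trans (hD x Dx) (fg x Dx Nx); rewrite -leeBlDr// -EFinB => H.
rewrite /= /h' maxElt; case: ifPn => _; last exact: g0.
by rewrite mulrC EFinM lee_pdivrMl.
Qed.

End integral_affine_bound.

(** * Euclidean balls, cutoff functions and the topology of cubes *)

Section euclidean_cubes.
Context {R : realType} {n : nat}.
Local Notation T := (lebesgue_rVType R n).
Local Notation mu := (@lebesgue_rV R n).
Implicit Types (x y : 'rV[R]_n) (W : set 'rV[R]_n).

Lemma norm_cube x y (r : R) : 0 < r -> cube x r y <-> `|x - y| < r.
Proof. by move=> r0; rewrite -ball_cube// -ball_normE. Qed.

Lemma coord_le_enorm x i : `|x ord0 i| <= enorm x.
Proof.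
rewrite -sqrtr_sqr ler_sqrt; last by apply: sumr_ge0 => j _; exact: sqr_ge0.
by rewrite (bigD1 i)//= lerDl sumr_ge0// => j _; exact: sqr_ge0.
Qed.

Lemma eball_cube x (e : R) : eball x e `<=` cube x e.
Proof.
move=> y xy i; have := coord_le_enorm (x - y) i; rewrite !mxE => h.
exact: le_lt_trans h xy.
Qed.

Lemma norm_le_enorm x : `|x| <= enorm x.
Proof.
apply/ler_addgt0Pr => e e0; apply/ltW.
have e1 : 0 < enorm x + e by rewrite ltr_wpDl// sqrtr_ge0.
have /(norm_cube x 0 e1) : cube x (enorm x + e) 0; last by rewrite subr0.
move=> i; rewrite !mxE subr0.
by apply: le_lt_trans (coord_le_enorm x i) _; rewrite ltrDl.
Qed.

Hypothesis n_gt0 : (0 < n)%N.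

(** The radius [e] over the square root of [n] would do; dividing by [n] keeps the constants free of
    roots. *)
Lemma cube_eball x (e : R) : 0 < e -> cube x (e / n%:R) `<=` eball x e.
Proof.
move=> e0 y xy; rewrite /eball /= /enorm.
have n0 : 0 < n%:R :> R by rewrite ltr0n.
have n1 : 1 <= n%:R :> R by rewrite ler1n.
have -> : e = Num.sqrt (e ^+ 2) by rewrite sqrtr_sqr gtr0_norm.
rewrite ltr_sqrt ?exprn_gt0//.
apply: (@lt_le_trans _ _ (\sum_(i < n) (e / n%:R) ^+ 2)); last first.
  rewrite sumr_const card_ord -[(e / n%:R) ^+ 2 *+ n]mulr_natr.
  have -> : (e / n%:R) ^+ 2 * n%:R = e ^+ 2 * n%:R^-1 by field; rewrite gt_eqF.
  by rewrite ler_piMr ?exprn_ge0 ?(ltW e0)// invf_le1.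
have H i : (x - y) ord0 i ^+ 2 < (e / n%:R) ^+ 2.
  rewrite -real_normK ?num_real// ltrXn2r// ?nnegrE ?divr_ge0 ?ltW//.
  by rewrite !mxE xy.
apply: ltr_sum => [|i _]; last exact: H.
by apply/hasP; exists (Ordinal n_gt0); rewrite ?mem_index_enum.
Qed.

Lemma lebesgue_rV_eball x (e : R) : 0 < e ->
  [/\ (mu (eball x e) \is a fin_num)%E, (e / n%:R) ^+ n <= fine (mu (eball x e)) &
      fine (mu (eball x e)) <= (2 * e) ^+ n].
Proof.
move=> e0; have n0 : 0 < n%:R :> R by rewrite ltr0n.
have hi : (mu (eball x e) <= ((2 * e) ^+ n)%:E)%E.
  apply: le_trans (lebesgue_rV_cube_le x (ltW e0)); apply: le_outer_measure.
  exact: eball_cube.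
have lo : (((e / n%:R) ^+ n)%:E <= mu (eball x e))%E.
  apply: le_trans (lebesgue_rV_cube_ge x (divr_gt0 e0 n0)) _.
  by apply: le_outer_measure; exact: cube_eball.
have fin : (mu (eball x e) \is a fin_num)%E.
  by rewrite ge0_fin_numE//; exact: le_lt_trans hi (ltry _).
by split => //; rewrite -lee_fin fineK.
Qed.

Lemma inner_part_cube W x (rho e : R) : open W -> cube x rho `<=` W ->
  0 < e -> e < rho -> inner_part W e x.
Proof.
move=> oW xW e0 er; have r0 := lt_trans e0 er; split.
  by apply: xW; exact: cube_center.
apply: lt_le_trans (_ : rho%:E <= _)%E; first by rewrite lte_fin.
apply: le_ereal_inf_tmp => _ [y [_ Wy] <-]; rewrite lee_fin leNgt.
apply/negP => xy; apply: Wy; move: oW; rewrite openE; apply.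
by apply: xW; exact: eball_cube.
Qed.

(** Lebesgue number argument: cover [K] by cubes of half the size that fits into [W], and take the
    least radius of a finite subcover. *)
Lemma open_cube_uniform W (K : set 'rV[R]_n) : open W -> compact K -> K `<=` W ->
  exists2 tau, 0 < tau & forall x, K x -> cube x tau `<=` W.
Proof.
move=> oW cK KW.
have /choice[r Hr] : forall x, exists r : R, 0 < r /\ (W x -> cube x (2 * r) `<=` W).
  move=> x; have [Wx|Wx] := pselect (W x); last by exists 1.
  have [r r0 H] := openP_cube oW Wx; exists (r / 2); split; first by rewrite divr_gt0.
  by move=> _; rewrite mulrC divfK.
rewrite compact_cover in cK.
have [|x Kx|D Dsub KD] := cK _ K (fun x => cube x (r x)).
- by move=> x _; exact: open_cube.
- by exists x => //; apply: cube_center; exact: (Hr x).1.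
pose tau := \big[Num.min/1]_(x <- finmap.enum_fset D) r x.
exists tau.
  rewrite /tau; elim/big_ind: _ => // [a b a0 b0|x _]; last exact: (Hr x).1.
  by rewrite lt_min a0.
move=> y Ky z yz; have [x /= xD xy] := KD _ Ky.
have Wx : W x by apply: KW; have := Dsub _ xD; rewrite inE.
apply: ((Hr x).2 Wx); rewrite mulr2n mulrDl mul1r; apply: cube_triangle xy _.
by apply: le_cube yz; rewrite /tau; exact: ge_bigmin_seq.
Qed.

End euclidean_cubes.

Section clamp.
Context {R : realType}.

Definition clamp (t : R) := Num.max 0 (Num.min 1 t).

Lemma clamp_itv t : 0 <= clamp t <= 1.
Proof. by rewrite /clamp le_max lexx/= ge_max ler01 ge_min lexx. Qed.

Lemma clamp0 t : t <= 0 -> clamp t = 0.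
Proof.
by move=> t0; apply/max_idPl; rewrite ge_min t0 orbT.
Qed.

Lemma clamp1 t : 1 <= t -> clamp t = 1.
Proof. by move=> t1; rewrite /clamp min_l// max_r. Qed.

Lemma clamp_lipschitz s t : `|clamp s - clamp t| <= `|s - t|.
Proof.
have E x : clamp x = if x < 0 then 0 else if x < 1 then x else 1.
  case: (ltP x 0) => x0; first exact/clamp0/ltW.
  case: (ltP x 1) => x1; last exact: clamp1.
  by rewrite /clamp min_r ?max_r// ltW.
rewrite !E; have := ler_norm (s - t); have := ler_norm (- (s - t)).
rewrite normrN => h1 h2; rewrite ler_norml.
by case: (ltP s 0) => ?; case: (ltP s 1) => ?; case: (ltP t 0) => ?;
  case: (ltP t 1) => ?; apply/andP; split; lra.
Qed.

End clamp.

Section cube_topology.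
Context {R : realType} {n : nat}.
Local Notation T := (lebesgue_rVType R n).
Implicit Types (x y : 'rV[R]_n) (W : set 'rV[R]_n).

Definition closed_cube x (r : R) : set 'rV[R]_n :=
  [set y | forall i, `[x ord0 i - r, x ord0 i + r]%classic (y ord0 i)].

Lemma compact_closed_cube x r : compact (closed_cube x r).
Proof.
apply: (@rV_compact _ _ (fun i => `[x ord0 i - r, x ord0 i + r]%classic)) => i.
exact: segment_compact.
Qed.

Lemma closed_closed_cube (x : 'rV[R]_n) (r : R) : closed (closed_cube x r).
Proof. by apply: compact_closed; [exact: norm_hausdorff|exact: compact_closed_cube]. Qed.

Lemma cube_closed_cube x r : cube x r `<=` closed_cube x r.
Proof.
by move=> y xy i /=; rewrite in_itv/=; have := ltW (xy i); rewrite distrC ler_distl.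
Qed.

Lemma closed_cube_cube x r s : r < s -> closed_cube x r `<=` cube x s.
Proof.
move=> rs y xy i; have := xy i; rewrite /= in_itv/= -ler_distl distrC => h.
exact: le_lt_trans h rs.
Qed.

Lemma closure_sub_closed_cube x r (A : set 'rV[R]_n) : A `<=` closed_cube x r ->
  closure A `<=` closed_cube x r.
Proof.
move=> /closure_subset; rewrite -(closure_id (closed_cube x r)).1//.
exact: (@closed_closed_cube x r).
Qed.

Lemma compact_closure_sub x r (A : set 'rV[R]_n) : A `<=` closed_cube x r ->
  compact (closure A).
Proof.
move=> /closure_sub_closed_cube; apply: subclosed_compact.
  exact: closed_closure.
exact: compact_closed_cube.
Qed.

Lemma connected_cube x (r : R) : 0 < r -> connected (cube x r).
Proof.
move=> r0.
pose S (y : 'rV[R]_n) := [set x + t *: (y - x) | t in `[(0 : R), 1]%classic].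
have SE : cube x r = \bigcup_(y in cube x r) S y.
  apply/seteqP; split => [y xy|z [y xy [t]]].
    exists y; first exact: xy.
    by exists 1; [rewrite /= in_itv/= ler01 lexx|rewrite scale1r addrC subrK].
  rewrite /= in_itv/= => t01 <-; apply: cube_convex => //; exact: cube_center.
rewrite SE; apply: bigcup_connected.
  exists x => y xy; exists 0; first by rewrite /= in_itv/= ler01 lexx.
  by rewrite scale0r addr0.
move=> y _; apply: connected_continuous_connected; first exact: segment_connected.
apply: continuous_subspaceT => t.
by apply: cvgD; [exact: cvg_cst|apply: cvgZr_tmp; exact: cvg_id].
Qed.

Lemma domain_cube x (r : R) : 0 < r -> domain (cube x r).
Proof.
move=> r0; split; [|exact: open_cube|exact: connected_cube].
by exists x; exact: cube_center.
Qed.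

Definition cutoff x (r : R) (y : 'rV[R]_n) : R := clamp (2 - `|x - y| / r).

Lemma norm_dist_lipschitz x y z (r c : R) : 0 < r ->
  `|(c - `|x - y| / r) - (c - `|x - z| / r)| <= `|y - z| / r.
Proof.
move=> r0; have -> : (c - `|x - y| / r) - (c - `|x - z| / r) =
  (`|x - z| - `|x - y|) / r by ring.
rewrite normrM (gtr0_norm (_ : 0 < r^-1)) ?invr_gt0// ler_pM2r ?invr_gt0//.
apply: le_trans (ler_dist_dist _ _) _.
by rewrite opprB addrC addrA subrK addrC.
Qed.

Lemma continuous_cutoff x (r : R) : 0 < r -> continuous (cutoff x r).
Proof.
move=> r0 y; apply/(@cvgrPdist_lt _ _ _ _ (nbhs_filter y)) => e e0.
apply/nbhs_cubeP.
exists (e * r); first by rewrite mulr_gt0.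
move=> z /(norm_cube _ _ (mulr_gt0 e0 r0)) yz.
apply: le_lt_trans (clamp_lipschitz _ _) _.
apply: le_lt_trans (norm_dist_lipschitz _ _ _ _ r0) _.
by rewrite ltr_pdivrMr.
Qed.

Lemma cutoff_Cc W x (r : R) : 0 < r -> cube x (4 * r) `<=` W -> Cc W (cutoff x r).
Proof.
move=> r0 xW.
have sub : [set y | cutoff x r y != 0] `<=` closed_cube x (2 * r).
  move=> y /= /eqP cy; apply: cube_closed_cube; apply/norm_cube; first by rewrite mulr_gt0.
  rewrite ltNge; apply/negP => xy; apply: cy; apply: clamp0.
  by rewrite subr_le0 ler_pdivlMr.
split; first exact: continuous_cutoff.
  exact: compact_closure_sub sub.
move=> y /(closure_sub_closed_cube sub) xy; apply: xW.
by apply: closed_cube_cube xy; lra.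
Qed.

Lemma cutoff_eq1 x (r : R) y : 0 < r -> cube x r y -> cutoff x r y = 1.
Proof.
move=> r0 /(norm_cube _ _ r0) xy; apply: clamp1.
have : `|x - y| / r < 1 by rewrite ltr_pdivrMr// mul1r.
lra.
Qed.

End cube_topology.

(** * Comparison with the Korevaar-Schoen energy *)

Section limsup_right.
Context {R : realType}.
Implicit Types (F : R -> \bar R) (M : \bar R).

Lemma at_right0P (A : set R) :
  (0 : R)^'+ A <-> exists2 d : R, 0 < d & forall e, 0 < e < d -> A e.
Proof.
split=> [/nbhs_ballP[d /= d0 H]|[d d0 H]].
  exists d => // e /andP[e0 ed]; apply: H => //.
  by rewrite /ball/= sub0r normrN gtr0_norm.
apply/nbhs_ballP; exists d => // e; rewrite /ball/= sub0r normrN => ed e0.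
by apply: H; rewrite e0 -(gtr0_norm e0).
Qed.

Lemma limf_esup_right_le F M (d : R) : 0 < d ->
  (forall e, 0 < e < d -> (F e <= M)%E) -> (limf_esup F 0^'+ <= M)%E.
Proof.
move=> d0 H; apply: le_trans (ereal_inf_lbound _) _.
  by exists [set e | 0 < e < d] => //; apply/at_right0P; exists d.
by apply: ge_ereal_sup => _ [e ed <-]; exact: H.
Qed.

Lemma limf_esup_right_ge F M :
  (forall d : R, 0 < d -> exists2 e, 0 < e < d & (M <= F e)%E) ->
  (M <= limf_esup F 0^'+)%E.
Proof.
move=> H; apply: le_ereal_inf_tmp => _ [A /at_right0P[d d0 dA] <-].
have [e ed Me] := H d d0; apply: le_trans Me _.
by apply: ereal_sup_ubound; exists e => //; exact: dA.
Qed.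

Lemma limf_esup_right_lt F M : (limf_esup F 0^'+ < M)%E ->
  exists2 d : R, 0 < d & forall e, 0 < e < d -> (F e <= M)%E.
Proof.
move=> /ereal_inf_lt[_ [A /at_right0P[d d0 dA] <-]] /ltW FM.
exists d => // e ed; apply: le_trans FM.
by apply: ereal_sup_ubound; exists e => //; exact: dA.
Qed.

End limsup_right.

Section energy_densities.
Context {R : realType} {n : nat} {X : metricType R}.
Local Notation T := (lebesgue_rVType R n).
Local Notation mu := (@lebesgue_rV R n).
Hypothesis n_gt0 : (0 < n)%N.
Variables (W : set 'rV[R]_n) (u : 'rV[R]_n -> X) (u' : T -> X) (N : set T).
Hypotheses (oW : open W) (u'_mm : measurable_map u').
Hypotheses (mN : measurable N) (N0 : mu N = 0%E).
Local Notation delta := (fun x y => mdist (u' x) (u' y)).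
Let delta_pm := measurable_map_pseudometric u'_mm.

(** Passage from the given map to its measurable modification at one point. Equality of the
    integrals is obtained as two inequalities, which spares a measurability proof for the integrand
    in [u]. *)
Lemma energy_densityE (e : R) (x : 'rV[R]_n) : 0 < e -> inner_part W e x ->
  u' x = u x -> (forall y, eball x e y -> ~ N y -> u' y = u y) ->
  energy_density n%:R e W u x =
  (((fine (mu (eball x e)))^-1 / e ^+ n)%:E *
   \int[mu]_(y in (eball x e : set T)) pmpow delta x y)%E.
Proof.
move=> e0 ix ux uy; rewrite /energy_density ifT; last exact: mem_set.
rewrite EFinM -muleA; congr (_ * _)%E.
have mB : measurable (eball x e : set T) by exact: measurable_eball.
have en : 0 <= (e ^+ n)^-1 by rewrite invr_ge0 exprn_ge0// ltW.
have K0 y : (0 <= pmpow delta x y)%E by exact: (pmpow_ge0 delta_pm).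
rewrite -(ge0_integralZl_EFin _ mB (fun y _ => K0 y))//; last first.
  exact: measurable_pmpow.
have I0 y : (0 <= (mdist (u x) (u y) `^ n%:R / e `^ n%:R)%:E)%E.
  by rewrite lee_fin divr_ge0// powR_ge0.
have J0 y : (0 <= (e ^+ n)^-1%:E * pmpow delta x y)%E by rewrite mule_ge0.
have IJ y : eball x e y -> ~ N y ->
    ((mdist (u x) (u y) `^ n%:R / e `^ n%:R)%:E = (e ^+ n)^-1%:E * pmpow delta x y)%E.
  move=> xy Ny; rewrite !powR_mulrn ?mdist_ge0 ?(ltW e0)//.
  by rewrite /pmpow -EFinM mulrC ux uy.
apply/eqP; rewrite eq_le; apply/andP; split;
  apply: (@ge0_le_integral_ae _ _ _ _ _ N) => // y xy Ny; rewrite IJ//.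
Qed.

Variable c : nat -> R -> R.
Hypothesis c_gt0 : forall m p, 0 < c m p.
Hypothesis u'E : forall x, W x -> ~ N x -> u' x = u x.

(** The Euclidean ball of radius [e] has volume at most [(2 e) ^ n] and contains the cube of radius
    [e / n], whose energy is normalized by [(e / n) ^ (2 n)]. *)
Definition energy_lower_cst : R := (2 ^+ n * n%:R ^+ (2 * n))^-1.

Lemma energy_lower_cst_gt0 : 0 < energy_lower_cst.
Proof. by rewrite invr_gt0 mulr_gt0 ?exprn_gt0 ?ltr0n. Qed.

Lemma energy_density_ge0 (e : R) (w : 'rV[R]_n -> X) x :
  (0 <= energy_density n%:R e W w x)%E.
Proof.
rewrite /energy_density; case: ifP => // _; apply: mule_ge0.
  by rewrite lee_fin invr_ge0 fine_ge0.
by apply: integral_ge0 => y _; rewrite lee_fin divr_ge0 ?powR_ge0.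
Qed.

Lemma approx_energy_lower (x0 : 'rV[R]_n) (rho e : R) :
  cube x0 (4 * rho) `<=` W -> 0 < e -> e < rho ->
  ((c n n%:R * energy_lower_cst)%:E *
     scaled_energy delta (e / n%:R) (cube x0 rho) <=
   approx_energy c n%:R e W u (cutoff x0 rho))%E.
Proof.
move=> xW e0 er; have rho0 := lt_trans e0 er.
have n0 : 0 < n%:R :> R by rewrite ltr0n.
rewrite EFinM -muleA; apply: lee_wpmul2l; first by rewrite lee_fin ltW.
have mQ : measurable (cube x0 rho : set T) by exact: measurable_cube.
have mW : measurable (W : set T) by exact: open_measurable_rV.
have QW : cube x0 rho `<=` W.
  by apply: subset_trans xW; apply: le_cube; lra.
pose k : R := energy_lower_cst * ((e / n%:R) ^+ (2 * n))^-1.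
have k0 : 0 <= k.
  rewrite mulr_ge0 ?(ltW energy_lower_cst_gt0)// invr_ge0 exprn_ge0//.
  by rewrite divr_ge0// ltW.
have dens0 x : (0 <= dens delta (e / n%:R) x)%E by exact: (dens_ge0 delta_pm).
have mdens D : measurable_fun D (dens delta (e / n%:R)).
  exact: (measurable_dens delta_pm).
rewrite /scaled_energy muleA -EFinM -/k /energy_at.
rewrite -(ge0_integralZl_EFin _ mQ (fun x _ => dens0 x))// integral_mkcond.
rewrite [leRHS]integral_mkcond.
have f01 x : 0 <= cutoff x0 rho x by have /andP[] := clamp_itv (2 - `|x0 - x| / rho).
apply: (@ge0_le_integral_ae _ _ _ _ _ N) => //.
- by move=> x _; rewrite patchE; case: ifP => // _; rewrite mule_ge0.
- move=> x _; rewrite patchE; case: ifP => // _.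
  by rewrite mule_ge0 ?energy_density_ge0// lee_fin.
move=> x _ Nx; rewrite !patchE; case: ifPn => [/set_mem xQ|_]; last first.
  by case: ifP => // _; rewrite mule_ge0 ?energy_density_ge0// lee_fin.
rewrite mem_set; last exact: QW.
rewrite (cutoff_eq1 rho0 xQ) mul1e.
have xeW : cube x rho `<=` W.
  move=> y xy; apply: xW; apply: le_cube (cube_triangle xQ xy); lra.
rewrite energy_densityE//; last 3 first.
- exact: inner_part_cube xeW e0 er.
- by apply: u'E => //; exact: QW.
- move=> y xy Ny; apply: u'E => //; apply: xeW; apply: (le_cube (ltW er)).
  exact: eball_cube.
have [fm ml mh] := lebesgue_rV_eball n_gt0 x e0.
have m0 : 0 < fine (mu (eball x e)).
  by apply: lt_le_trans ml; rewrite exprn_gt0 ?divr_gt0.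
apply: lee_pmul => //.
  have E : 2 ^+ n * n%:R ^+ (2 * n) * (e / n%:R) ^+ (2 * n) = (2 * e) ^+ n * e ^+ n.
    rewrite !exprM -!exprMn; congr (_ ^+ _).
    by field; rewrite gt_eqF.
  rewrite lee_fin /k /energy_lower_cst -invfM E.
  rewrite invfM ler_wpM2r ?invr_ge0 ?exprn_ge0 ?(ltW e0)//.
  by rewrite lef_pV2// posrE exprn_gt0// mulr_gt0.
apply: ge0_subset_integral => //.
- exact: measurable_cube.
- exact: measurable_eball.
- exact: measurable_pmpow.
- by move=> y _; exact: (pmpow_ge0 delta_pm).
- exact: cube_eball.
Qed.

(** A single test function suffices: its limsup along [e] dominates the liminf along the scales
    [e / n]. *)
Lemma energy_lower (x0 : 'rV[R]_n) (rho : R) : 0 < rho ->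
  cube x0 (4 * rho) `<=` W ->
  ((c n n%:R * energy_lower_cst)%:E * liminf_energy delta (cube x0 rho) <=
   energy c n%:R W u)%E.
Proof.
move=> rho0 xW; have n0 : 0 < n%:R :> R by rewrite ltr0n.
pose f := cutoff x0 rho.
apply: le_trans (_ : limf_esup (fun e => approx_energy c n%:R e W u f) 0^'+ <= _)%E;
    last first.
  apply: ereal_sup_ubound; exists f => //; split; first exact: cutoff_Cc.
  by move=> x; exact: clamp_itv.
have C0 : 0 < c n n%:R * energy_lower_cst by rewrite mulr_gt0// energy_lower_cst_gt0.
apply: le_ereal_inf_tmp => _ [A /at_right0P[a a0 aA] <-].
rewrite -lee_pdivlMl//; apply: liminf_energy_le => d d0.
pose t := Num.min a (Num.min rho (d * n%:R)).
have t0 : 0 < t by rewrite !lt_min a0 rho0 mulr_gt0.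
have ta : t <= a by rewrite ge_min lexx.
have trho : t <= rho by rewrite /t !ge_min lexx !orbT.
have td : t <= d * n%:R by rewrite /t !ge_min lexx !orbT.
exists (t / 2 / n%:R); first by rewrite !divr_gt0//= ltr_pdivrMr//; lra.
have e0 : 0 < t / 2 by lra.
have er : t / 2 < rho by lra.
rewrite lee_pdivlMl//; apply: le_trans (approx_energy_lower xW e0 er) _.
by apply: ereal_sup_ubound; exists (t / 2) => //; apply: aA; lra.
Qed.

End energy_densities.

(** * Hole filling *)

Section competitor.
Context {R : realType} {n : nat} {X : metricType R}.
Local Notation T := (lebesgue_rVType R n).
Local Notation mu := (@lebesgue_rV R n).
Hypothesis n_ge2 : (2 <= n)%N.
Let n_gt0 : (0 < n)%N. Proof. exact: ltn_trans n_ge2. Qed.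
Variables (u : T -> X) (z0 : T) (m : R -> X -> X) (x0 : 'rV[R]_n) (r : R).
Hypotheses (u_mm : measurable_map u) (r_gt0 : 0 < r).
Hypothesis m_contr : geodesic_contraction (u z0) m.
Local Notation delta := (fun x y => mdist (u x) (u y)).
Let delta_pm := measurable_map_pseudometric u_mm.

(** Parameter of the contraction, with Lipschitz constant [1 / r]: the competitor is constant inside
    radius [2 r] and equals [u] outside radius [3 r]. *)
Definition ramp (x : T) : R := clamp (`|x0 - x| / r - 2).
Definition competitor (x : T) : X := m (ramp x) (u x).
Local Notation s := ramp.
Local Notation v := competitor.
Local Notation delta_v := (fun x y => mdist (v x) (v y)).

Lemma ramp_itv x : 0 <= s x <= 1. Proof. exact: clamp_itv. Qed.

Let s_lip (x y : 'rV[R]_n) : `|s x - s y| <= `|x - y| / r.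
Proof.
apply: le_trans (clamp_lipschitz _ _) _; rewrite distrC.
have -> : `|x0 - y| / r - 2 - (`|x0 - x| / r - 2) =
  (2 - `|x0 - x| / r) - (2 - `|x0 - y| / r) by ring.
exact: norm_dist_lipschitz.
Qed.

Lemma ramp_near (e : R) (x y : 'rV[R]_n) : 0 < e -> cube x e y -> `|s x - s y| <= e / r.
Proof.
move=> e0 /(norm_cube _ _ e0) xy; apply: le_trans (s_lip x y) _.
by rewrite ler_pM2r ?invr_gt0// ltW.
Qed.

Lemma ramp_in x : cube x0 (2 * r) x -> s x = 0.
Proof.
move=> xr; have r2 : 0 < 2 * r by rewrite mulr_gt0.
move/(norm_cube _ _ r2) : xr => /ltW xr; apply: clamp0.
by rewrite subr_le0 ler_pdivrMr.
Qed.

Lemma ramp_out x : ~ cube x0 (3 * r) x -> s x = 1.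
Proof.
move=> xr; have r3 : 0 < 3 * r by rewrite mulr_gt0.
have : 3 * r <= `|x0 - x| by rewrite leNgt; apply/negP => /(norm_cube _ _ r3).
by move=> h; apply: clamp1; rewrite lerBrDr ler_pdivlMr// (_ : 1 + 2 = 3).
Qed.

Let measurable_s : measurable_fun setT s.
Proof.
have mnorm : measurable_fun setT (fun x : T => `|x0 - x|).
  move=> _; apply: (measurability _ (RGenInftyO.measurableE R)) => //.
  move=> _ [_ [t ->] <-]; rewrite setTI.
  have [t0|t0] := leP t 0.
    rewrite (_ : _ @^-1` _ = set0)//; apply/seteqP; split => // x /=.
    by rewrite in_itv/= ltNge (le_trans t0).
  have := measurable_cube x0 t; congr measurable.
  by apply/seteqP; split => x /=; rewrite in_itv/= => /(norm_cube _ _ t0).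
apply: measurable_maxr; first exact: measurable_cst.
apply: measurable_minr; first exact: measurable_cst.
apply: measurable_funB; last exact: measurable_cst.
by apply: measurable_funM; [exact: mnorm|exact: measurable_cst].
Qed.

Lemma competitor_dist x y :
  mdist (v x) (v y) <= mdist (u x) (u y) + `|s x - s y| * mdist (u z0) (u x).
Proof. by case: m_contr => _ _ _; apply; exact: ramp_itv. Qed.

Lemma competitor_measurable : measurable_map v.
Proof. exact: measurable_map_lipschitz u_mm measurable_s competitor_dist. Qed.

Lemma competitor_out x : ~ cube x0 (3 * r) x -> v x = u x.
Proof. by move=> /ramp_out sx; rewrite /v sx; case: m_contr. Qed.

Lemma competitor_in x : cube x0 (2 * r) x -> v x = u z0.
Proof. by move=> /ramp_in sx; rewrite /v sx; case: m_contr. Qed.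

Let v_pm := measurable_map_pseudometric competitor_measurable.

Lemma competitor_pmpow x y : (pmpow delta_v x y <= (2 ^+ n.-1)%:E *
   (pmpow delta x y + (`|s x - s y| ^+ n)%:E * pmpow delta z0 x))%E.
Proof.
rewrite /pmpow -[X in (_ <= _ * (_ + X))%E]EFinM -EFinD -EFinM lee_fin -exprMn.
have a0 : 0 <= mdist (u x) (u y) by exact: mdist_ge0.
have b0 : 0 <= `|s x - s y| * mdist (u z0) (u x) by rewrite mulr_ge0 ?mdist_ge0.
have := power_mean2 n.-1 a0 b0; rewrite prednK//; apply: le_trans.
by apply: lerXn2r (competitor_dist x y); rewrite nnegrE ?mdist_ge0 ?addr_ge0.
Qed.

Let C2 : R := n%:R ^+ n * 2 ^+ n.-1.
Let C20 : 0 <= C2. Proof. by rewrite mulr_ge0 ?exprn_ge0. Qed.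

Let dens_v (e : R) (x : 'rV[R]_n) : 0 < e ->
  (dens delta_v e x <= (2 ^+ n.-1)%:E *
     (dens delta e x + ((2 * e) ^+ n * (e / r) ^+ n)%:E * pmpow delta z0 x))%E.
Proof.
move=> e0; have mQ : measurable (cube x e : set T) by exact: measurable_cube.
have P0 x' y' : (0 <= pmpow delta x' y')%E by exact: (pmpow_ge0 delta_pm).
have er : 0 <= (e / r) ^+ n by rewrite exprn_ge0// divr_ge0 ?ltW.
have p20 : 0 <= 2 ^+ n.-1 :> R by rewrite exprn_ge0.
have q0 : (0 <= ((e / r) ^+ n)%:E * pmpow delta z0 x)%E by rewrite mule_ge0.
apply: (@le_trans _ _ (\int[mu]_(y in (cube x e : set T)) ((2 ^+ n.-1)%:E *
    (pmpow delta x y + ((e / r) ^+ n)%:E * pmpow delta z0 x)))%E).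
  apply: ge0_le_integral_pointwise => // y xy; first exact: (pmpow_ge0 v_pm).
  apply: le_trans (competitor_pmpow x y) _; apply: lee_wpmul2l => //.
  apply: leeD2l; apply: lee_wpmul2r => //; rewrite lee_fin.
  by apply: lerXn2r (ramp_near e0 xy); rewrite nnegrE// divr_ge0 ?ltW.
have mK : measurable_fun (cube x e : set T) (pmpow delta x).
  exact: measurable_pmpow.
have -> := @ge0_integralZD _ _ _ mu (cube x e) _ (pmpow delta x)
  (fun=> ((e / r) ^+ n)%:E * pmpow delta z0 x)%E mQ p20
  mK (measurable_cst _) (P0 x) (fun=> q0).
apply: lee_wpmul2l => //; apply: leeD2l.
have -> : (((2 * e) ^+ n * (e / r) ^+ n)%:E * pmpow delta z0 x =
    ((e / r) ^+ n)%:E * pmpow delta z0 x * ((2 * e) ^+ n)%:E)%E.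
  by rewrite [RHS]muleC muleA -EFinM.
rewrite (integral_cst mu mQ); apply: lee_wpmul2l => //.
by apply: lebesgue_rV_cube_le; exact: ltW.
Qed.

(** In the second term the powers of [e] cancel, the ramp having difference quotients bounded by
    [1 / r] at every scale. In [C2], [n ^ n] comes from the volume of the Euclidean ball and
    [2 ^ n.-1] from the power mean inequality. *)
Let density_v (W' : set 'rV[R]_n) (e : R) (x : 'rV[R]_n) : 0 < e ->
  (energy_density n%:R e W' v x <= C2%:E * ((e ^+ (2 * n))^-1%:E * dens delta e x +
     (2 ^+ n / r ^+ n)%:E * pmpow delta z0 x))%E.
Proof.
move=> e0; have n0 : 0 < n%:R :> R by rewrite ltr0n.
have D0 : (0 <= dens delta e x)%E by exact: (dens_ge0 delta_pm).
have P0 : (0 <= pmpow delta z0 x)%E by exact: (pmpow_ge0 delta_pm).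
have [ix|/negP ix] := boolP (x \in inner_part W' e); last first.
  rewrite /energy_density ifN; last exact/negP.
  apply: mule_ge0 => //; apply: adde_ge0; apply: mule_ge0 => //.
    by rewrite lee_fin invr_ge0 exprn_ge0// ltW.
  by rewrite lee_fin divr_ge0 ?exprn_ge0// ltW.
rewrite (energy_densityE competitor_measurable (N := set0))//; last exact: set_mem.
have [fm ml mh] := lebesgue_rV_eball n_gt0 x e0.
have m0 : 0 < fine (mu (eball x e)).
  by apply: lt_le_trans ml; rewrite exprn_gt0 ?divr_gt0.
have en : 0 < e ^+ n by rewrite exprn_gt0.
apply: (@le_trans _ _ ((((e / n%:R) ^+ n)^-1 / e ^+ n)%:E * dens delta_v e x)%E).
  apply: lee_pmul => //.
  - by rewrite lee_fin divr_ge0// ?invr_ge0 ltW.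
  - by apply: integral_ge0 => y _; exact: (pmpow_ge0 v_pm).
  - rewrite lee_fin ler_pM2r ?invr_gt0// lef_pV2// posrE exprn_gt0//.
    by rewrite divr_gt0.
  - apply: ge0_subset_integral => //.
    + exact: measurable_eball.
    + exact: measurable_cube.
    + exact: measurable_pmpow.
    + by move=> y _; exact: (pmpow_ge0 v_pm).
    + exact: eball_cube.
apply: (@le_trans _ _ ((((e / n%:R) ^+ n)^-1 / e ^+ n)%:E * ((2 ^+ n.-1)%:E *
  (dens delta e x + ((2 * e) ^+ n * (e / r) ^+ n)%:E * pmpow delta z0 x)))%E).
  apply: lee_wpmul2l; last exact: dens_v.
  by rewrite lee_fin divr_ge0 ?invr_ge0 ?exprn_ge0 ?divr_ge0// ltW.
rewrite le_eqVlt; apply/orP; left; apply/eqP.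
have e2 : (e ^+ (2 * n))^-1 = (e ^+ n)^-1 * (e ^+ n)^-1.
  by rewrite mulnC exprM expr2 invfM.
rewrite muleA -EFinM.
have -> : ((e / n%:R) ^+ n)^-1 / e ^+ n * 2 ^+ n.-1 = C2 * (e ^+ (2 * n))^-1.
  rewrite e2 expr_div_n /C2 invf_div; ring.
rewrite EFinM -muleA; congr (_ * _)%E.
rewrite ge0_muleDr//; last first.
  by rewrite mule_ge0// lee_fin mulr_ge0// exprn_ge0 ?divr_ge0 ?mulr_ge0// ltW.
congr (_ + _)%E; rewrite muleA; congr (_ * _)%E; rewrite -EFinM; congr EFin.
rewrite e2 exprMn expr_div_n; field; rewrite !gt_eqF//; exact: exprn_gt0.
Qed.

Variable c : nat -> R -> R.
Hypothesis c_gt0 : forall m p, 0 < c m p.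

Definition energy_upper_cst : R :=
  n%:R ^+ n * 2 ^+ n.-1 * (@chain_cst R n + 2 ^+ n * @annulus_cst R n).

Lemma energy_upper_cst_gt0 : 0 < energy_upper_cst.
Proof.
apply: mulr_gt0; first by rewrite mulr_gt0 ?exprn_gt0 ?ltr0n.
apply: addr_gt0; first exact: chain_cst_gt0.
by apply: mulr_gt0; [exact: exprn_gt0|exact: annulus_cst_gt0].
Qed.

(** For [e < r / 4] the competitor is constant on the [e]-ball about any point of [cube x0 (3/2 r)],
    so only the annulus contributes. There the first term of [density_v] is bounded by chaining and
    the second by the choice of [z0]. The same restriction on [e] keeps the [2 e]-neighbourhood of
    the annulus inside the big annulus. *)
Lemma energy_upper (l : R) :
  (liminf_energy delta (big_annulus x0 r) <= l%:E)%E ->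
  (\int[mu]_(y in annulus x0 r) pmpow delta z0 y <=
     (@annulus_cst R n * r ^+ n * l)%:E)%E ->
  (energy c n%:R (cube x0 (4 * r)) v <= (c n n%:R * (energy_upper_cst * l))%:E)%E.
Proof.
move=> Ll Zl; apply: ge_ereal_sup => _ [f [_ f01] <-].
have r4 : 0 < r / 4 by rewrite divr_gt0.
apply: (limf_esup_right_le r4) => e /andP[e0 er].
rewrite /approx_energy [leRHS]EFinM; apply: lee_wpmul2l; first by rewrite lee_fin ltW.
have mQ : measurable (cube x0 (4 * r) : set T) by exact: measurable_cube.
have mA : measurable (annulus x0 r : set T) by exact: measurable_annulus.
have AQ : annulus x0 r `<=` cube x0 (4 * r) by move=> x [].
have mP : measurable_fun (annulus x0 r) (pmpow delta z0) by exact: measurable_pmpow.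
have mD : measurable_fun (annulus x0 r) (dens delta e) by exact: measurable_dens.
have D0 x : (0 <= dens delta e x)%E by exact: (dens_ge0 delta_pm).
have P0 x : (0 <= pmpow delta z0 x)%E by exact: (pmpow_ge0 delta_pm).
have ei : 0 <= (e ^+ (2 * n))^-1 by rewrite invr_ge0 exprn_ge0// ltW.
have ri : 0 <= 2 ^+ n / r ^+ n by rewrite divr_ge0 ?exprn_ge0// ltW.
pose g1 x := ((e ^+ (2 * n))^-1%:E * dens delta e x)%E.
pose g2 x := ((2 ^+ n / r ^+ n)%:E * pmpow delta z0 x)%E.
have g10 x : (0 <= g1 x)%E by rewrite mule_ge0.
have g20 x : (0 <= g2 x)%E by rewrite mule_ge0.
have mg1 : measurable_fun (annulus x0 r) g1 by exact: measurable_funeM.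
have mg2 : measurable_fun (annulus x0 r) g2 by exact: measurable_funeM.
apply: (@le_trans _ _ (\int[mu]_(x in annulus x0 r) (C2%:E * (g1 x + g2 x)))%E).
  rewrite integral_mkcond [leRHS]integral_mkcond.
  have B0 x : (0 <= C2%:E * (g1 x + g2 x))%E by rewrite mule_ge0 ?adde_ge0.
  apply: ge0_le_integral_pointwise => // x _; rewrite !patchE.
    case: ifP => // _; apply: mule_ge0; last exact: energy_density_ge0.
    by rewrite lee_fin; have /andP[] := f01 x.
  case: ifPn => [/set_mem xQ|_]; last by case: ifP.
  have /andP[f0 f1] := f01 x.
  have [xA|/negP xA] := boolP (x \in annulus x0 r).
    rewrite -[leRHS]mul1e; apply: lee_pmul => //.
    - exact: energy_density_ge0.
    - exact: density_v.
  have x32 : cube x0 (3 / 2 * r) x.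
    by apply: contrapT => h; apply: xA; apply: mem_set.
  rewrite (_ : energy_density _ _ _ _ _ = 0)%E ?mule0//.
  rewrite /energy_density; case: ifP => // _; rewrite integral0_eq ?mule0// => y xy.
  have h1 : cube x0 (2 * r) x by apply: le_cube x32; move: r_gt0; lra.
  have h2 : cube x0 (2 * r) y.
    have := cube_triangle x32 (eball_cube xy); apply: le_cube.
    by move: r_gt0 er; lra.
  by rewrite !competitor_in// mdistxx powR0 ?mul0r// pnatr_eq0 -lt0n.
rewrite (ge0_integralZD _ mA C20 mg1 mg2)//.
have -> : energy_upper_cst * l =
    C2 * (@chain_cst R n * l + 2 ^+ n * @annulus_cst R n * l).
  by rewrite -mulrDl mulrA.
rewrite [leRHS]EFinM; apply: lee_wpmul2l => //.
rewrite [leRHS]EFinD; apply: leeD.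
  rewrite (ge0_integralZl_EFin _ mA (fun x _ => D0 x))// -/(energy_at delta e _).
  have mB : measurable (big_annulus x0 r : set T) by exact: measurable_big_annulus.
  rewrite lee_pdivrMl ?exprn_gt0//.
  apply: le_trans (energy_at_le_liminf n_gt0 delta_pm e0 mA mB _) _.
    move=> x [x4 x32] y xy; split.
      by apply: le_cube (cube_triangle x4 xy); move: r_gt0 er; lra.
    move=> yr; apply: x32; have := cube_triangle yr (cube_sym xy); apply: le_cube.
    by move: r_gt0 er; lra.
  rewrite [_ * _ ^+ _]mulrC !EFinM -muleA; apply: lee_wpmul2l.
    by rewrite lee_fin exprn_ge0// ltW.
  by apply: lee_wpmul2l => //; rewrite lee_fin ltW// chain_cst_gt0.
rewrite (ge0_integralZl_EFin _ mA (fun x _ => P0 x))//.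
apply: le_trans (lee_wpmul2l _ Zl) _; first by rewrite lee_fin.
rewrite -EFinM lee_fin le_eqVlt; apply/orP; left; apply/eqP.
by field; rewrite gt_eqF// exprn_gt0.
Qed.

End competitor.

(** * The competitor is a Sobolev map on the whole domain *)

Section competitor_sobolev.
Context {R : realType} {n : nat} {X : metricType R}.
Local Notation T := (lebesgue_rVType R n).
Local Notation mu := (@lebesgue_rV R n).
Hypothesis n_ge2 : (2 <= n)%N.
Let n_gt0 : (0 < n)%N. Proof. exact: ltn_trans n_ge2. Qed.
Variables (W : set 'rV[R]_n) (u0 : 'rV[R]_n -> X) (N : set T).
Variables (u : T -> X) (z0 : T) (m : R -> X -> X) (x0 : 'rV[R]_n) (r : R).
Hypotheses (u_mm : measurable_map u) (r_gt0 : 0 < r).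
Hypothesis m_contr : geodesic_contraction (u z0) m.
Hypotheses (oW : open W) (mN : measurable N) (N0 : mu N = 0%E).
Hypothesis uE : forall x, W x -> ~ N x -> u x = u0 x.
Variable c : nat -> R -> R.
Hypothesis c_gt0 : forall m p, 0 < c m p.
Hypothesis u0_sobolev : sobolev c n%:R W u0.
Local Notation delta := (fun x y => mdist (u x) (u y)).
Local Notation v := (competitor u m x0 r).
Local Notation s := (ramp x0 r).
Local Notation delta_v := (fun x y => mdist (v x) (v y)).
Let delta_pm := measurable_map_pseudometric u_mm.
Let v_mm := competitor_measurable x0 r u_mm m_contr.
Let v_pm := measurable_map_pseudometric v_mm.
Let mW : measurable (W : set T). Proof. exact: open_measurable_rV. Qed.
Let mQ : measurable (cube x0 (4 * r) : set T). Proof. exact: measurable_cube. Qed.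
Let k : R := 2 ^+ n.-1.
Let k_gt0 : 0 < k. Proof. by rewrite exprn_gt0. Qed.

Let ind (x : T) : R := \1_(cube x0 (4 * r) : set T) x.

Let measurable_ind : measurable_fun setT ind.
Proof. exact: measurable_indic. Qed.

Let integral_ind (b : R) : 0 <= b -> (\int[mu]_(x in W) (b * ind x)%:E < +oo)%E.
Proof.
move=> b0; have mEi : measurable_fun (W : set T) (EFin \o ind).
  by apply/measurable_EFinP; exact: measurable_funTS.
under eq_integral do rewrite EFinM.
have i0 x : W x -> (0 <= (EFin \o ind) x)%E by rewrite lee_fin.
rewrite (ge0_integralZl_EFin _ mW i0 mEi b0).
rewrite integral_indic//; apply: lte_mul_pinfty => //.
apply: le_lt_trans (_ : _ <= mu (cube x0 (4 * r)))%E _.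
  by apply: le_measure; rewrite ?inE//; exact: measurableI.
apply: le_lt_trans (lebesgue_rV_cube_le _ _) (ltry _).
by rewrite mulr_ge0// ltW.
Qed.

Let dist_pow_bound (a p q : X) :
  mdist p q ^+ n <= k * (mdist p a ^+ n + mdist a q ^+ n).
Proof.
have := power_mean2 n.-1 (mdist_ge0 p a) (mdist_ge0 a q); rewrite prednK//.
apply: le_trans; apply: lerXn2r (metric_triangle _ a _); rewrite nnegrE ?mdist_ge0//.
by rewrite addr_ge0 ?mdist_ge0.
Qed.

(* [w] agrees with a multiple of [d(u0, a)^n] up to an error supported in a cube. *)
Let finite_integral (a : X) (w : T -> R) (b : R) :
  lebesgue_rV.-integrable (W : set T) (fun x => (mdist (u0 x) a `^ n%:R)%:E) ->
  0 <= b -> (forall x, 0 <= w x) ->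
  (forall x, W x -> w x <= k * mdist (u x) a ^+ n + b * ind x) ->
  (\int[mu]_(x in W) (w x)%:E < +oo)%E.
Proof.
move=> /integrableP[_ Iu] b0 w0 wb.
apply: le_lt_trans (@ge0_integral_affine_bound _ _ _ mu W N k _
  (fun x => `|(mdist (u0 x) a `^ n%:R)%:E|)%E (fun x => b * ind x)
  mW mN N0 k_gt0 _ _ _ _ _) _.
- by apply: measurable_funM => //; exact: measurable_cst.
- by move=> x; rewrite mulr_ge0.
- by move=> x _; rewrite lee_fin.
- by move=> x _; exact: abse_ge0.
- move=> x Wx Nx; rewrite gee0_abs ?lee_fin ?powR_ge0//.
  by rewrite -uE// powR_mulrn ?mdist_ge0//; exact: wb.
- apply: lte_add_pinfty; last exact: integral_ind.
  by apply: lte_mul_pinfty => //; rewrite lee_fin ltW.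
Qed.

Let dist_v (a : X) x : mdist (v x) a <= mdist (u x) a + 2 * mdist (u z0) a.
Proof.
have [_ _ h _] := m_contr.
have [s0 s1] := andP (ramp_itv x0 r x).
apply: le_trans (metric_triangle _ (u z0) _) _.
have h1 : mdist (v x) (u z0) <= mdist (u z0) (u x).
  rewrite metric_sym; apply: le_trans (h _ _ (ramp_itv x0 r x)) _.
  by rewrite ler_piMl ?mdist_ge0.
have := metric_triangle (u z0) a (u x); rewrite (metric_sym a (u x)) => h2.
by lra.
Qed.

Lemma competitor_Lp : Lp_map n%:R W v.
Proof.
have [[_ _ [a Ia]] _] := u0_sobolev.
have [v1 v2] := measurable_map_Lp_map mW v_mm.
split => //; exists a; apply/integrableP; split.
  apply/measurable_EFinP; apply: measurable_funTS.
  rewrite (_ : (fun _ => _) = (fun x : T => mdist (v x) a ^+ n)); last first.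
    by apply/funext => x; rewrite powR_mulrn ?mdist_ge0.
  by apply: measurable_funX; exact: measurable_mdist1.
under eq_integral do rewrite gee0_abs ?lee_fin ?powR_ge0//.
pose b : R := k * (2 * mdist (u z0) a) ^+ n.
have b0 : 0 <= b by rewrite mulr_ge0 ?(ltW k_gt0)// exprn_ge0// mulr_ge0 ?mdist_ge0.
apply: (finite_integral Ia b0); first by move=> x; exact: powR_ge0.
move=> x Wx; rewrite powR_mulrn ?mdist_ge0// /ind indicE.
have [xQ|/negP xQ] := boolP (x \in _).
  rewrite mulr1 /b -mulrDr.
  have p0 : 0 <= 2 * mdist (u z0) a by rewrite mulr_ge0 ?mdist_ge0.
  have := power_mean2 n.-1 (mdist_ge0 (u x) a) p0; rewrite prednK//.
  apply: le_trans; apply: lerXn2r (dist_v a x); rewrite nnegrE ?mdist_ge0//.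
  by rewrite addr_ge0 ?mdist_ge0.
have x3 : ~ cube x0 (3 * r) x.
  move=> x3; apply: xQ; apply: mem_set; apply: le_cube x3.
  by move: r_gt0; lra.
rewrite mulr0 addr0 (competitor_out r_gt0 m_contr x3).
rewrite -[leLHS]mul1r ler_wpM2r ?exprn_ge0 ?mdist_ge0//.
by rewrite /k exprn_ege1// ler1n.
Qed.

(** The energy density added by the ramp, independent of the scale; it is integrable because [u] is
    in L^n and the cube is bounded. *)
Let err (x : T) : R := k * ((r ^+ n)^-1 * mdist (u z0) (u x) ^+ n * ind x).

Let err_ge0 x : 0 <= err x.
Proof.
by rewrite mulr_ge0 ?(ltW k_gt0)// mulr_ge0// mulr_ge0 ?invr_ge0 ?exprn_ge0 ?mdist_ge0// ltW.
Qed.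

Let measurable_err : measurable_fun setT err.
Proof.
apply: measurable_funM; first exact: measurable_cst.
apply: measurable_funM; last exact: measurable_ind.
apply: measurable_funM; first exact: measurable_cst.
apply: measurable_funX; under eq_fun do rewrite metric_sym.
exact: measurable_mdist1.
Qed.

Let density_bound (e tau : R) (x : 'rV[R]_n) : 0 < e -> e < tau -> e < r ->
  cube x tau `<=` W -> ~ N x ->
  (energy_density n%:R e W v x <=
     k%:E * energy_density n%:R e W u0 x + (err x)%:E)%E.
Proof.
move=> e0 et er xW Nx; have t0 := lt_trans e0 et.
have ix : inner_part W e x by exact: inner_part_cube et.
have Wx : W x by apply: xW; exact: cube_center.
have exW : eball x e `<=` W.
  by move=> y /eball_cube /(le_cube (ltW et)); exact: xW.
have mB : measurable (eball x e : set T) by exact: measurable_eball.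
rewrite (energy_densityE v_mm (N := set0))//.
rewrite (energy_densityE u_mm mN N0 e0 ix)//; [|exact: uE|by move=> y xy Ny; apply: uE => //; exact: exW].
have [fm ml mh] := lebesgue_rV_eball n_gt0 x e0.
have m0 : 0 < fine (mu (eball x e)).
  by apply: lt_le_trans ml; rewrite exprn_gt0 ?divr_gt0// ltr0n.
set q := (fine _)^-1 / e ^+ n.
have q0 : 0 <= q by rewrite divr_ge0 ?invr_ge0 ?exprn_ge0// ltW.
pose E : R := (e / r) ^+ n * ind x.
have E0 : 0 <= E by rewrite mulr_ge0// exprn_ge0// divr_ge0// ltW.
have P0 x' y' : (0 <= pmpow delta x' y')%E by exact: (pmpow_ge0 delta_pm).
have EP0 : (0 <= E%:E * pmpow delta z0 x)%E by rewrite mule_ge0.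
have mK : measurable_fun (eball x e : set T) (pmpow delta x).
  exact: measurable_pmpow.
apply: (@le_trans _ _ (q%:E * \int[mu]_(y in (eball x e : set T))
    (k%:E * (pmpow delta x y + E%:E * pmpow delta z0 x)))%E).
  apply: lee_wpmul2l => //; apply: ge0_le_integral_pointwise => // y xy.
    exact: (pmpow_ge0 v_pm).
  apply: le_trans (competitor_pmpow n_ge2 x0 r m_contr x y) _.
  apply: lee_wpmul2l; first by rewrite lee_fin ltW.
  apply: leeD2l; apply: lee_wpmul2r => //; rewrite lee_fin /E /ind indicE.
  have [xQ|/negP xQ] := boolP (x \in _).
    rewrite mulr1; apply: lerXn2r (ramp_near x0 r_gt0 e0 (eball_cube xy)) => //.
    by rewrite nnegrE divr_ge0// ltW.
  (* For [x] outside radius [4 r], [e < r] keeps [y] outside radius [3 r]: both ramp values are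
     1. *)
  rewrite mulr0 !ramp_out ?subrr ?normr0 ?expr0n -?lt0n//.
  - by rewrite (gtn_eqF n_gt0).
  - move=> y3; apply: xQ; apply: mem_set.
    have := cube_triangle y3 (cube_sym (eball_cube xy)); apply: le_cube.
    by move: r_gt0 er; lra.
  - move=> x3; apply: xQ; apply: mem_set; apply: le_cube x3.
    by move: r_gt0; lra.
have -> := @ge0_integralZD _ _ _ mu (eball x e) _ (pmpow delta x)
  (fun=> E%:E * pmpow delta z0 x)%E mB (ltW k_gt0) mK (measurable_cst _)
  (P0 x) (fun=> EP0).
rewrite (integral_cst mu mB) muleCA; set J := (\int[mu]_(_ in _) _)%E.
have J0 : (0 <= J)%E by apply: integral_ge0 => y _.
rewrite ge0_muleDr//; last by rewrite mule_ge0.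
rewrite ge0_muleDr; [|by rewrite mule_ge0|by rewrite !mule_ge0].
apply: leeD2l.
apply: (@le_trans _ _ (k%:E * (q%:E * (E%:E * pmpow delta z0 x *
    (fine (mu (eball x e)))%:E)))%E).
  apply: lee_wpmul2l; first by rewrite lee_fin ltW.
  apply: lee_wpmul2l; first by rewrite lee_fin.
  apply: lee_wpmul2l => //; rewrite le_eqVlt; apply/orP; left; apply/eqP.
  exact: esym (fineK fm).
rewrite /pmpow -!EFinM lee_fin /q /err /E le_eqVlt; apply/orP; left; apply/eqP.
rewrite expr_div_n; field.
by rewrite !gt_eqF// exprn_gt0.
Qed.

Let integral_density_ge0 (f : 'rV[R]_n -> R) (e : R) (w : 'rV[R]_n -> X) :
  (forall x, 0 <= f x) ->
  (0 <= \int[mu]_(x in W) ((f x)%:E * energy_density n%:R e W w x))%E.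
Proof.
move=> f0; apply: integral_ge0 => x _.
by apply: mule_ge0; [rewrite lee_fin|exact: energy_density_ge0].
Qed.

(** The support of a test function has a positive margin [tau] in [W], so at scales below [tau] the
    density of [v] is bounded on it by that of [u0] plus [err]. The resulting bound is uniform in
    the test function. *)
Lemma competitor_energy_finite : (energy c n%:R W v < +oo)%E.
Proof.
have [[_ _ [a Ia]] u0fin] := u0_sobolev.
have Ierr : (\int[mu]_(x in W) (err x)%:E < +oo)%E.
  pose w x := mdist (u z0) (u x) ^+ n * ind x.
  pose b := k * mdist (u z0) a ^+ n.
  have w0 x : 0 <= w x by rewrite mulr_ge0// exprn_ge0// mdist_ge0.
  have b0 : 0 <= b by rewrite mulr_ge0 ?(ltW k_gt0)// exprn_ge0// mdist_ge0.
  have Iw : (\int[mu]_(x in W) (w x)%:E < +oo)%E.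
    apply: (finite_integral Ia b0 w0) => x _; rewrite /w /b /ind indicE.
    case: (x \in _); last first.
      by rewrite !mulr0 addr0 mulr_ge0 ?(ltW k_gt0)// exprn_ge0// mdist_ge0.
    rewrite !mulr1 -mulrDr addrC (metric_sym (u x) a); exact: dist_pow_bound.
  have mEw : measurable_fun (W : set T) (EFin \o w).
    apply/measurable_EFinP; apply: measurable_funTS.
    apply: measurable_funM; last exact: measurable_ind.
    apply: measurable_funX; under eq_fun do rewrite metric_sym.
    exact: measurable_mdist1.
  have Ew0 x : W x -> (0 <= (EFin \o w) x)%E by move=> _; rewrite lee_fin.
  have kr0 : 0 <= k / r ^+ n by rewrite divr_ge0 ?(ltW k_gt0)// exprn_ge0// ltW.
  rewrite (_ : (fun x => (err x)%:E) = (fun x => (k / r ^+ n)%:E * (EFin \o w) x)%E).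
    rewrite (ge0_integralZl_EFin _ mW Ew0 mEw kr0).
    by apply: lte_mul_pinfty => //; rewrite lee_fin.
  by apply/funext => x; rewrite /= -EFinM /err /w; congr EFin; ring.
have Ierr0 : (0 <= \int[mu]_(x in W) (err x)%:E)%E.
  by apply: integral_ge0 => x _; rewrite lee_fin.
pose E := fine (energy c n%:R W u0).
have cn : 0 < c n n%:R by [].
apply: (@le_lt_trans _ _ ((k * (E + 1))%:E + (c n n%:R)%:E *
    \int[mu]_(x in W) (err x)%:E)%E); last first.
  by apply: lte_add_pinfty; [exact: ltry|apply: lte_mul_pinfty => //; rewrite lee_fin ltW].
apply: ge_ereal_sup => _ [f [[cf Kf KW] f01] <-].
set K := closure _ in Kf KW.
have [tau t0 tW] := open_cube_uniform oW Kf KW.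
(* The added 1 makes the inequality strict, so that it holds at all small scales. *)
have supE : (limf_esup (fun e => approx_energy c n%:R e W u0 f) 0^'+ < (E + 1)%:E)%E.
  apply: (@le_lt_trans _ _ (energy c n%:R W u0)).
    by apply: ereal_sup_ubound; exists f.
  have E0 : (0 <= energy c n%:R W u0)%E.
    apply: le_trans (_ : limf_esup (fun e => approx_energy c n%:R e W u0 f) 0^'+ <= _)%E.
      apply: (limf_esup_right_ge (M := 0%E)) => d d0; exists (d / 2); first by lra.
      apply: mule_ge0; first by rewrite lee_fin ltW.
      by apply: integral_density_ge0 => x; have /andP[] := f01 x.
    by apply: ereal_sup_ubound; exists f.
  by rewrite -[X in (X < _)%E]fineK ?ge0_fin_numE// lte_fin ltrDl.
have [d d0 dE] := limf_esup_right_lt supE.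
apply: (@limf_esup_right_le _ _ _ (Num.min d (Num.min tau r))).
  by rewrite !lt_min d0 t0.
move=> e /andP[e0]; rewrite !lt_min => /and3P[ed et er].
have ed' : 0 < e < d by rewrite e0.
apply: (@le_trans _ _ (k%:E * approx_energy c n%:R e W u0 f + (c n n%:R)%:E *
    \int[mu]_(x in W) (err x)%:E)%E); last first.
  apply: leeD2r; rewrite EFinM; apply: lee_wpmul2l; first by rewrite lee_fin ltW.
  exact: dE.
rewrite /approx_energy muleCA -ge0_muleDr; last 2 first.
- apply: mule_ge0; first by rewrite lee_fin ltW.
  by apply: integral_density_ge0 => x; have /andP[] := f01 x.
- exact: Ierr0.
apply: lee_wpmul2l; first by rewrite lee_fin ltW.
apply: (@ge0_integral_affine_bound _ _ _ mu W N) => //.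
- move=> x _; rewrite mule_ge0 ?energy_density_ge0// lee_fin.
  by have /andP[] := f01 x.
- move=> x _; rewrite mule_ge0 ?energy_density_ge0// lee_fin.
  by have /andP[] := f01 x.
move=> x Wx Nx; have /andP[f0 f1] := f01 x.
have [->|fx] := eqVneq (f x) 0.
  rewrite (mul0e (energy_density n%:R e W v x)) (mul0e (energy_density n%:R e W u0 x)).
  by rewrite mule0 add0e lee_fin.
have xK : K x by apply: subset_closure.
have D0 : (0 <= energy_density n%:R e W u0 x)%E by exact: energy_density_ge0.
apply: (@le_trans _ _ ((f x)%:E * (k%:E * energy_density n%:R e W u0 x + (err x)%:E))%E).
  apply: lee_wpmul2l; first by rewrite lee_fin.
  exact: density_bound (tW _ xK) Nx.
rewrite ge0_muleDr ?mule_ge0 ?lee_fin ?(ltW k_gt0)// muleCA; apply: leeD2l.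
by rewrite -EFinM lee_fin ler_piMl.
Qed.

Lemma competitor_sobolev : sobolev c n%:R W v.
Proof. by split; [exact: competitor_Lp|exact: competitor_energy_finite]. Qed.

End competitor_sobolev.

(** * Caccioppoli inequality and energy decay *)

Section hole_filling.
Context {R : realType} {n : nat} {X : metricType R}.
Local Notation T := (lebesgue_rVType R n).
Local Notation mu := (@lebesgue_rV R n).
Hypothesis n_ge2 : (2 <= n)%N.
Let n_gt0 : (0 < n)%N. Proof. exact: ltn_trans n_ge2. Qed.
Variables (Q : R) (c : nat -> R -> R).
Hypotheses (Q_ge1 : 1 <= Q) (c_gt0 : forall m p, 0 < c m p) (npc : NPC X).

Definition hole_cst : R := Q * (@energy_upper_cst R n) / (@energy_lower_cst R n).
Definition decay_cst : R := hole_cst / (hole_cst + 1).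

Lemma hole_cst_gt0 : 0 < hole_cst.
Proof.
have Q0 : 0 < Q by exact: lt_le_trans Q_ge1.
apply: divr_gt0; last exact: energy_lower_cst_gt0.
by apply: mulr_gt0 => //; exact: energy_upper_cst_gt0.
Qed.

Lemma decay_cst_itv : 0 < decay_cst < 1.
Proof.
have h := hole_cst_gt0; have h1 : 0 < hole_cst + 1 by rewrite addr_gt0.
by rewrite divr_gt0//= ltr_pdivrMr// mul1r ltrDl.
Qed.

Variables (W : set 'rV[R]_n) (u0 : 'rV[R]_n -> X) (u : T -> X) (N : set T).
Hypotheses (oW : open W) (u_mm : measurable_map u).
Hypotheses (mN : measurable N) (N0 : mu N = 0%E).
Hypothesis uE : forall x, W x -> ~ N x -> u x = u0 x.
Hypothesis u0_qh : quasi_n_harmonic c Q W u0.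
Local Notation delta := (fun x y => mdist (u x) (u y)).
Local Notation L := (liminf_energy delta).
Let delta_pm := measurable_map_pseudometric u_mm.

(** Finiteness is what allows the energy of the small cube to be moved to the other side in hole
    filling. *)
Lemma liminf_energy_fin (x0 : 'rV[R]_n) (rho : R) : 0 < rho ->
  cube x0 (4 * rho) `<=` W -> L (cube x0 rho) \is a fin_num.
Proof.
move=> rho0 xW; rewrite ge0_fin_numE ?liminf_energy_ge0//.
have := energy_lower n_gt0 oW u_mm mN N0 c_gt0 uE rho0 xW.
have C0 : 0 < c n n%:R * (@energy_lower_cst R n).
  by rewrite mulr_gt0// energy_lower_cst_gt0.
rewrite -lee_pdivlMl// => /le_lt_trans; apply; apply: lte_mul_pinfty => //.
  by rewrite lee_fin invr_ge0 ltW.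
by case: u0_qh => [[]].
Qed.

(** Stated with a positive upper bound [l] because [annulus_poincare] needs one even when the energy
    of the annulus vanishes. *)
Lemma caccioppoli (x0 : 'rV[R]_n) (r l : R) : 0 < r -> 0 < l ->
  cube x0 (8 * r) `<=` W -> (L (big_annulus x0 r) <= l%:E)%E ->
  (L (cube x0 r) <= (hole_cst * l)%:E)%E.
Proof.
move=> r0 l0 xW Ll.
have [z0 z0A Hz] := annulus_poincare n_ge2 delta_pm r0 l0 Ll.
have [m m_contr] := NPC_contraction (u z0) npc.
have [u0_sob quasi] := u0_qh.
have r4 : 0 < 4 * r by rewrite mulr_gt0.
pose W' := cube x0 (4 * r).
have W'W : W' `<=` W by apply: subset_trans xW; apply: le_cube; lra.
have clW : closure W' `<=` closed_cube x0 (4 * r).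
  exact: closure_sub_closed_cube (@cube_closed_cube _ _ _ _).
have cW : closure W' `<=` W.
  apply: subset_trans clW (subset_trans (closed_cube_cube _) xW); lra.
have ccW : compact (closure W').
  exact: compact_closure_sub (@cube_closed_cube _ _ x0 (4 * r)).
have v_sob := competitor_sobolev n_ge2 x0 u_mm r0 m_contr oW mN N0 uE c_gt0 u0_sob.
have ae : {ae mu, forall x, (W `\` W') x -> u0 x = competitor u m x0 r x}.
  exists N; split => // x /= H; apply: contrapT => Nx; apply: H => -[Wx W'x].
  rewrite (competitor_out r0 m_contr) ?uE// => x3; apply: W'x.
  by apply: le_cube x3; lra.
have := quasi W' _ (domain_cube x0 r4) ccW cW v_sob ae.
have hu := energy_upper n_ge2 u_mm r0 m_contr c_gt0 Ll Hz.
have uE' x : W' x -> ~ N x -> u x = u0 x by move=> /W'W; exact: uE.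
(* Quasi-minimality compares energies on [W'] only, so the lower bound is taken with [W'] as the
   ambient domain; the radius [4 r] leaves exactly the room it requires. *)
have hl := energy_lower n_gt0 (@open_cube _ _ x0 (4 * r)) u_mm mN N0 c_gt0 uE' r0
  (@subset_refl _ _).
move=> /(le_trans hl).
have Q0 : 0 < Q by exact: lt_le_trans Q_ge1.
have C0 : 0 < c n n%:R * (@energy_lower_cst R n).
  by rewrite mulr_gt0// energy_lower_cst_gt0.
rewrite -lee_pdivlMl// => /le_trans; apply.
apply: le_trans (lee_wpmul2l _ (lee_wpmul2l _ hu)) _.
- by rewrite lee_fin invr_ge0 ltW.
- by rewrite lee_fin ltW.
rewrite -!EFinM lee_fin /hole_cst le_eqVlt; apply/orP; left; apply/eqP.
by field; rewrite !gt_eqF// energy_lower_cst_gt0.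
Qed.

Lemma hole_filling (x0 : 'rV[R]_n) (r : R) : 0 < r -> cube x0 (32 * r) `<=` W ->
  (L (cube x0 r) <= decay_cst%:E * L (cube x0 (8 * r)))%E.
Proof.
move=> r0 xW.
have sub (s : R) : s <= 32 * r -> cube x0 s `<=` W.
  by move=> sr; apply: subset_trans (le_cube sr) xW.
have fA : L (cube x0 (8 * r)) \is a fin_num.
  apply: liminf_energy_fin; first by rewrite mulr_gt0.
  by apply: sub; lra.
have fa : L (cube x0 r) \is a fin_num.
  by apply: liminf_energy_fin => //; apply: sub; lra.
have mB := measurable_big_annulus x0 r.
have LD : (L (cube x0 r) + L (big_annulus x0 r) <= L (cube x0 (8 * r)))%E.
  apply: liminf_energyD => //.
  - exact: measurable_cube.
  - exact: measurable_cube.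
  - by apply/seteqP; split => // x [xr [_]].
  - by apply: le_cube; lra.
  - by move=> x [].
have fb : L (big_annulus x0 r) \is a fin_num.
  rewrite ge0_fin_numE ?liminf_energy_ge0//.
  apply: le_lt_trans (_ : _ <= L (cube x0 (8 * r)))%E _; last by rewrite ltey_eq fA.
  by apply: le_trans LD; rewrite leeDr// liminf_energy_ge0.
have b0 : (0 <= L (big_annulus x0 r))%E by exact: liminf_energy_ge0.
have K0 := hole_cst_gt0.
have cac (l : R) : 0 < l -> (L (big_annulus x0 r) <= l%:E)%E ->
    (L (cube x0 r) <= (hole_cst * l)%:E)%E.
  by move=> l0; apply: caccioppoli => //; apply: sub; lra.
have [a Ea] : exists a, L (cube x0 r) = a%:E by eexists; exact: esym (fineK fa).
have [b Eb] : exists b, L (big_annulus x0 r) = b%:E.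
  by eexists; exact: esym (fineK fb).
have [A EA] : exists A, L (cube x0 (8 * r)) = A%:E by eexists; exact: esym (fineK fA).
move: LD b0 cac; rewrite Ea Eb EA -EFinD -EFinM !lee_fin => LD b0 cac.
(* Let the bound [l] decrease to the energy [b] of the annulus, which may be zero. *)
have aK : a <= hole_cst * b.
  apply/ler_addgt0Pr => t t0.
  have tK : 0 < t / hole_cst by rewrite divr_gt0.
  have := cac _ (ltr_wpDl b0 tK).
  rewrite !lee_fin mulrDr [hole_cst * (t / _)]mulrC divfK ?gt_eqF//; apply.
  by rewrite lerDl ltW.
have h1 : 0 < hole_cst + 1 by rewrite addr_gt0.
by rewrite /decay_cst mulrAC ler_pdivlMr//; nra.
Qed.

Lemma energy_decay (x0 : 'rV[R]_n) (rho : R) (k : nat) : 0 < rho ->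
  cube x0 (4 * rho) `<=` W ->
  (L (cube x0 (rho / 8 ^+ k)) <= (decay_cst ^+ k)%:E * L (cube x0 rho))%E.
Proof.
move=> rho0 xW; have /andP[d0 _] := decay_cst_itv.
elim: k => [|k IH]; first by rewrite !expr0 divr1 mul1e.
have e8 : rho / 8 ^+ k = 8 * (rho / 8 ^+ k.+1).
  by rewrite exprS; field; rewrite expf_neq0// pnatr_eq0.
have q0 : 0 < rho / 8 ^+ k.+1 by rewrite divr_gt0 ?exprn_gt0.
apply: le_trans (hole_filling q0 _) _.
  apply: subset_trans (le_cube _) xW.
  rewrite (_ : 32 = 4 * 8); last by ring.
  rewrite -mulrA -e8 ler_pM2l// ler_pdivrMr ?exprn_gt0// ler_peMr ?(ltW rho0)//.
  by rewrite exprn_ege1// ler1n.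
have -> : ((decay_cst ^+ k.+1)%:E * L (cube x0 rho) =
    decay_cst%:E * ((decay_cst ^+ k)%:E * L (cube x0 rho)))%E.
  by rewrite [RHS]muleA -EFinM -exprS.
by rewrite -e8; apply: lee_wpmul2l => //; rewrite lee_fin ltW.
Qed.

End hole_filling.

(** * Hoelder continuity from energy decay *)

Section mean_distance.
Context {R : realType} {n : nat}.
Local Notation T := (lebesgue_rVType R n).
Local Notation mu := (@lebesgue_rV R n).
Variable delta : T -> T -> R.
Hypotheses (n_gt0 : (0 < n)%N) (delta_pm : measurable_pseudometric delta).
Local Notation L := (liminf_energy delta).

(** Replaces Hoelder's inequality in passing from n-th powers to first powers: with [s] of the
    expected size of [a], both terms have that size. *)
Lemma young_split (a s : R) : 0 <= a -> 0 < s -> a <= s + s^-1 ^+ n.-1 * a ^+ n.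
Proof.
move=> a0 s0; have p0 : 0 <= s^-1 ^+ n.-1 * a ^+ n.
  by rewrite mulr_ge0 ?exprn_ge0// invr_ge0 ltW.
have [as_|sa] := leP a s; first by rewrite (le_trans as_)// lerDl.
apply: ler_wpDl; first exact: ltW.
rewrite -(prednK n_gt0) exprSr mulrA -exprMn ler_peMl//= exprn_ege1//.
by rewrite mulrC ler_pdivlMr// mul1r ltW.
Qed.

Local Open Scope ereal_scope.

(** First powers, since the triangle inequality then has constant 1; with n-th powers a factor
    [2 ^ n.-1] would accumulate at each step of the telescoping. *)
Definition meanint (B : set T) (x : T) : \bar R :=
  \int[mu]_(y in B) (delta x y)%:E.

Let measurable_delta2 :
  measurable_fun setT (fun p : T * T => (delta p.1 p.2)%:E).
Proof. by apply/measurable_EFinP; exact: (pm_measurable delta_pm). Qed.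

Let measurable_delta x (B : set T) : measurable_fun B (fun y => (delta x y)%:E).
Proof.
by apply: measurable_funTS; exact: (measurable_fun_pair2 x measurable_delta2).
Qed.

Let delta_ge0 x y : 0 <= (delta x y)%:E.
Proof. by rewrite lee_fin (pm_ge0 delta_pm). Qed.

Lemma meanint_ge0 B x : 0 <= meanint B x.
Proof. by apply: integral_ge0 => y _; exact: delta_ge0. Qed.

Lemma le_meanint (B B' : set T) x : measurable B -> measurable B' ->
  B `<=` B' -> meanint B x <= meanint B' x.
Proof.
move=> mB mB' BB'; apply: ge0_subset_integral => //; exact: measurable_delta.
Qed.

Lemma measurable_meanint (B A : set T) : measurable B ->
  measurable_fun A (meanint B).
Proof.
move=> mB; apply: measurable_funTS.
apply: (@measurable_fun_section_integral _ _ T T R mu (fun=> B)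
  (fun x y => (delta x y)%:E)) => //.
rewrite (_ : [set _ | _] = [set: T] `*` B); first exact: measurableX.
by apply/seteqP; split => [[? ?]|[? ?] []].
Qed.

Lemma meanint_young (B : set T) (x : T) (s : R) : measurable B -> (0 < s)%R ->
  meanint B x <= s%:E * mu B + (s^-1 ^+ n.-1)%:E * \int[mu]_(y in B) pmpow delta x y.
Proof.
move=> mB s0.
have si0 : (0 <= s^-1 ^+ n.-1)%R by rewrite exprn_ge0// invr_ge0 ltW.
have mK : measurable_fun B (pmpow delta x) by exact: measurable_pmpow.
have K0 y : B y -> 0 <= pmpow delta x y by move=> _; exact: pmpow_ge0.
have mc : measurable_fun B (fun=> s%:E) by exact: measurable_cst.
have mZ : measurable_fun B (fun y => (s^-1 ^+ n.-1)%:E * pmpow delta x y).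
  by apply: measurable_funeM.
rewrite -(ge0_integralZl_EFin _ mB K0 mK si0) -(integral_cst mu mB s%:E).
rewrite -(ge0_integralD _ mB _ mc _ mZ); last first.
  - by move=> y By; rewrite mule_ge0 ?K0.
  - by move=> y _; rewrite lee_fin ltW.
apply: ge0_le_integral_pointwise => // y _; rewrite -EFinM -EFinD lee_fin.
exact: young_split (pm_ge0 delta_pm _ _) s0.
Qed.

Lemma meanint2_young (B : set T) (s : R) : measurable B -> (0 < s)%R ->
  \int[mu]_(x in B) meanint B x <=
  s%:E * mu B * mu B +
  (s^-1 ^+ n.-1)%:E * \int[mu]_(x in B) \int[mu]_(y in B) pmpow delta x y.
Proof.
move=> mB s0.
have si0 : (0 <= s^-1 ^+ n.-1)%R by rewrite exprn_ge0// invr_ge0 ltW.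
pose G (x : T) := \int[mu]_(y in B) pmpow delta x y.
have G0 x : B x -> 0 <= G x.
  by move=> _; apply: integral_ge0 => y _; exact: pmpow_ge0.
have mG : measurable_fun B G.
  apply: measurable_funTS.
  apply: (@measurable_fun_section_integral _ _ T T R mu (fun=> B)
    (fun x y => pmpow delta x y)).
  - rewrite (_ : [set _ | _] = [set: T] `*` B); first exact: measurableX.
    by apply/seteqP; split => [[? ?]|[? ?] []].
  - exact: measurable_pmpow2.
  - exact: pmpow_ge0.
have sB0 : 0 <= s%:E * mu B by rewrite mule_ge0// lee_fin ltW.
have mc : measurable_fun B (fun=> s%:E * mu B) by exact: measurable_cst.
have mZ : measurable_fun B (fun x => (s^-1 ^+ n.-1)%:E * G x).
  by apply: measurable_funeM.
rewrite -(ge0_integralZl_EFin _ mB G0 mG si0) -(integral_cst mu mB (s%:E * mu B)).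
rewrite -(ge0_integralD _ mB _ mc _ mZ); last first.
  - by move=> y By; rewrite mule_ge0 ?G0.
  - by move=> y _.
apply: ge0_le_integral_pointwise => // y _; first exact: meanint_ge0.
exact: meanint_young.
Qed.

(** Integrate the triangle inequality from [x] to [z] in [A] through [w] in [B] over both
    variables. *)
Lemma meanint_compare (A B : set T) (x : T) : measurable A -> measurable B ->
  mu B * meanint A x <= mu A * meanint B x + \int[mu]_(w in B) meanint A w.
Proof.
move=> mA mB.
have mdx : measurable_fun B (fun w => mu A * (delta x w)%:E).
  by apply: measurable_funeM; exact: measurable_delta.
have mF : measurable_fun B (meanint A) by exact: measurable_meanint.
rewrite {1}muleC -(integral_cst mu mB (meanint A x)).
have Zl : \int[mu]_(w in B) (mu A * (delta x w)%:E) = mu A * meanint B x.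
  by apply: ge0_integralZl => //; exact: measurable_delta.
rewrite -Zl.
rewrite -(ge0_integralD _ mB _ mdx _ mF); last first.
  - by move=> w _; exact: meanint_ge0.
  - by move=> w _; rewrite mule_ge0.
apply: ge0_le_integral_pointwise => // w _; first exact: meanint_ge0.
rewrite muleC -(integral_cst mu mA (delta x w)%:E).
rewrite -(ge0_integralD _ mA _ (measurable_cst _) _ (@measurable_delta w A))//;
  last by move=> z _; exact: delta_ge0.
apply: ge0_le_integral_pointwise => // z _.
by rewrite -EFinD lee_fin; exact: (pm_triangle delta_pm).
Qed.

Lemma le_meanint_pair (B : set T) (x y : T) : measurable B ->
  mu B * (delta x y)%:E <= meanint B x + meanint B y.
Proof.
move=> mB; rewrite muleC -(integral_cst mu mB (delta x y)%:E).
rewrite -(ge0_integralD _ mB _ (@measurable_delta x B) _ (@measurable_delta y B))//.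
apply: ge0_le_integral_pointwise => // z _; first exact: delta_ge0.
rewrite -EFinD lee_fin [X in (_ <= _ + X)%R](pm_sym delta_pm).
exact: (pm_triangle delta_pm).
Qed.

End mean_distance.

(** * Telescoping averages over shrinking cubes *)

Section averages.
Context {R : realType} {n : nat}.
Local Notation T := (lebesgue_rVType R n).
Local Notation mu := (@lebesgue_rV R n).
Variable delta : T -> T -> R.
Hypotheses (n_gt0 : (0 < n)%N) (delta_pm : measurable_pseudometric delta).
Local Notation L := (liminf_energy delta).
Local Notation dens := (dens delta).
Local Notation meanint := (meanint delta).
Local Notation ccst := (@chain_cst R n).

Lemma cube_measure (x : 'rV[R]_n) (r : R) : 0 < r ->
  exists m : R, [/\ mu (cube x r) = m%:E, r ^+ n <= m, m <= (2 * r) ^+ n & 0 < m].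
Proof.
move=> r0; have h1 := lebesgue_rV_cube_ge x r0.
have h2 := lebesgue_rV_cube_le x (ltW r0).
have fm : mu (cube x r) \is a fin_num.
  rewrite ge0_fin_numE//; exact: le_lt_trans h2 (ltry _).
exists (fine (mu (cube x r))).
rewrite -(fineK fm) !lee_fin in h1 h2.
by split => //; [rewrite fineK|exact: lt_le_trans (exprn_gt0 _ r0) h1].
Qed.

Definition average (r : R) (x : 'rV[R]_n) : \bar R :=
  ((fine (mu (cube x r)))^-1%:E * meanint (cube x r) x)%E.

Definition step_cst (M : R) : R := 16 ^+ n * (1 + ccst * 4 ^+ n * M).

Lemma step_cst_ge0 M : 0 <= M -> 0 <= step_cst M.
Proof.
move=> M0; rewrite mulr_ge0 ?exprn_ge0// addr_ge0// !mulr_ge0 ?exprn_ge0//.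
Qed.

(** By Poincare and [young_split] with this [s], the double integral of [delta] over the cube is of
    order [s r ^ (2 n)], linear in [s]. The factor [16 ^ n] in [step_cst] bounds the ratio of the
    volumes of the two cubes. *)
Lemma average_step (x : 'rV[R]_n) (r s M : R) : 0 < r -> 0 < s -> 0 <= M ->
  (L (cube x (8 * r)) <= (M * s ^+ n)%:E)%E ->
  (average r x <= average (r / 8) x + (step_cst M * s)%:E)%E.
Proof.
move=> r0 s0 M0 LM; have r80 : 0 < r / 8 by rewrite divr_gt0.
have [a [aE a1 a2 a0]] := cube_measure x r0.
have [b [bE b1 b2 b0]] := cube_measure x r80.
rewrite /average aE bE/=.
have mC (z : 'rV[R]_n) t : measurable (cube z t : set T) by exact: measurable_cube.
set K := 1 + ccst * 4 ^+ n * M.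
have K0 : 0 <= K.
  by rewrite addr_ge0// !mulr_ge0 ?exprn_ge0//; exact/ltW/chain_cst_gt0.
have I1 : (\int[mu]_(w in (cube x r : set T)) meanint (cube x r) w <=
    (K * s * a ^+ 2)%:E)%E.
  apply: le_trans (meanint2_young n_gt0 delta_pm (mC _ _) s0) _.
  have r20 : 0 < 2 * r by rewrite mulr_gt0.
  have P := poincare_convex n_gt0 delta_pm (B := cube x r) (V := cube x (8 * r))
    r20 r0 (mC _ _) (mC _ _).
  have {}P : (\int[mu]_(x0 in (cube x r : set T))
      \int[mu]_(y in (cube x r : set T)) pmpow delta x0 y <=
      (ccst * (2 * r) ^+ (2 * n) * (M * s ^+ n))%:E)%E.
    have C0 : 0 <= ccst * (2 * r) ^+ (2 * n).
      by rewrite mulr_ge0 ?exprn_ge0 ?(ltW r20)//; exact/ltW/chain_cst_gt0.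
    apply: (@le_trans _ _ ((ccst * (2 * r) ^+ (2 * n))%:E * L (cube x (8 * r)))%E).
      apply: P.
      - move=> y z Hy Hz i; have := Hy i; have := Hz i.
        by rewrite !ltr_distl => /andP[? ?] /andP[? ?]; rewrite ler_distl; apply/andP; split; lra.
      - by move=> y z t Hy Hz t01; exact: cube_convex.
      - move=> y Hy z Hz; have := cube_triangle Hy Hz; apply: le_cube; lra.
    by rewrite [leRHS]EFinM lee_wpmul2l.
  have si0 : 0 <= s^-1 ^+ n.-1 by rewrite exprn_ge0// invr_ge0 ltW.
  rewrite aE; apply: (@le_trans _ _ ((s * a * a)%:E +
      (s^-1 ^+ n.-1 * (ccst * (2 * r) ^+ (2 * n) * (M * s ^+ n)))%:E)%E).
    by rewrite leeD2l// [leRHS]EFinM lee_wpmul2l.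
  rewrite -EFinD lee_fin.
  have -> : s^-1 ^+ n.-1 * (ccst * (2 * r) ^+ (2 * n) * (M * s ^+ n)) =
      s * (ccst * 4 ^+ n * M * (r ^+ n) ^+ 2).
    have -> : s ^+ n = s * s ^+ n.-1 by rewrite -exprS prednK.
    have -> : (2 * r) ^+ (2 * n) = 4 ^+ n * (r ^+ n) ^+ 2.
      rewrite [r ^+ n ^+ 2]exprAC exprM -exprMn; congr (_ ^+ _).
      by rewrite !expr2; ring.
    rewrite exprVn; field; exact: expf_neq0 (lt0r_neq0 s0).
  rewrite /K [leRHS](_ : _ = s * a * a + s * (ccst * 4 ^+ n * M * a ^+ 2)); last by ring.
  rewrite lerD2l ler_wpM2l ?(ltW s0)// ler_wpM2l//.
    by rewrite !mulr_ge0 ?exprn_ge0//; exact/ltW/chain_cst_gt0.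
  by apply: lerXn2r => //; rewrite nnegrE ?exprn_ge0 ?(ltW r0) ?(ltW a0).
have sub : cube x (r / 8) `<=` cube x r by apply: le_cube; lra.
have H := meanint_compare delta_pm x (mC x r) (mC x (r / 8)).
have I2 : (\int[mu]_(w in (cube x (r / 8) : set T)) meanint (cube x r) w <=
    (K * s * a ^+ 2)%:E)%E.
  apply: le_trans I1; apply: ge0_subset_integral => //.
    exact: measurable_meanint.
  by move=> w _; exact: meanint_ge0.
have {H} := le_trans H (leeD2l _ I2); rewrite aE bE -lee_pdivlMl// => H.
rewrite lee_pdivrMl//; apply: le_trans H _.
have := meanint_ge0 delta_pm (cube x (r / 8)) x.
(* An infinite average over the smaller cube makes the claim trivial. *)
case: (meanint _ x) => [f f0||//]; last first.
  by move=> _; rewrite !gt0_muley ?lte_fin ?invr_gt0// !addye// !gt0_muley ?lte_fin// leey.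
rewrite -!EFinM lee_fin !mulrDr.
rewrite (_ : b^-1 * (a * f) = a * (b^-1 * f)); last by ring.
rewrite lerD2l ler_pdivrMl// /step_cst -/K.
rewrite (_ : b * (a * (16 ^+ n * K * s)) = K * s * a * (16 ^+ n * b)); last by ring.
rewrite expr2 mulrA ler_wpM2l//; first by rewrite !mulr_ge0 ?(ltW s0) ?(ltW a0).
apply: le_trans a2 _; rewrite (_ : 2 * r = 16 * (r / 8)); last by field.
by rewrite exprMn ler_wpM2l// exprn_ge0.
Qed.

Lemma average_le_dens (x : 'rV[R]_n) (r s : R) : 0 < r -> 0 < s ->
  (dens r x <= (s ^+ n * r ^+ n)%:E)%E -> (average r x <= (2 * s)%:E)%E.
Proof.
move=> r0 s0 H; have [a [aE a1 a2 a0]] := cube_measure x r0.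
rewrite /average aE/= lee_pdivrMl// -EFinM.
have si0 : 0 <= s^-1 ^+ n.-1 by rewrite exprn_ge0// invr_ge0 ltW.
apply: le_trans (meanint_young n_gt0 delta_pm x (measurable_cube x r) s0) _.
rewrite aE; apply: (@le_trans _ _ ((s * a)%:E +
    (s^-1 ^+ n.-1 * (s ^+ n * r ^+ n))%:E)%E).
  by rewrite leeD2l// [leRHS]EFinM lee_wpmul2l.
rewrite -EFinD lee_fin.
have -> : s^-1 ^+ n.-1 * (s ^+ n * r ^+ n) = s * r ^+ n.
  have -> : s ^+ n = s * s ^+ n.-1 by rewrite -exprS prednK.
  by rewrite exprVn; field; exact: expf_neq0 (lt0r_neq0 s0).
rewrite [leRHS](_ : _ = s * a + s * a); last by ring.
by rewrite lerD2l ler_wpM2l// ltW.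
Qed.

Lemma le_average_pair (x y : 'rV[R]_n) (r a b : R) : 0 < r -> cube x r y ->
  0 <= b -> (average r x <= a%:E)%E -> (average (8 * r) y <= b%:E)%E ->
  delta x y <= a + 16 ^+ n * b.
Proof.
move=> r0 xy b0 Ha Hb; have r80 : 0 < 8 * r by rewrite mulr_gt0.
have mC (z : 'rV[R]_n) t : measurable (cube z t : set T) by exact: measurable_cube.
have [m [mE m1 m2 m0]] := cube_measure x r0.
have [l [lE l1 l2 l0]] := cube_measure y r80.
rewrite /average mE/= lee_pdivrMl// -EFinM in Ha.
rewrite /average lE/= lee_pdivrMl// -EFinM in Hb.
have sub : cube x r `<=` cube y (8 * r).
  move=> z Hz; have := cube_triangle (cube_sym xy) Hz; apply: le_cube; lra.
have := le_meanint_pair delta_pm x y (mC x r).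
have Hb' := le_trans (le_meanint delta_pm y (mC x r) (mC y (8 * r)) sub) Hb.
move=> /le_trans/(_ (leeD Ha Hb')); rewrite mE -EFinM -EFinD lee_fin => H.
rewrite -(ler_pM2l m0); apply: le_trans H _.
rewrite mulrDr lerD2l mulrA ler_wpM2r// mulrC.
apply: le_trans l2 _; rewrite (_ : 2 * (8 * r) = 16 * r); last by ring.
by rewrite exprMn ler_wpM2l// exprn_ge0.
Qed.

Local Notation sc k := ((8^-1 : R) ^+ k).

(** A Lebesgue point condition along the radii [8 ^ -k]: the mean of [delta x y ^ n] over the cube
    about [x] tends to 0. *)
Definition good_point (x : 'rV[R]_n) := forall tau : R, 0 < tau ->
  exists k0, forall k, (k0 <= k)%N -> (dens (sc k) x <= (tau * sc k ^+ n)%:E)%E.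

Let sc_gt0 k : 0 < sc k. Proof. by rewrite exprn_gt0. Qed.

Section decaying.
Variables (M q : R) (K : nat).
Hypotheses (M_ge0 : 0 <= M) (q_gt0 : 0 < q) (q_lt1 : q < 1).

Definition decaying (x : 'rV[R]_n) :=
  forall j, (L (cube x (sc (K + j))) <= (M * (q ^+ j) ^+ n)%:E)%E.

(** The error terms form a geometric progression, kept in closed form so that the induction is
    exact. The radius has index [j + 1] because [average_step] uses the energy of a cube eight times
    larger. *)
Lemma average_telescope x j i : decaying x ->
  (average (sc (K + j.+1)) x <= average (sc (K + (j + i).+1)) x +
     (step_cst M / (1 - q) * (q ^+ j - q ^+ (j + i)))%:E)%E.
Proof.
move=> H; elim: i => [|i IH]; first by rewrite addn0 subrr mulr0 adde0.
apply: le_trans IH _.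
have := average_step (sc_gt0 (K + (j + i).+1)) (exprn_gt0 (j + i) q_gt0) M_ge0.
move=> /(_ x); rewrite addnS exprS mulrA divff// mul1r => /(_ (H _)).
have -> : 8^-1 * sc (K + (j + i)) / 8 = sc (K + (j + i.+1).+1).
  by rewrite !addnS !exprS mulrC.
move=> /(leeD2r (step_cst M / (1 - q) * (q ^+ j - q ^+ (j + i)))%:E) h.
apply: le_trans h _; rewrite -addeA leeD2l// -EFinD lee_fin.
rewrite addnS [q ^+ (j + i).+1]exprS le_eqVlt; apply/orP; left; apply/eqP.
by field; rewrite lt0r_neq0// subr_gt0.
Qed.

(** At a good point the far end of the telescope tends to 0. *)
Lemma average_decay x j : decaying x -> good_point x ->
  (average (sc (K + j.+1)) x <= (step_cst M / (1 - q) * q ^+ j)%:E)%E.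
Proof.
move=> dx gx; apply/lee_addgt0Pr => t t0.
have t20 : 0 < t / 2 by rewrite divr_gt0.
have [k0 Hk0] := gx ((t / 2) ^+ n) (exprn_gt0 _ t20).
have := average_telescope j k0 dx.
have Hk : (k0 <= K + (j + k0).+1)%N by lia.
have := average_le_dens (sc_gt0 _) t20 (Hk0 _ Hk).
rewrite mulrC divfK// => A1 A2; apply: le_trans A2 _.
rewrite addeC; apply: leeD A1.
rewrite lee_fin ler_wpM2l ?gerBl ?exprn_ge0 ?(ltW q_gt0)//.
by rewrite divr_ge0 ?step_cst_ge0// subr_ge0 ltW.
Qed.

(** The average about [y] is taken at a radius eight times larger, so that its cube contains the one
    about [x]; hence the index [j + 2] in the hypothesis. *)
Lemma decaying_pair x y j : decaying x -> decaying y -> good_point x ->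
  good_point y -> cube x (sc (K + j.+2)) y ->
  delta x y <= (1 + 16 ^+ n) * (step_cst M / (1 - q)) * q ^+ j.
Proof.
move=> dx dy gx gy xy; set C := step_cst M / (1 - q).
have C0 : 0 <= C by rewrite divr_ge0 ?step_cst_ge0// subr_ge0 ltW.
have ax : (average (sc (K + j.+2)) x <= (C * q ^+ j)%:E)%E.
  apply: le_trans (average_decay j.+1 dx gx) _; rewrite lee_fin ler_wpM2l// exprS.
  by rewrite ler_piMl ?exprn_ge0 ?(ltW q_gt0) ?(ltW q_lt1).
have ay : (average (8 * sc (K + j.+2)) y <= (C * q ^+ j)%:E)%E.
  by rewrite addnS exprS mulrA divff// mul1r; exact: average_decay.
have Cq : 0 <= C * q ^+ j by rewrite mulr_ge0// exprn_ge0// ltW.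
have := le_average_pair (sc_gt0 _) xy Cq ax ay.
by move=> /le_trans; apply; rewrite le_eqVlt; apply/orP; left; apply/eqP; ring.
Qed.

End decaying.
End averages.

(** * Almost every point is good; Hoelder estimate at good points *)

Section good_points.
Context {R : realType} {n : nat}.
Local Notation T := (lebesgue_rVType R n).
Local Notation mu := (@lebesgue_rV R n).
Variable delta : T -> T -> R.
Hypotheses (n_ge2 : (2 <= n)%N) (delta_pm : measurable_pseudometric delta).
Let n_gt0 : (0 < n)%N. Proof. exact: ltn_trans n_ge2. Qed.
Let nE : (2 * n).-1 = (n + (n.-2).+1)%N. Proof. by move: n_ge2; lia. Qed.
Local Notation L := (liminf_energy delta).
Local Notation dens := (dens delta).
Local Notation ccst := (@chain_cst R n).
Local Notation sc k := ((8^-1 : R) ^+ k).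
Local Notation good_point := (good_point delta).

Lemma exists_small_scale (e : R) : 0 < e -> exists k, sc k < e.
Proof.
move=> e0; exists (Num.truncn e^-1).+1; set k := _.+1.
rewrite exprVn invf_plt ?posrE ?exprn_gt0//.
apply: lt_trans (truncnS_gt _) _; rewrite -/k -natrX ltr_nat; exact: ltn_expl.
Qed.

Let sc_gt0 k : 0 < sc k. Proof. by rewrite exprn_gt0. Qed.

Let le_sc j k : (j <= k)%N -> sc k <= sc j.
Proof. by move=> jk; rewrite ler_wiXn2l// invf_le1// ler1n. Qed.

(** By chaining, the integral of [dens] at scale [s] is [O(s ^ (2 n))]. Divided by [s ^ (2 n - 1)]
    it is summable over the scales [8 ^ -k], so at almost every point [dens] is [O(s ^ (2 n - 1))].
    This is [o(s ^ n)] because [n >= 2]. *)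
Lemma good_point_cube (a : 'rV[R]_n) (r : R) : 0 < r ->
  L (cube a (2 * r)) \is a fin_num ->
  mu.-negligible [set x : T | cube a r x /\ ~ good_point x].
Proof.
move=> r0 Lf; have [l lE] : exists l, L (cube a (2 * r)) = l%:E.
  by eexists; exact: esym (fineK Lf).
have l0 : 0 <= l by rewrite -lee_fin -lE; exact: liminf_energy_ge0.
have r20 : 0 < r / 2 by rewrite divr_gt0.
(* From this scale on, the doubled neighbourhoods of [cube a r] used in chaining stay in
   [cube a (2 * r)]. *)
have [k0 Hk0] := exists_small_scale r20.
have mU : measurable (cube a r : set T) by exact: measurable_cube.
have mV : measurable (cube a (2 * r) : set T) by exact: measurable_cube.
pose w k : R := (sc (k0 + k) ^+ (2 * n).-1)^-1.
have w0 k : 0 < w k by rewrite invr_gt0 exprn_gt0.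
pose g k (x : T) := ((w k)%:E * dens (sc (k0 + k)) x)%E.
have mg k : measurable_fun (cube a r : set T) (g k).
  by apply: measurable_funeM; exact: measurable_dens.
have g0 k x : (0 <= g k x)%E by rewrite mule_ge0 ?dens_ge0// lee_fin ltW.
have Ig k : (\int[mu]_(x in (cube a r : set T)) g k x <=
    ((ccst * l * 2) / (2 ^ k.+1)%:R)%:E)%E.
  have E : (\int[mu]_(x in (cube a r : set T)) g k x =
      (w k)%:E * energy_at delta (sc (k0 + k)) (cube a r))%E.
    apply: (ge0_integralZl_EFin _ mU) (ltW (w0 k)).
      by move=> x _; exact: dens_ge0.
    exact: measurable_dens.
  rewrite {}E.
  have {}H := energy_at_le_liminf n_gt0 delta_pm (sc_gt0 (k0 + k)) mU mV.
  have {}H : (energy_at delta (sc (k0 + k)) (cube a r) <=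
      (ccst * sc (k0 + k) ^+ (2 * n) * l)%:E)%E.
    rewrite [leRHS]EFinM -lE; apply: H => x Ux z Hz.
    have := cube_triangle Ux Hz; apply: le_cube.
    by have := le_sc (leq_addr k k0); lra.
  apply: (@le_trans _ _ ((w k)%:E * (ccst * sc (k0 + k) ^+ (2 * n) * l)%:E)%E).
    by rewrite lee_wpmul2l// lee_fin ltW.
  rewrite -EFinM lee_fin.
  have -> : w k * (ccst * sc (k0 + k) ^+ (2 * n) * l) = ccst * l * sc (k0 + k).
    have nS : (2 * n = (2 * n).-1.+1)%N by rewrite prednK// muln_gt0.
    rewrite /w {2}nS exprS; field; exact: lt0r_neq0 (exprn_gt0 _ _).
  have -> : (2 ^ k.+1)%:R = 2 * 2 ^+ k :> R by rewrite natrX exprS.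
  rewrite invfM mulrA mulfK// ler_wpM2l//.
    by rewrite mulr_ge0//; exact/ltW/chain_cst_gt0.
  apply: le_trans (le_sc (leq_addl k0 k)) _; rewrite exprVn lef_pV2 ?posrE ?exprn_gt0//.
  by apply: lerXn2r; rewrite ?nnegrE// ler_nat.
pose G (x : T) := (\sum_(k <oo) g k x)%E.
have mG : measurable_fun (cube a r : set T) G.
  by apply: ge0_emeasurable_sum.
have G0 x : (0 <= G x)%E by exact: nneseries_ge0.
have IG : mu.-integrable (cube a r : set T) G.
  apply/integrableP; split => //.
  rewrite (eq_integral G); last by move=> x _; rewrite gee0_abs.
  rewrite /G integral_nneseries//.
  apply: (@le_lt_trans _ _ (ccst * l * 2)%:E); last exact: ltry.
  have C0 : 0 <= ccst * l * 2.
    by rewrite mulr_ge0// mulr_ge0//; exact/ltW/chain_cst_gt0.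
  apply: le_trans (epsilon_trick0 xpredT C0); apply: lee_nneseries => // k _ _.
  by apply: integral_ge0.
have := integrable_ae mU IG; apply: negligibleS => x /= [Ux bx].
move=> /(_ Ux) fx; apply: bx => tau tau0.
have [b bE] : exists b, G x = b%:E by eexists; exact: esym (fineK fx).
have b0 : 0 <= b by rewrite -lee_fin -bE.
have b10 : 0 < b + 1 by rewrite ltr_wpDl.
have [k1 Hk1] := exists_small_scale (divr_gt0 tau0 b10).
exists (k0 + k1)%N => k kk.
have [j kE] : exists j, k = (k0 + j)%N.
  by exists (k - k0)%N; rewrite subnKC//; exact: leq_trans (leq_addr _ _) kk.
have k1j : (k1 <= j)%N by move: kk; rewrite kE leq_add2l.
have : (g j x <= b%:E)%E.
  rewrite -bE; apply: le_trans (nneseries_lim_ge j.+1 (fun i _ _ => g0 i x)).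
  by rewrite big_nat_recr//= leeDr// sume_ge0.
rewrite /g -lee_pdivlMl// -kE => /le_trans; apply.
rewrite -EFinM lee_fin /w invrK -kE.
rewrite nE exprD -mulrA [leRHS]mulrC ler_wpM2l ?exprn_ge0 ?(ltW (sc_gt0 _))//.
apply: (@le_trans _ _ (sc k * b)).
  rewrite ler_wpM2r// exprS ler_piMr ?(ltW (sc_gt0 _))//.
  rewrite -exprM; apply: exprn_ile1; first by rewrite invr_ge0.
  by rewrite invf_le1// ler1n.
apply: (@le_trans _ _ (tau / (b + 1) * (b + 1))); last by rewrite divfK// gt_eqF.
apply: ler_pM; rewrite ?b0 ?lerDl ?(ltW (sc_gt0 k))//.
apply: le_trans (ltW Hk1); apply: le_sc; rewrite kE.
by rewrite (leq_trans k1j)// leq_addl.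
Qed.

Variable W : set 'rV[R]_n.
Hypothesis oW : open W.
Hypothesis L_fin : forall (x : 'rV[R]_n) rho, 0 < rho ->
  cube x (4 * rho) `<=` W -> L (cube x rho) \is a fin_num.

Lemma good_point_ae : mu.-negligible [set x : T | W x /\ ~ good_point x].
Proof.
pose ctr (p : 'rV[rat]_n * nat) : 'rV[R]_n := map_mx ratr p.1.
pose rad (p : 'rV[rat]_n * nat) : R := p.2.+1%:R^-1.
pose bad k : set T :=
  if unpickle k is Some p then
    if `[< cube (ctr p) (8 * rad p) `<=` W >]
    then [set x | cube (ctr p) (rad p) x /\ ~ good_point x] else set0
  else set0.
have Hbad : mu.-negligible (\bigcup_k bad k).
  apply: negligible_bigcup => k; rewrite /bad.
  case: (unpickle k) => [p|]; last exact: negligible_set0.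
  case: ifPn => [/asboolP HW|_]; last exact: negligible_set0.
  have r0 : 0 < rad p by rewrite invr_gt0.
  apply: good_point_cube => //; apply: L_fin; first by rewrite mulr_gt0.
  by rewrite mulrA -natrM.
apply: negligibleS Hbad => x [Wx bx].
have [r r0 xr] := openP_cube oW Wx.
(* Nine is eight plus one: the cube of eight times the radius about the rational centre must stay in
   [cube x r], and [x] is within one radius of that centre. *)
have r90 : 0 < r / 9 by rewrite divr_gt0.
pose m := Num.truncn (r / 9)^-1.
have m1 : m.+1%:R^-1 < r / 9.
  by rewrite invf_plt ?posrE// truncnS_gt.
have mp : 0 < m.+1%:R^-1 :> R by rewrite invr_gt0.
have /choice[q Hq] : forall i, exists q : rat, `|ratr q - x ord0 i| < m.+1%:R^-1.
  move=> i; have : x ord0 i - m.+1%:R^-1 < x ord0 i + m.+1%:R^-1.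
    by rewrite ltrBlDr -addrA ltrDl addr_gt0.
  by move=> /rat_in_itvoo[q]; rewrite in_itv/= => Hq; exists q; rewrite ltr_distl.
pose p := (\row_i q i, m); exists (pickle p) => //; rewrite /bad pickleK.
have cx : cube (ctr p) (rad p) x by move=> i; rewrite !mxE; exact: Hq.
case: ifPn => // /asboolP[] y Hy; apply: xr.
have := cube_triangle (cube_sym cx) Hy; apply: le_cube.
by move: m1; rewrite /rad/=; move: m.+1%:R^-1 => a; lra.
Qed.

Variables alpha theta : R.
Hypotheses (alpha_gt0 : 0 < alpha) (thetaE : theta = (8^-1 `^ alpha) ^+ n).
Hypothesis decay : forall (x : 'rV[R]_n) rho k, 0 < rho ->
  cube x (4 * rho) `<=` W ->
  (L (cube x (rho / 8 ^+ k)) <= (theta ^+ k)%:E * L (cube x rho))%E.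

(** Energy decay holds about every [x] near [p] with the same constant, the energy of one cube about
    [p] that contains all the starting cubes. The scale is then matched to the distance of [x] and
    [y]. *)
Lemma good_point_hoelder (p : 'rV[R]_n) : W p -> exists r C : R,
  [/\ 0 < r, 0 <= C, cube p r `<=` W & forall x y : 'rV[R]_n,
    good_point x -> good_point y -> cube p r x -> cube p r y ->
    delta x y <= C * `|x - y| `^ alpha].
Proof.
move=> Wp; have [r r0 pr] := openP_cube oW Wp.
have r80 : 0 < r / 8 by rewrite divr_gt0.
have [K HK] := exists_small_scale r80.
have pK : cube p (8 * sc K) `<=` W by apply: subset_trans pr; apply: le_cube; lra.
have sK := sc_gt0 K.
have [M ME] : exists M, L (cube p (2 * sc K)) = M%:E.
  eexists; apply: esym; apply: fineK; apply: L_fin; first by rewrite mulr_gt0.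
  by rewrite mulrA -natrM.
have M0 : 0 <= M by rewrite -lee_fin -ME; exact: liminf_energy_ge0.
pose q : R := 8^-1 `^ alpha.
have q0 : 0 < q by rewrite powR_gt0.
have q1 : q < 1.
  have <- : 1 `^ alpha = 1 :> R by rewrite powR1.
  rewrite /q; apply: gt0_ltr_powR => //; rewrite ?nnegrE ?invr_ge0//.
  by rewrite invf_lt1// ltr1n.
have qE j : q ^+ j = sc j `^ alpha.
  by rewrite -powR_mulrn ?(ltW q0)// /q -powRrM mulrC powRrM powR_mulrn.
have dec x : cube p (sc K) x -> decaying delta M q K x.
  move=> px j.
  have E : sc (K + j) = sc K / 8 ^+ j by rewrite exprD !exprVn.
  rewrite E.
  apply: le_trans (decay j sK _) _.
    move=> z Hz; apply: pK; have := cube_triangle px Hz; apply: le_cube; lra.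
  rewrite thetaE -/q mulrC EFinM exprAC -ME; apply: lee_wpmul2l.
    by rewrite lee_fin !exprn_ge0// ltW.
  apply: (liminf_energy_mono delta_pm) => //; try exact: measurable_cube.
  move=> z Hz; have := cube_triangle px Hz; apply: le_cube; lra.
pose C := (1 + 16 ^+ n) * (@step_cst R n M / (1 - q)).
have C0 : 0 <= C.
  by rewrite mulr_ge0 ?addr_ge0 ?exprn_ge0// divr_ge0 ?step_cst_ge0// subr_ge0 ltW.
have ppos (a : R) : 0 <= a `^ alpha by exact: powR_ge0.
exists (sc (K + 3)), (C * (8 ^+ (K + 3)) `^ alpha); split => //.
- exact: mulr_ge0.
- apply: subset_trans pK; apply: le_cube; apply: le_trans (le_sc (leq_addr 3 K)) _.
  by lra.
move=> x y gx gy px py.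
have [->|xy] := eqVneq x y.
  rewrite (pm_refl delta_pm); exact: mulr_ge0 (mulr_ge0 C0 (ppos _)) (ppos _).
pose d := `|x - y|; have d0 : 0 < d by rewrite normr_gt0 subr_eq0.
have d2 : d < sc (K + 2).
  apply/(norm_cube _ _ (sc_gt0 _)).
  have := cube_triangle (cube_sym px) py; apply: le_cube.
  by rewrite addnS exprS; have := sc_gt0 (K + 2); lra.
(* The least such [j] also gives [d < sc (K + j.+2)]: by minimality if [j > 0], by [d2] if [j = 0].
   The upper bound feeds [decaying_pair], the lower one converts [q ^+ j] into a power of [d]. *)
have ex : exists j, sc (K + j.+3) <= d.
  have [k Hk] := exists_small_scale d0; exists k; apply: le_trans (ltW Hk).
  by apply: le_sc; rewrite (leq_trans _ (leq_addl _ _))// -addn3 leq_addr.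
have [j Hj Hmin] := ex_minnP ex.
have cj : d < sc (K + j.+2).
  case: j Hmin {Hj} => [//|j] Hmin; rewrite ltNge; apply/negP => /Hmin.
  by rewrite ltnn.
have sub t : cube p (sc (K + 3)) t -> cube p (sc K) t.
  by apply: le_cube; exact: le_sc (leq_addr _ _).
have := decaying_pair n_gt0 delta_pm M0 q0 q1 (dec _ (sub _ px)) (dec _ (sub _ py))
  gx gy.
move=> /(_ j); move/(_ (proj2 (norm_cube x y (sc_gt0 _)) cj)) => /le_trans; apply.
rewrite -/C -mulrA ler_wpM2l// qE -powRM ?exprn_ge0//.
apply: ge0_ler_powR; rewrite ?nnegrE ?(ltW alpha_gt0) ?exprn_ge0 ?mulr_ge0//.
rewrite -ler_pdivrMl ?exprn_gt0// -exprVn -exprD.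
by apply: le_trans Hj; rewrite -addnA (addnC 3) addn3.
Qed.

End good_points.

(** * Extension of a Hoelder map from a dense set *)

Section hoelder_extension.
Context {R : realType} {n : nat} {X : metricType R}.
Hypothesis X_complete : complete_metric X.
Variables (alpha : R) (W G : set 'rV[R]_n) (f : 'rV[R]_n -> X).
Hypothesis alpha_gt0 : 0 < alpha.
Hypothesis dense : forall z r, W z -> 0 < r -> exists2 y, G y & cube z r y.
Hypothesis f_hoelder : forall p, W p -> exists r C : R,
  [/\ 0 < r, 0 <= C & forall x y, G x -> G y -> cube p r x -> cube p r y ->
    mdist (f x) (f y) <= C * `|x - y| `^ alpha].

(** The limit along [G] does not exclude [z] itself, so at points of [G] it is forced to be
    [f z]. *)
Let limit_point (z : 'rV[R]_n) (P : X) := forall tau : R, 0 < tau ->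
  exists2 d, 0 < d & forall y, G y -> cube z d y -> mdist P (f y) < tau.

Let exists_limit z : W z -> exists P, limit_point z P.
Proof.
move=> Wz; have [r [C [r0 C0 H]]] := f_hoelder Wz.
pose F := f @ within G (nbhs z).
have PF : ProperFilter F.
  apply: fmap_proper_filter; apply: Build_ProperFilter_ex => A.
  move=> /nbhs_cubeP[d d0 zA]; have [y Gy zy] := dense Wz d0.
  by exists y; exact: zA.
have : cauchy F.
  apply: cauchy_exP => e e0.
  have C10 : 0 < C + 1 by rewrite ltr_wpDl.
  (* Chosen so that [C * b ^ alpha < e]; the added 1 avoids a division by zero. *)
  pose b := (e / (C + 1)) `^ alpha^-1.
  have b0 : 0 < b by rewrite powR_gt0// divr_gt0.
  have bE : b `^ alpha = e / (C + 1).
    by rewrite /b -powRrM mulVf ?gt_eqF// powRr1// divr_ge0 ?ltW.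
  pose d := Num.min r (b / 2).
  have d0 : 0 < d by rewrite lt_min r0 divr_gt0.
  have [y0 Gy0 zy0] := dense Wz d0.
  exists (f y0); apply/nbhs_cubeP; exists d => // y zy Gy; rewrite /= ballEmdist/=.
  have dr : d <= r by rewrite ge_min lexx.
  have db : d <= b / 2 by rewrite ge_min lexx orbT.
  apply: le_lt_trans (H _ _ Gy0 Gy (le_cube dr zy0) (le_cube dr zy)) _.
  have : `|y0 - y| <= b.
    apply/ltW/(norm_cube _ _ b0); rewrite [b]splitr.
    exact: le_cube (lerD db db) _ (cube_triangle (cube_sym zy0) zy).
  move=> /(ge0_ler_powR (ltW alpha_gt0)); rewrite !nnegrE normr_ge0 (ltW b0).
  move=> /(_ isT isT); rewrite bE => /(ler_wpM2l C0) /le_lt_trans; apply.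
  by rewrite mulrCA gtr_pMr// ltr_pdivrMr// mul1r ltrDl.
move=> /(X_complete PF)[P FP]; exists P => tau tau0.
have : nbhs P (ball P tau) by exact: nbhsx_ballx.
move=> /FP /nbhs_cubeP[d d0 zd]; exists d => // y Gy zy.
by have := zd y zy Gy; rewrite /= ballEmdist.
Qed.

Lemma hoelder_extension : exists v : 'rV[R]_n -> X,
  (forall x, W x -> G x -> v x = f x) /\
  (forall p, W p -> exists r C : R, [/\ 0 < r, 0 <= C &
     forall x y, W x -> W y -> cube p r x -> cube p r y ->
     mdist (v x) (v y) <= C * `|x - y| `^ alpha]).
Proof.
have /choice[v Hv] : forall z, exists P, W z -> limit_point z P.
  move=> z; have [/exists_limit[P HP]|nW] := pselect (W z); first by exists P.
  by exists (f z).
exists v; split.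
  move=> x Wx Gx; apply: mdist_positivity; apply/eqP; rewrite eq_le mdist_ge0 andbT.
  apply/ler_addgt0Pr => t t0; rewrite add0r.
  by have [d d0 H] := Hv x Wx t t0; apply/ltW/H => //; exact: cube_center.
move=> p Wp; have [r [C [r0 C0 H]]] := f_hoelder Wp.
have r20 : 0 < r / 2 by rewrite divr_gt0.
(* Points of [G] approximating [x] and [y] within half their distance are at most twice as far
   apart, hence [2 ^ alpha]; halving [r] keeps them in the cube where [f] is controlled. *)
exists (r / 2), (C * 2 `^ alpha); split => //; first by rewrite mulr_ge0// powR_ge0.
move=> x y Wx Wy px py; have [->|xy] := eqVneq x y.
  by rewrite mdistxx !mulr_ge0// powR_ge0.
pose d := `|x - y|; have d0 : 0 < d by rewrite normr_gt0 subr_eq0.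
have approx z (t : R) : W z -> cube p (r / 2) z -> 0 < t ->
    exists z', [/\ G z', cube p r z', `|z - z'| < d / 2 & mdist (v z) (f z') < t].
  move=> Wz pz t0; have [e e0 He] := Hv z Wz t t0.
  pose m := Num.min e (Num.min (r / 2) (d / 2)).
  have m0 : 0 < m by rewrite !lt_min e0 r20 divr_gt0.
  have [z' Gz' zz'] := dense Wz m0; exists z'; split => //.
  - rewrite [r]splitr; apply: cube_triangle pz _; apply: le_cube zz'.
    by rewrite !ge_min lexx orbT.
  - apply/norm_cube; first by rewrite divr_gt0.
    by apply: le_cube zz'; rewrite !ge_min lexx !orbT.
  - by apply: He => //; apply: le_cube zz'; rewrite ge_min lexx.
apply/ler_addgt0Pr => t t0; have t20 : 0 < t / 2 by rewrite divr_gt0.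
have [x' [Gx' px' xx' Hx]] := approx x _ Wx px t20.
have [y' [Gy' py' yy' Hy]] := approx y _ Wy py t20.
have xy' : `|x' - y'| <= 2 * d.
  have -> : x' - y' = (x' - x) + (x - y) + (y - y').
    by rewrite !addrA subrK subrK.
  apply: le_trans (ler_normD _ _) _.
  have := ler_normD (x' - x) (x - y); rewrite (distrC x' x) -/d.
  by rewrite -/d in xx' yy' *; move: xx' yy' d0; lra.
have := H _ _ Gx' Gy' px' py'.
have : `|x' - y'| `^ alpha <= 2 `^ alpha * d `^ alpha.
  rewrite -powRM ?(ltW d0)//; apply: ge0_ler_powR; rewrite ?nnegrE ?(ltW alpha_gt0)//.
  by rewrite mulr_ge0// ltW.
move=> /(ler_wpM2l C0); rewrite mulrA => h1 h2.
have h3 := metric_triangle (v x) (f x') (v y).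
have h4 := metric_triangle (f x') (f y') (v y).
rewrite (metric_sym (f y')) in h4.
move: h1 h2 h3 h4 Hx Hy.
by move: (C * _) (C * _ * _) => ? ? *; lra.
Qed.

End hoelder_extension.

Lemma negligible_compl_dense {R : realType} {n : nat} (W A : set 'rV[R]_n) z r :
  open W -> W z -> (@lebesgue_rV R n).-negligible (W `\` A) -> 0 < r ->
  exists2 y, A y & cube z r y.
Proof.
move=> oW Wz nA r0; apply: contrapT => H.
have [s s0 zs] := openP_cube oW Wz.
pose t := Num.min r s; have t0 : 0 < t by rewrite lt_min r0 s0.
have tW : cube z t `<=` W.
  by apply: subset_trans zs; apply: le_cube; rewrite ge_min lexx orbT.
have sub : cube z t `<=` W `\` A.
  move=> y zy; split; first exact: tW.
  by move=> Ay; apply: H; exists y => //; apply: le_cube zy; rewrite ge_min lexx.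
have mC : measurable (cube z t : set (lebesgue_rVType R n)).
  exact: measurable_cube.
have nC : (@lebesgue_rV R n).-negligible (cube z t) by exact: negligibleS nA.
have := nC => /(negligibleP _ mC) E.
have := lebesgue_rV_cube_ge z t0; rewrite E lee_fin.
by rewrite leNgt exprn_gt0.
Qed.

Theorem theorem1p2 (R : realType) (n : nat) (Q : R) (n_ge2 : (2 <= n)%N)
    (Q_ge1 : 1 <= Q) :
  exists2 alpha : R, 0 < alpha &
    forall (c : nat -> R -> R) (W : set 'rV[R]_n) (X : metricType R)
      (u : 'rV[R]_n -> X),
      (forall m p, 0 < c m p) ->
      domain W -> NPC X -> quasi_n_harmonic c Q W u ->
      exists2 v : 'rV[R]_n -> X,
        representative W u v & locally_hoelder alpha W v.
Proof.
pose theta : R := @decay_cst R n Q.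
have /andP[th0 th1] : 0 < theta < 1 by exact: decay_cst_itv.
have n0 : 0 < n%:R :> R by rewrite ltr0n; exact: ltn_trans n_ge2.
have ln8 : 0 < ln 8 :> R by rewrite ln_gt0// ltr1n.
(* Built from [n] and [Q] alone, before the normalization, the domain, the target and the map are
   introduced. *)
pose alpha := - ln theta / (n%:R * ln 8).
have alpha0 : 0 < alpha.
  by rewrite divr_gt0 ?mulr_gt0// oppr_gt0 ln_lt0// th0.
have thetaE : theta = (8^-1 `^ alpha) ^+ n.
  rewrite /powR gt_eqF ?invr_gt0// -expRM_natl lnV ?posrE//.
  rewrite (_ : n%:R * _ = ln theta); first by rewrite lnK// posrE.
  by rewrite /alpha; field; rewrite !lt0r_neq0.
exists alpha => // c W X u c_gt0 [_ oW _] npc qh.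
have [[[u_meas u_sep _] _] _] := qh.
have mW : measurable (W : set (lebesgue_rVType R n)) by exact: open_measurable_rV.
have [N [u' [mN N0 u'_mm u'E]]] := measurable_map_modification mW u_meas u_sep.
have pm := measurable_map_pseudometric u'_mm.
have L_fin := liminf_energy_fin n_ge2 c_gt0 oW u'_mm mN N0 u'E qh.
have decay := energy_decay n_ge2 Q_ge1 c_gt0 npc oW u'_mm mN N0 u'E qh.
have bad := good_point_ae n_ge2 pm oW L_fin.
have hoelder := good_point_hoelder n_ge2 pm oW L_fin alpha0 thetaE decay.
(* Removing [N] makes the modification equal to [u] on the dense set, so that the extension
   represents [u]. *)
pose G : set 'rV[R]_n :=
  [set x | ~ N x /\ good_point (fun x y => mdist (u' x) (u' y)) x].
have nG : (@lebesgue_rV R n).-negligible (W `\` G).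
  have nN : (@lebesgue_rV R n).-negligible N by apply/negligibleP.
  apply: negligibleS (negligibleU nN bad) => x [Wx nGx].
  by have [Nx|Nx] := pselect (N x); [left|right; split => // gx; exact: nGx].
have [X_complete _ _] := npc.
have [||v [vE v_hoelder]] := hoelder_extension X_complete (W := W) (G := G)
  (f := u') alpha0.
- by move=> z r Wz; exact: negligible_compl_dense oW Wz nG.
- move=> p Wp; have [r [C [r0 C0 _ H]]] := hoelder p Wp.
  by exists r, C; split => // x y [_ gx] [_ gy]; exact: H.
exists v.
  apply: negligibleS nG => x /= /not_implyP[Wx vx]; split => // Gx; apply: vx.
  by rewrite vE//; case: Gx => Nx _; exact: u'E.
move=> p Wp; have [r [C [r0 C0 H]]] := v_hoelder p Wp.
exists (cube p r); first by apply/nbhs_cubeP; exists r.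
exists C => y z [Wy py] [Wz pz]; apply: le_trans (H y z Wy Wz py pz) _.
(* The estimate so far uses the sup norm, which the Euclidean norm dominates. *)
rewrite ler_wpM2l//; apply: ge0_ler_powR; rewrite ?nnegrE ?(ltW alpha0)//.
  exact: sqrtr_ge0.
exact: norm_le_enorm.
Qed.
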